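(* Let $n\ge 2$, $\alpha\in\,]0,1[$, $T>0$, and let $\Omega$ be a bounded open subset of $\mathbb{R}^n$ of class $C^{1,\alpha}$. Let $\mu\in C_0^0([0,T]\times\partial\Omega)$. If $\left(\pm\tfrac12 I+W^*_{\partial\Omega}\right)[\mu]\in C_0^{\frac{\alpha}{2};\alpha}([0,T]\times\partial\Omega)$ (for a choice of sign), then $\mu\in C_0^{\frac{\alpha}{2};\alpha}([0,T]\times\partial\Omega)$.
   Context: $C_0^0([0,T]\times\partial\Omega)$ denotes continuous functions on $[0,T]\times\partial\Omega$ vanishing at $t=0$; $C_0^{\frac{\alpha}{2};\alpha}([0,T]\times\partial\Omega)$ denotes those which moreover are $\frac{\alpha}{2}$-Hölder in $t$ uniformly in $x$ and $\alpha$-Hölder in $x$ uniformly in $t$. $S_n(t,x)=(4\pi t)^{-n/2}e^{-|x|^2/(4t)}$ for $t>0$, $S_n=0$ for $t\le0$, and $W^*_{\partial\Omega}[\mu](t,x)=\int_0^t\int_{\partial\Omega}\frac{\partial}{\partial\nu_\Omega(x)}S_n(t-\tau,x-y)\mu(\tau,y)\,d\sigma_y\,d\tau$ for $(t,x)\in[0,T]\times\partial\Omega$, where $\nu_\Omega$ is the outward unit normal to $\partial\Omega$. *)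

(* Defs.v *)
From HB Require Import structures.
From mathcomp Require Import all_boot all_order all_algebra.
From mathcomp Require Import all_classical all_reals all_analysis.
Set Implicit Arguments. Unset Strict Implicit. Unset Printing Implicit Defensive.
Import Order.TTheory GRing.Theory Num.Theory.
Import numFieldNormedType.Exports.
Local Open Scope classical_set_scope.
Local Open Scope ring_scope.

Section Defs.
Variable R : realType.

Definition edot {n} (u v : 'rV[R]_n) : R := \sum_(i < n) u ord0 i * v ord0 i.
Definition enorm {n} (u : 'rV[R]_n) : R := Num.sqrt (edot u u).

Definition bdry {n} (A : set 'rV[R]_n) : set 'rV[R]_n := closure A `\` interior A.

Definition bounded_open_set {n} (A : set 'rV[R]_n) : Prop :=
  open A /\ exists M : R, forall x, A x -> enorm x <= M.

Definition C1alpha_fun {n} (alpha : R) (g : 'rV[R]_n -> R^o) : Prop :=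
  (forall x, differentiable g x) /\
  exists C : R, forall x y v : 'rV[R]_n,
    `|'d g x v - 'd g y v| <= C * enorm v * powR (enorm (x - y)) alpha.

(* bounded open set of class C^{1,alpha}: near each boundary point p, Omega is
   the subgraph {x . e < g(x - (x . e) e)} of a C^{1,alpha} function of the
   component of x orthogonal to a unit vector e. *)
Definition C1alpha_domain {n} (alpha : R) (Omega : set 'rV[R]_n) : Prop :=
  bounded_open_set Omega /\
  forall p, bdry Omega p ->
    exists (e : 'rV[R]_n) (r : R) (g : 'rV[R]_n -> R^o),
      [/\ enorm e = 1, 0 < r, C1alpha_fun alpha g &
          forall x, enorm (x - p) < r ->
            (Omega x <-> edot x e < g (x - edot x e *: e))].

Definition outward_unit_normal {n} (Omega : set 'rV[R]_n) (x v : 'rV[R]_n) : Prop :=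
  enorm v = 1 /\
  forall eps : R, 0 < eps -> exists delta : R, 0 < delta /\
    forall y, enorm (y - x) < delta ->
      (Omega y -> edot (y - x) v <= eps * enorm (y - x)) /\
      (~ closure Omega y -> - (eps * enorm (y - x)) <= edot (y - x) v).

Definition outward_normal_field {n} (Omega : set 'rV[R]_n) (nu : 'rV[R]_n -> 'rV[R]_n) :=
  forall x, bdry Omega x -> outward_unit_normal Omega x (nu x).

Fixpoint unit_ball_vol (k : nat) : R :=
  match k with
  | 0%N => 1
  | 1%N => 2
  | (k'.+2)%N => (2 * pi / k'.+2%:R) * unit_ball_vol k'
  end.

Definition ediam {n} (C : set 'rV[R]_n) : \bar R :=
  ereal_sup [set (enorm (x - y))%:E | x in C & y in C].

Definition hausdorff_delta {n} (s : nat) (delta : R) (A : set 'rV[R]_n) : \bar R :=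
  ereal_inf [set (\sum_(0 <= k <oo) (unit_ball_vol s * (fine (ediam (F k)) / 2) ^+ s)%:E)%E
            | F in [set F : nat -> set 'rV[R]_n |
                   A `<=` \bigcup_k F k /\ forall k, (ediam (F k) <= delta%:E)%E]].

Definition hausdorff {n} (s : nat) (A : set 'rV[R]_n) : \bar R :=
  ereal_sup [set hausdorff_delta s delta A | delta in [set delta : R | 0 < delta]].

Local Notation Borel n := (@g_sigma_algebraType 'rV[R]_n (@open 'rV[R]_n)).

Definition surface_measure {n} (Omega : set 'rV[R]_n)
  (sigma : {measure set (Borel n) -> \bar R}) : Prop :=
  forall A : set (Borel n), measurable A ->
    sigma A = hausdorff n.-1 (A `&` bdry Omega).

Definition heat_kernel (n : nat) (t : R) (x : 'rV[R]_n) : R :=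
  if 0 < t then powR (4 * pi * t) (- (n%:R / 2)) * expR (- (enorm x ^+ 2 / (4 * t)))
  else 0.

Definition Wstar {n} (sigma : {measure set (Borel n) -> \bar R})
  (Omega : set 'rV[R]_n) (nu : 'rV[R]_n -> 'rV[R]_n) (mu : R -> 'rV[R]_n -> R)
  (t : R) (x : 'rV[R]_n) : R :=
  Rintegral lebesgue_measure `[0, t]%classic (fun tau =>
    Rintegral sigma (bdry Omega : set (Borel n)) (fun y : Borel n =>
      'D_(nu x) (fun z : 'rV[R]_n => heat_kernel (t - tau) (z - y)) x * mu tau y)).

Definition C00 {n} (T : R) (Omega : set 'rV[R]_n) (f : R -> 'rV[R]_n -> R) : Prop :=
  {within [set p : R * 'rV[R]_n | `[0, T]%classic p.1 /\ bdry Omega p.2],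
     continuous (fun p : R * 'rV[R]_n => f p.1 p.2)} /\
  forall x, bdry Omega x -> f 0 x = 0.

Definition C0holder {n} (alpha T : R) (Omega : set 'rV[R]_n) (f : R -> 'rV[R]_n -> R) : Prop :=
  [/\ C00 T Omega f,
      exists C : R, forall t s x, `[0, T]%classic t -> `[0, T]%classic s -> bdry Omega x ->
        `|f t x - f s x| <= C * powR `|t - s| (alpha / 2) &
      exists C : R, forall t x y, `[0, T]%classic t -> bdry Omega x -> bdry Omega y ->
        `|f t x - f t y| <= C * powR (enorm (x - y)) alpha].

End Defs.

Notation Borel R n := (@g_sigma_algebraType 'rV[R]_n (@open 'rV[R]_n)).

(* Main.v *)
(* Since [mu] is a multiple of [f - W*[mu]], where [f] is the given Hoelder function, it
   suffices that [W*] gains regularity on bounded densities. Cutting the time integral at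
   [t - tau = |t - t'|], resp. [t - tau = |x - x'|^2], and using
   [|nu(x) . (x - y)| <= K |x - y|^(1 + alpha)], one obtains the Hoelder bound in time, and
   the one in space up to the term
     [int int (nu(x) - nu(x')) . grad S_n(t - tau, x - y) mu(tau, y)].
   Its inner integral has size [|x - x'|^alpha (t - tau)^(-1)], which just fails to be
   integrable in time.
   Giving up half of the exponent in [|x - x'|] makes it integrable, so [mu] is
   [alpha / 2]-Hoelder in space. For such [mu] the difference [mu(tau, y) - mu(tau, x)] gains
   [(t - tau)^(alpha / 4)], while the integral of [grad S_n] against the constant
   [mu(tau, x)] gains the same power because the kernel is almost odd under an almost
   isometric involution of the boundary near [x]. Hence [mu] is [alpha]-Hoelder. *)
Require Import Defs.
From HB Require Import structures.
From mathcomp Require Import all_boot all_order all_algebra.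
From mathcomp Require Import all_classical all_reals all_analysis.
From mathcomp Require Import measurable_realfun.
From mathcomp Require Import ring lra.
Set Implicit Arguments. Unset Strict Implicit. Unset Printing Implicit Defensive.
Import Order.TTheory GRing.Theory Num.Theory.
Import numFieldNormedType.Exports.
Local Open Scope classical_set_scope.
Local Open Scope ring_scope.

(** * The Euclidean norm and elementary inequalities *)

Section Euclid.
Variables (R : realType) (n : nat).
Implicit Types (u v w x y : 'rV[R]_n) (a : R).

(** The measure [sigma] is known only as a Hausdorff measure, so two facts about Hausdorff measure
    replace the area formula. Covering nearly flat pieces by grids gives mass of order r^(n-1) to
    balls of radius r, hence uniformly bounded Gaussian integrals; Lipschitz distortion makes the
    involution almost measure preserving. The involution is the point reflection in [x], corrected
    along the axis of a chart so that it maps the graph to itself. The correction is a symmetric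
    second difference of the graph function, which at distance d from [x] has size d^alpha relative
    to that distance. With s the elapsed time, the cancellation on a ball of radius d is thus
    spoiled by a relative error d^alpha, while beyond d the kernel improves by s^(alpha/2)
    d^(-alpha). Both equal s^(alpha/4) when d = s^(1/4): this is the origin of alpha/4. A density
    that is (alpha/2)-Hoelder in space gains exactly the same power, so that a single repetition
    reaches the full exponent. *)

Lemma edotE u v : edot u v = \sum_(i < n) u ord0 i * v ord0 i.
Proof. by []. Qed.

Lemma edotC u v : edot u v = edot v u.
Proof. by apply: eq_bigr => i _; rewrite mulrC. Qed.

Lemma edotDl u v w : edot (u + v) w = edot u w + edot v w.
Proof. by rewrite -big_split; apply: eq_bigr => i _ /=; rewrite mxE mulrDl. Qed.

Lemma edotZl a u v : edot (a *: u) v = a * edot u v.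
Proof. by rewrite mulr_sumr; apply: eq_bigr => i _; rewrite mxE mulrA. Qed.

Lemma edotNl u v : edot (- u) v = - edot u v.
Proof. by rewrite -scaleN1r edotZl mulN1r. Qed.

Lemma edotBl u v w : edot (u - v) w = edot u w - edot v w.
Proof. by rewrite edotDl edotNl. Qed.

Lemma edotDr u v w : edot w (u + v) = edot w u + edot w v.
Proof. by rewrite edotC edotDl !(edotC w). Qed.

Lemma edotZr a u v : edot u (a *: v) = a * edot u v.
Proof. by rewrite edotC edotZl edotC. Qed.

Lemma edotNr u v : edot u (- v) = - edot u v.
Proof. by rewrite edotC edotNl edotC. Qed.

Lemma edotBr u v w : edot w (u - v) = edot w u - edot w v.
Proof. by rewrite edotDr edotNr. Qed.

Lemma edot0l u : edot 0 u = 0.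
Proof. by rewrite -(scale0r u) edotZl mul0r. Qed.

Lemma edot_ge0 u : 0 <= edot u u.
Proof. by apply: sumr_ge0 => i _; rewrite -expr2 sqr_ge0. Qed.

Lemma enorm_ge0 u : 0 <= enorm u. Proof. exact: sqrtr_ge0. Qed.

Lemma enorm_sqr u : enorm u ^+ 2 = edot u u.
Proof. by rewrite sqr_sqrtr ?edot_ge0. Qed.

Lemma edot_eq0 u : edot u u = 0 -> u = 0.
Proof.
move=> /eqP; rewrite psumr_eq0 => [/allP u0|i _]; last by rewrite -expr2 sqr_ge0.
apply/rowP => i; rewrite mxE; apply/eqP.
by have := u0 i (mem_index_enum _); rewrite -expr2 sqrf_eq0.
Qed.

Lemma enorm_eq0 u : enorm u = 0 -> u = 0.
Proof. by move=> u0; apply: edot_eq0; rewrite -enorm_sqr u0 expr0n. Qed.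

Lemma enorm0 : enorm (0 : 'rV[R]_n) = 0.
Proof. by rewrite /enorm edot0l sqrtr0. Qed.

Lemma enormZ a u : enorm (a *: u) = `|a| * enorm u.
Proof. by rewrite /enorm edotZl edotZr mulrA -expr2 sqrtrM ?sqr_ge0 // sqrtr_sqr. Qed.

Lemma enormN u : enorm (- u) = enorm u.
Proof. by rewrite -scaleN1r enormZ normrN1 mul1r. Qed.

Lemma enormBC u v : enorm (u - v) = enorm (v - u).
Proof. by rewrite -enormN opprB. Qed.

Lemma cauchy_schwarz u v : `|edot u v| <= enorm u * enorm v.
Proof.
have [->|v0] := eqVneq v 0; first by rewrite edotC edot0l normr0 mulr_ge0 ?enorm_ge0.
have vv : 0 < edot v v.
  rewrite lt_def edot_ge0 andbT; apply: contra v0 => /eqP /edot_eq0 ->; exact/eqP.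
rewrite -(@ler_pXn2r _ 2) ?nnegrE ?mulr_ge0 ?enorm_ge0 //.
rewrite real_normK ?num_real // exprMn !enorm_sqr.
have := edot_ge0 (edot v v *: u - edot u v *: v).
rewrite !(edotBl, edotBr, edotZl, edotZr) (edotC v u) => h.
have : 0 <= edot v v * (edot u u * edot v v - edot u v ^+ 2) by move: h; nra.
by rewrite pmulr_rge0 // subr_ge0.
Qed.

Lemma edot_le u v : edot u v <= enorm u * enorm v.
Proof. exact: le_trans (ler_norm _) (cauchy_schwarz u v). Qed.

Lemma enormD u v : enorm (u + v) <= enorm u + enorm v.
Proof.
rewrite -(@ler_pXn2r _ 2) ?nnegrE ?addr_ge0 ?enorm_ge0 //.
rewrite enorm_sqr sqrrD !enorm_sqr !(edotDl, edotDr) (edotC v u).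
have := edot_le u v; lra.
Qed.

Lemma enormB u v : enorm (u - v) <= enorm u + enorm v.
Proof. by rewrite -(enormN v) enormD. Qed.

Lemma enorm_tri u v w : enorm (u - w) <= enorm (u - v) + enorm (v - w).
Proof. by have := enormD (u - v) (v - w); rewrite addrA subrK. Qed.

Lemma coord_le_enorm u i : `|u ord0 i| <= enorm u.
Proof.
rewrite -sqrtr_sqr ler_wsqrtr // /edot (bigD1 i) //= -expr2 lerDl.
by apply: sumr_ge0 => j _; rewrite -expr2 sqr_ge0.
Qed.

Lemma enorm_le_sum u : enorm u <= \sum_i `|u ord0 i|.
Proof.
have s0 : 0 <= \sum_i `|u ord0 i| by apply: sumr_ge0.
rewrite -(@ler_pXn2r _ 2) ?nnegrE ?enorm_ge0 // enorm_sqr expr2 mulr_sumr.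
apply: ler_sum => i _; apply: (@le_trans _ _ (`|u ord0 i| * `|u ord0 i|)).
  by rewrite -normrM ler_norm.
by rewrite ler_wpM2r // (bigD1 i) //= lerDl sumr_ge0.
Qed.

Lemma norm_le_enorm u : `|u| <= enorm u.
Proof.
rewrite /Num.norm /= mx_normrE; apply/bigmax_leP; split=> [|[i j] _] /=.
  exact: enorm_ge0.
by rewrite (ord1 i) coord_le_enorm.
Qed.

Lemma coord_le_norm u i : `|u ord0 i| <= `|u|.
Proof.
rewrite {2}/Num.norm /= mx_normrE.
exact: (@le_bigmax _ _ _ 0 (fun ij : 'I_1 * 'I_n => `|u ij.1 ij.2|) (ord0, i)).
Qed.

Lemma enorm_le_norm u : enorm u <= n%:R * `|u|.
Proof.
apply: (le_trans (enorm_le_sum u)).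
apply: (@le_trans _ _ (\sum_(i < n) `|u|)); first by apply: ler_sum => i _; exact: coord_le_norm.
by rewrite sumr_const card_ord mulr_natl.
Qed.

Lemma near_enorm x (r : R) : 0 < r -> \forall y \near x, enorm (y - x) < r.
Proof.
move=> r0; pose e := r / n.+1%:R.
have e0 : 0 < e by rewrite divr_gt0.
apply/nbhs_ballP; exists e => //= y; rewrite -ball_normE /= => xy.
apply: (le_lt_trans (enorm_le_norm _)); rewrite distrC in xy.
apply: (@le_lt_trans _ _ (n.+1%:R * `|y - x|)); first by rewrite ler_wpM2r // ler_nat.
by rewrite mulrC -ltr_pdivlMr.
Qed.

Lemma nbhs_enorm x (A : set 'rV[R]_n) : nbhs x A ->
  exists2 r : R, 0 < r & forall y, enorm (y - x) < r -> A y.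
Proof.
move=> /nbhs_ballP[r r0 rA]; exists r => // y xy; apply: rA; rewrite -ball_normE /=.
by rewrite distrC (le_lt_trans (norm_le_enorm _)).
Qed.

Lemma enorm_continuous : continuous (@enorm R n).
Proof.
move=> x; apply/(@cvgrPdist_lt _ R^o _ (nbhs x) (nbhs_filter x)) => e e0; near=> y.
apply: (@le_lt_trans _ _ (enorm (y - x))); last by near: y; exact: near_enorm.
rewrite ler_norml; apply/andP; split.
  have := enormD (y - x) x; rewrite subrK; lra.
by have := enormD (x - y) y; rewrite subrK enormBC; lra.
Unshelve. all: by end_near. Qed.

Lemma edot_continuous v : continuous (fun u => edot u v).
Proof.
move=> x; apply/(@cvgrPdist_lt _ R^o _ (nbhs x) (nbhs_filter x)) => e e0; near=> y.
rewrite /= -edotBl; apply: le_lt_trans (cauchy_schwarz _ _) _.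
apply: (@le_lt_trans _ _ (enorm (y - x) * (enorm v + 1))).
  by rewrite enormBC ler_wpM2l ?enorm_ge0 // lerDl.
rewrite -ltr_pdivlMr; last by rewrite ltr_wpDl ?enorm_ge0.
by near: y; apply: near_enorm; rewrite divr_gt0 // ltr_wpDl ?enorm_ge0.
Unshelve. all: by end_near. Qed.

Lemma normalize_lip u w : 1 <= enorm u -> 1 <= enorm w ->
  enorm ((enorm u)^-1 *: u - (enorm w)^-1 *: w) <= 2 * enorm (u - w).
Proof.
move=> u1 w1; set a := enorm u in u1 *; set b := enorm w in w1 *.
have -> : a^-1 *: u - b^-1 *: w = a^-1 *: (u - w) + (a^-1 - b^-1) *: w.
  by rewrite scalerBr scalerBl addrA subrK.
apply: (le_trans (enormD _ _)); rewrite !enormZ -/b.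
have ab : `|b - a| <= enorm (u - w).
  rewrite /a /b ler_norml; apply/andP; split.
    by have := enormD (u - w) w; rewrite subrK; lra.
  by have := enormB u (u - w); rewrite subKr; lra.
have -> : `|a^-1 - b^-1| * b = `|b - a| / a.
  have -> : a^-1 - b^-1 = (b - a) / (a * b) by field; lra.
  rewrite normrM normfV [in X in _ / X]ger0_norm; last by apply: mulr_ge0; lra.
  by field; lra.
rewrite ger0_norm; last by rewrite invr_ge0; lra.
have ai : a^-1 <= 1 by rewrite invf_le1 //; lra.
have ai0 : 0 <= a^-1 by rewrite invr_ge0; lra.
have := enorm_ge0 (u - w); have := normr_ge0 (b - a).
by move: ab; set t := enorm _; set q := `|_|; nra.
Qed.

End Euclid.

Section Elementary.
Variable R : realType.
Implicit Types a b c k w x y : R.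

Lemma expRN_lip a b : `|expR (- a) - expR (- b)| <= `|a - b| * expR (- Num.min a b).
Proof.
wlog ab : a b / a <= b.
  move=> h; case/orP: (le_total a b) => [ab|ba]; first exact: h.
  by rewrite distrC (distrC a) minC; apply: h.
rewrite (min_idPl ab) ger0_norm ?subr_ge0 ?ler_expR ?lerN2 //.
rewrite ler0_norm ?subr_le0 // opprB.
have -> : expR (- b) = expR (- a) * expR (a - b).
  by rewrite -expRD; congr expR; ring.
have := expR_ge1Dx (a - b); have := expR_gt0 (- a).
by move=> h1 h2; nra.
Qed.

(** Half of the exponential pays for the power: the inequality u <= exp u at u = w/(2k), raised to
    the power k, bounds w^k by (2k)^k exp(w/2). *)
Lemma powR_absorb k : 0 <= k -> exists2 C, 0 < C &
  forall w, 0 <= w -> w `^ k * expR (- w) <= C * expR (- (w / 2)).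
Proof.
rewrite le_eqVlt => /predU1P[<-|k0].
  exists 1 => // w w0; rewrite powRr0 !mul1r ler_expR lerN2; lra.
exists ((2 * k) `^ k) => [|w w0]; first by apply: powR_gt0; lra.
have h : w `^ k <= (2 * k) `^ k * expR (w / 2).
  have -> : expR (w / 2) = expR (w / (2 * k)) `^ k.
    by rewrite -expRM; congr expR; field; lra.
  rewrite -powRM ?expR_ge0 ?mulr_ge0 ?(ltW k0) //.
  apply: ge0_ler_powR; rewrite ?nnegrE ?(ltW k0) ?mulr_ge0 ?expR_ge0 ?(ltW k0) //.
  rewrite {1}(_ : w = 2 * k * (w / (2 * k))); last by field; lra.
  rewrite ler_pM2l ?mulr_gt0 //.
  by apply: le_trans (expR_ge1Dx _); rewrite lerDr.
apply: (le_trans (ler_wpM2r (expR_ge0 _) h)).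
by rewrite -mulrA -expRD ler_pM2l ?powR_gt0 ?mulr_gt0 // ler_expR; lra.
Qed.

(** After scaling by [s] this is the Bernoulli-type inequality 1 - p u <= (1 + u)^(-p) for u = h/s,
    which follows from 1 + y <= exp y and ln (1 + u) <= u. *)
Lemma powRN_lip (p s h : R) : 0 <= p -> 0 < s -> 0 <= h ->
  `|(s + h) `^ (- p) - s `^ (- p)| <= p * h * s `^ (- p - 1).
Proof.
move=> p0 s0 h0.
have sh : 0 < s + h by lra.
have le1 : (s + h) `^ (- p) <= s `^ (- p).
  rewrite !powRN lef_pV2 ?posrE ?powR_gt0 // ge0_ler_powR ?nnegrE; lra.
rewrite distrC ger0_norm ?subr_ge0 //.
have -> : s `^ (- p - 1) = s `^ (- p) / s.
  by rewrite powRB ?powRr1 ?(ltW s0) // (gt_eqF s0) implybT.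
have -> : s + h = s * (1 + h / s) by field; lra.
have hs : 0 <= h / s by rewrite divr_ge0 // ltW.
rewrite powRM ?addr_ge0 ?(ltW s0) //.
have h1 : 1 - p * (h / s) <= (1 + h / s) `^ (- p).
  rewrite /powR gt_eqF; last by lra.
  apply: le_trans (expR_ge1Dx _).
  have : ln (1 + h / s) <= h / s by apply: le_ln1Dx; lra.
  by nra.
have := powR_gt0 (- p) s0; set P := s `^ _ => P0.
have -> : p * h * (P / s) = P * (p * (h / s)) by ring.
by nra.
Qed.

End Elementary.

(** * Hausdorff measure *)

Section Hausdorff.
Variables (R : realType) (n : nat).
Implicit Types (A B C : set 'rV[R]_n) (d L : R).

Lemma ediam_le C d : 0 <= d -> (forall x y, C x -> C y -> enorm (x - y) <= d) ->
  (ediam C <= d%:E)%E /\ fine (ediam C) <= d.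
Proof.
move=> d0 Cd.
have h : (ediam C <= d%:E)%E.
  by apply/ereal_supP => _ [x Cx [y Cy <-]]; rewrite lee_fin; exact: Cd.
split => //; move: h; case: (ediam C) => //= r; exact.
Qed.

Lemma enorm_le_ediam C d x y : (ediam C <= d%:E)%E -> C x -> C y ->
  enorm (x - y) <= fine (ediam C).
Proof.
move=> Cd Cx Cy.
have : ((enorm (x - y))%:E <= ediam C)%E by apply: ereal_sup_ubound; exists x => //; exists y.
by move: Cd; case: (ediam C) => //= r _; rewrite lee_fin.
Qed.

Lemma fine_ediam_ge0 C : 0 <= fine (ediam C).
Proof.
have [->|/set0P[x Cx]] := eqVneq C set0.
  (* A supremum over the empty set is [-oo], which [fine] turns into 0. *)
  rewrite (_ : ediam set0 = -oo%E) //; apply/eqP; rewrite -leeNy_eq.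
  by apply/ereal_supP => _ [? []].
have : ((enorm (x - x))%:E <= ediam C)%E by apply: ereal_sup_ubound; exists x => //; exists x.
by rewrite subrr enorm0; exact: fine_ge0.
Qed.

Lemma unit_ball_vol_ge0 k : 0 <= unit_ball_vol R k.
Proof.
elim/ltn_ind: k => -[|[|k]] IH //=.
by rewrite mulr_ge0 ?divr_ge0 ?mulr_ge0 ?pi_ge0 // IH.
Qed.

(** A cover of [A] of mesh [d / L] is pushed to a cover of [B] of mesh [d]. Its cells are first cut
    with [A], because [f] is Lipschitz only there. *)
Lemma hausdorff_lipschitz s L (f : 'rV[R]_n -> 'rV[R]_n) A B : 0 < L ->
  B `<=` f @` A ->
  (forall x y, A x -> A y -> enorm (f x - f y) <= L * enorm (x - y)) ->
  (hausdorff s B <= (L ^+ s)%:E * hausdorff s A)%E.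
Proof.
move=> L0 BfA fL; apply/ereal_supP => _ [d /= d0 <-].
have dL0 : 0 < d / L by rewrite divr_gt0.
apply: (@le_trans _ _ ((L ^+ s)%:E * hausdorff_delta s (d / L) A)%E); last first.
  by rewrite lee_pmul2l ?lte_fin ?exprn_gt0 //; apply: ereal_sup_ubound; exists (d / L).
rewrite -lee_pdivrMl ?exprn_gt0 //; apply/ereal_infP => _ [F [/= AF Fd] <-].
rewrite lee_pdivrMl ?exprn_gt0 //.
pose F' k := f @` (F k `&` A).
have F'd k x y : F' k x -> F' k y -> enorm (x - y) <= L * fine (ediam (F k)).
  move=> [x' [Fx Ax] <-] [y' [Fy Ay] <-]; apply: (le_trans (fL _ _ Ax Ay)).
  by rewrite ler_pM2l //; exact: enorm_le_ediam (Fd k) Fx Fy.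
have Fk0 k : 0 <= L * fine (ediam (F k)) by rewrite mulr_ge0 ?fine_ediam_ge0 ?(ltW L0).
have le_d k : L * fine (ediam (F k)) <= d.
  rewrite mulrC -ler_pdivlMr //.
  by move: (Fd k); case: (ediam (F k)) => //= r; rewrite ltW.
apply: ge_ereal_inf.
exists (\sum_(0 <= k <oo) (unit_ball_vol R s * (fine (ediam (F' k)) / 2) ^+ s)%:E)%E.
  exists F' => //; split.
    move=> _ /BfA[x Ax <-]; have [k _ Fx] := AF _ Ax.
    by exists k => //; exists x.
  move=> k; have [h _] := ediam_le (Fk0 k) (@F'd k).
  by apply: (le_trans h); rewrite lee_fin.
rewrite -nneseriesZl; last first.
  move=> k _; rewrite lee_fin mulr_ge0 ?unit_ball_vol_ge0 // exprn_ge0 // divr_ge0 //.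
  exact: fine_ediam_ge0.
apply: lee_nneseries => k _.
  rewrite lee_fin mulr_ge0 ?unit_ball_vol_ge0 // exprn_ge0 // divr_ge0 //.
  exact: fine_ediam_ge0.
rewrite -EFinM lee_fin mulrCA ler_wpM2l ?unit_ball_vol_ge0 // -exprMn.
apply: lerXn2r; rewrite ?nnegrE ?mulr_ge0 ?divr_ge0 ?fine_ediam_ge0 ?(ltW L0) //.
by rewrite mulrA ler_pM2r ?invr_gt0 //; exact: (ediam_le (Fk0 k) (@F'd k)).2.
Qed.

Lemma hausdorff_delta_finite_cover s d e (I : finType) (F : I -> set 'rV[R]_n) A :
  (0 < s)%N -> 0 <= e <= d -> A `<=` \bigcup_i F i ->
  (forall i x y, F i x -> F i y -> enorm (x - y) <= e) ->
  (hausdorff_delta s d A <= (#|I|%:R * (unit_ball_vol R s * (e / 2) ^+ s))%:E)%E.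
Proof.
move=> s0 /andP[e0 ed] AF Fe.
(* The finite family is padded with empty sets. Their terms are powers of 0 and vanish because
   [0 < s]. *)
pose F' k := if insub k is Some j then F (enum_val (j : 'I_#|I|)) else set0.
have F'e k x y : F' k x -> F' k y -> enorm (x - y) <= e.
  by rewrite /F'; case: insubP => // j _ _; exact: Fe.
apply: ge_ereal_inf.
exists (\sum_(0 <= k <oo) (unit_ball_vol R s * (fine (ediam (F' k)) / 2) ^+ s)%:E)%E.
  exists F' => //; split.
    move=> x /AF[i _ Fix]; exists (enum_rank i) => //.
    rewrite /F' insubT //= => h.
    by rewrite (_ : Sub _ _ = enum_rank i) ?enum_rankK //; exact: val_inj.
  by move=> k; apply: (le_trans (ediam_le e0 (@F'e k)).1); rewrite lee_fin.
have nn k : (0 <= (unit_ball_vol R s * (fine (ediam (F' k)) / 2) ^+ s)%:E)%E.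
  rewrite lee_fin mulr_ge0 ?unit_ball_vol_ge0 // exprn_ge0 // divr_ge0 //.
  exact: fine_ediam_ge0.
rewrite (nneseries_split 0 #|I|) // add0n [X in (_ + X)%E]eseries0 => [|k Ik _].
  rewrite adde0 sumEFin lee_fin mulr_natl.
  rewrite big_mkord.
  apply: (@le_trans _ _ (\sum_(i < #|I|) unit_ball_vol R s * (e / 2) ^+ s)); last first.
    by rewrite sumr_const card_ord.
  apply: ler_sum => i _.
  rewrite ler_wpM2l ?unit_ball_vol_ge0 //.
  apply: lerXn2r; rewrite ?nnegrE ?divr_ge0 ?fine_ediam_ge0 //.
  by rewrite ler_pM2r ?invr_gt0 //; exact: (ediam_le e0 (@F'e i)).2.
rewrite /F' insubF; last by rewrite ltnNge Ik.
rewrite (_ : ediam set0 = -oo%E) /= ?mul0r ?expr0n ?gtn_eqF ?mulr0 //.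
by apply/eqP; rewrite -leeNy_eq; apply/ereal_supP => _ [? []].
Qed.

End Hausdorff.

(** * Local charts and almost reflections *)

Section Line.
Variables (R : realType) (n : nat).
Implicit Types (a b : 'rV[R]_n) (f g : 'rV[R]_n -> R^o).

Lemma line_is_derive f a b (t : R) : differentiable f (a + t *: b) ->
  is_derive t 1 (fun s : R => f (a + s *: b) : R^o) ('d f (a + t *: b) b).
Proof.
move=> df; have dv : derivable f (a + t *: b) b by exact: diff_derivable.
have E : (fun h : R => h^-1 *: (f (a + (h *: (1 : R) + t) *: b) - f (a + t *: b))) =
         (fun h : R => h^-1 *: (f (h *: b + (a + t *: b)) - f (a + t *: b))).
  apply/funext => h; congr (_ *: (f _ - _)).
  by rewrite [_ *: 1](_ : _ = h) ?scalerDl 1?addrCA // /GRing.scale /= mulr1.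
split; first by rewrite /derivable E.
by rewrite -deriveE // /derive E.
Qed.

Lemma line_is_deriveN f a b (t : R) : differentiable f (a - t *: b) ->
  is_derive t 1 (fun s : R => f (a - s *: b) : R^o) (- 'd f (a - t *: b) b).
Proof.
move=> df; have E s : s *: - b = - (s *: b) by rewrite scalerN.
have := @line_is_derive f a (- b) t; rewrite E linearN => /(_ df).
by under eq_fun do rewrite E.
Qed.

(** The mean value theorem on the segment turns the increment into ['d g] at an intermediate point,
    no farther from [a] than [b] is; the Hoelder bound on the differential does the rest. *)
Lemma C1alpha_taylor (alpha : R) g : 0 < alpha -> C1alpha_fun alpha g ->
  exists2 C : R, 0 <= C &
    (forall x y v, `|'d g x v - 'd g y v| <= C * enorm v * enorm (x - y) `^ alpha) /\
    (forall a b, `|g b - g a - 'd g a (b - a)| <= C * enorm (b - a) `^ alpha * enorm (b - a)).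
Proof.
move=> alpha0 [dg [C0 gC0]]; pose C := `|C0|.
have gC x y v : `|'d g x v - 'd g y v| <= C * enorm v * enorm (x - y) `^ alpha.
  apply: (le_trans (gC0 x y v)); rewrite ler_wpM2r ?powR_ge0 //.
  by rewrite ler_wpM2r ?enorm_ge0 // ler_norm.
exists C; first exact: normr_ge0.
split=> // a b; set v := b - a.
have [|||c c01] := @MVT_segment R (fun s : R => g (a + s *: v)) (fun s => 'd g (a + s *: v) v) 0 1.
- exact: ler01.
- by move=> x _; exact: line_is_derive.
- apply: continuous_subspaceT => x.
  apply: differentiable_continuous; apply/derivable1_diffP.
  exact: (@ex_derive _ _ _ _ _ _ _ (line_is_derive (dg _))).
have avb : a + v = b by rewrite /v addrC subrK.
rewrite scale1r scale0r addr0 subr0 mulr1 avb => ->.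
apply: (le_trans (gC _ _ _)); rewrite mulrAC.
apply: (ler_wpM2r (enorm_ge0 _)); apply: (ler_wpM2l (normr_ge0 _)).
rewrite addrC addKr enormZ ge0_ler_powR ?nnegrE ?mulr_ge0 ?enorm_ge0 ?(ltW alpha0) //.
move: c01; rewrite in_itv /= => /andP[c0 c1].
by rewrite ger0_norm // ler_piMl ?enorm_ge0.
Qed.

Lemma linear_form_edot (f : 'rV[R]_n -> R) v :
  (forall (k : R) u w, f (k *: u + w) = k * f u + f w) ->
  f v = edot (\row_j f (delta_mx 0 j)) v.
Proof.
move=> fl; have f0 : f 0 = 0 by have := fl (-1) 0 0; rewrite scaler0 addr0; lra.
have fD u w : f (u + w) = f u + f w by have := fl 1 u w; rewrite scale1r mul1r.
rewrite {1}(row_sum_delta v) (big_morph f fD f0); apply: eq_bigr => i _.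
by have := fl (v 0 i) (delta_mx 0 i) 0; rewrite addr0 f0 addr0 mxE mulrC => <-.
Qed.

End Line.

Section Borel.
Variables (R : realType) (n : nat).

Lemma continuous_Borel_measurable (f : 'rV[R]_n -> 'rV[R]_n) : continuous f ->
  measurable_fun setT (f : Borel R n -> Borel R n).
Proof.
move=> fc; apply: (@measurability _ _ (Borel R n) (Borel R n) _ _ (@open 'rV[R]_n)) => //.
move=> _ [A oA <-]; rewrite setTI; apply: sub_sigma_algebra.
by move/continuousP: fc; apply.
Qed.

(* A substitute for the point reflection [y |-> 2 x - y], which would change the sign of
   the gradient of the heat kernel but does not preserve the boundary. *)
Definition almost_reflection (sigma : {measure set (Borel R n) -> \bar R})
    (alpha c : R) (x : 'rV[R]_n) (rho : 'rV[R]_n -> 'rV[R]_n) : Prop :=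
  [/\ continuous rho, forall y, rho (rho y) = y,
    forall d y, 0 < d <= c^-1 -> enorm (y - x) < d ->
      enorm (rho y - (x + x - y)) <= c * d `^ alpha * enorm (y - x) &
    forall d (A : set (Borel R n)), 0 < d <= c^-1 -> measurable A ->
      A `<=` [set y | enorm (y - x) < d] ->
      (sigma (rho @^-1` A) <= ((1 + c * d `^ alpha) ^+ n.-1)%:E * sigma A)%E].

(** A single number bounds the constants and, inverted, the radius. A chart then yields the property
    for all large [c], and compactness makes the threshold uniform over the boundary. *)
Definition regular_at (Omega : set 'rV[R]_n) (nu : 'rV[R]_n -> 'rV[R]_n)
    (sigma : {measure set (Borel R n) -> \bar R}) (alpha c : R) (x : 'rV[R]_n) : Prop :=
  (forall y, bdry Omega y -> enorm (x - y) < c^-1 ->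
     enorm (nu x - nu y) <= c * enorm (x - y) `^ alpha /\
     `|edot (nu x) (x - y)| <= c * enorm (x - y) `^ alpha * enorm (x - y)) /\
  exists rho, almost_reflection sigma alpha c x rho.

End Borel.

Section Perp.
Variables (R : realType) (n : nat) (e : 'rV[R]_n).
Hypothesis e1 : enorm e = 1.
Implicit Types u v z : 'rV[R]_n.

Definition perp z := z - edot z e *: e.

Lemma perpE z : perp z = z - edot z e *: e. Proof. by []. Qed.

Lemma edotee : edot e e = 1. Proof. by rewrite -enorm_sqr e1 expr1n. Qed.

Lemma perpZD (k : R) u v : perp (k *: u + v) = k *: perp u + perp v.
Proof.
by rewrite !perpE edotDl edotZl scalerBr scalerDl scalerA opprD addrACA.
Qed.

Lemma perpB u v : perp (u - v) = perp u - perp v.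
Proof. by rewrite addrC -scaleN1r perpZD scaleN1r addrC. Qed.

Lemma perpe (k : R) : perp (k *: e) = 0.
Proof. by rewrite perpE edotZl edotee mulr1 subrr. Qed.

Lemma edot_perp z : edot (perp z) e = 0.
Proof. by rewrite perpE edotBl edotZl edotee mulr1 subrr. Qed.

Lemma enorm_perp z : enorm (perp z) <= enorm z.
Proof.
rewrite -(@ler_pXn2r _ 2) ?nnegrE ?enorm_ge0 // !enorm_sqr {2}perpE edotBr edotZr.
rewrite edot_perp mulr0 subr0 perpE edotBl edotZl (edotC e) lerBlDr lerDl -expr2.
exact: sqr_ge0.
Qed.

End Perp.
Local Opaque perp enorm edot powR.

Section Chart.
Variables (R : realType) (n : nat) (alpha : R) (Omega : set 'rV[R]_n).
Variables (p e : 'rV[R]_n) (r : R) (g : 'rV[R]_n -> R^o).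
Hypotheses (alpha01 : 0 < alpha < 1) (openO : open Omega) (e1 : enorm e = 1).
Hypotheses (r0 : 0 < r) (gC1 : C1alpha_fun alpha g).
Hypothesis chart : forall x, enorm (x - p) < r ->
  (Omega x <-> edot x e < g (x - edot x e *: e)).
Implicit Types x y z u v : 'rV[R]_n.

Let alpha_gt0 : 0 < alpha. Proof. by case/andP: alpha01. Qed.

Let P := perp e.
(** A local defining function of [Omega], negative inside; the next two definitions are its
    differential and its gradient. *)
Definition chart_gap z := edot z e - g (P z).
Definition chart_diff x v := edot v e - 'd g (P x) (P v).
Definition chart_normal x := \row_j chart_diff x (delta_mx 0 j).
Local Notation G := chart_gap.
Local Notation D := chart_diff.
Local Notation N := chart_normal.
Let GE z : G z = edot z e - g (P z). Proof. by []. Qed.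
Let DE x v : D x v = edot v e - 'd g (P x) (P v). Proof. by []. Qed.
Let NE x : N x = \row_j D x (delta_mx 0 j). Proof. by []. Qed.
Let ee : edot e e = 1. Proof. exact: edotee. Qed.
Let PD k u v : P (k *: u + v) = k *: P u + P v. Proof. exact: perpZD. Qed.
Let PB u v : P (u - v) = P u - P v. Proof. exact: perpB. Qed.
Let Pe k : P (k *: e) = 0. Proof. exact: perpe. Qed.
Let enormP z : enorm (P z) <= enorm z. Proof. exact: enorm_perp. Qed.

Let gP_continuous : continuous (fun z => g (P z)).
Proof.
move=> x A /=; have gc : {for P x, continuous g}.
  by apply: differentiable_continuous; case: gC1.
move=> /gc /nbhs_enorm[d d0 dA].
apply: filterS (near_enorm x d0) => y xy; apply: dA.
by rewrite -PB (le_lt_trans (enormP _)).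
Qed.

Let G_continuous : continuous (G : 'rV[R]_n -> R^o).
Proof. by move=> x; apply: (@cvgB _ R^o _ (nbhs x) (nbhs_filter x)); [exact: (@edot_continuous R n e x)|exact: (@gP_continuous x)]. Qed.

Lemma bdry_chart x : enorm (x - p) < r -> (bdry Omega x <-> G x = 0).
Proof.
move=> xp; split=> [[clx nix]|Gx].
  have Gge : 0 <= G x.
    rewrite leNgt; apply/negP => Gx; apply: nix; rewrite (interior_id _).1 //.
    by apply/(chart xp); rewrite -subr_lt0.
  apply/eqP; rewrite eq_le Gge andbT leNgt; apply/negP => Gx.
  have near1 : nbhs x [set y | enorm (y - p) < r /\ 0 < G y].
    apply: filterI.
      have d0 : 0 < r - enorm (x - p) by rewrite subr_gt0.
      apply: filterS (near_enorm x d0) => y yx.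
      by apply: (le_lt_trans (enorm_tri y x p)); rewrite -ltrBrDr.
    exact: (@cvgr_gt _ _ _ (nbhs_filter x) _ _ (@G_continuous x)).
  have [y [Oy [yp Gy]]] := clx _ near1.
  have /(chart yp) : Omega y by [].
  by rewrite -subr_lt0 => /(lt_trans Gy); rewrite ltxx.
split=> [|/interior_subset /(chart xp)]; last by rewrite -subr_lt0 -/(P x) -/(G x) Gx ltxx.
move=> B /nbhs_enorm[d d0 dB].
(* Descending by [t] along [e] keeps the projection [P] fixed and lowers [G] by [t]. The point
   reached lies in [Omega], within distance [d] of [x] and still inside the chart. *)
pose t := Num.min d (r - enorm (x - p)) / 2.
have m0 : 0 < Num.min d (r - enorm (x - p)) by rewrite lt_min d0 subr_gt0.
have t0 : 0 < t by rewrite divr_gt0.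
have td : t < d.
  by apply: (@lt_le_trans _ _ (Num.min d (r - enorm (x - p)))); rewrite ?ge_min ?lexx // /t; lra.
have tr : t < r - enorm (x - p).
  apply: (@lt_le_trans _ _ (Num.min d (r - enorm (x - p)))); last by rewrite ge_min lexx orbT.
  by rewrite /t; lra.
exists (x - t *: e); split; last first.
  by apply: dB; rewrite addrAC subrr sub0r enormN enormZ e1 mulr1 gtr0_norm.
have yp : enorm (x - t *: e - p) < r.
  rewrite addrAC; apply: (le_lt_trans (enormB _ _)).
  by rewrite enormZ e1 mulr1 gtr0_norm // -ltrBrDl.
apply/(chart yp); rewrite -(perpE e) -/P PB Pe subr0 edotBl edotZl ee mulr1.
by have := Gx; rewrite GE; lra.
Qed.

Let D_linear x (k : R) u v : D x (k *: u + v) = k * D x u + D x v.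
Proof.
rewrite !DE PD linearD linearZ /= edotDl edotZl /GRing.scale /=; ring.
Qed.

Let ND x v : edot (N x) v = D x v.
Proof. by rewrite NE -(linear_form_edot v (D_linear x)). Qed.

Let De x : D x e = 1.
Proof. by have := Pe 1; rewrite scale1r /D ee => ->; rewrite linear0 subr0. Qed.

Local Opaque chart_gap chart_diff chart_normal.

Let N_ge1 x : 1 <= enorm (N x).
Proof. by have := edot_le (N x) e; rewrite ND De e1 mulr1. Qed.

Variable C : R.
Hypothesis C0 : 0 <= C.
Hypothesis dgC : forall x y v, `|'d g x v - 'd g y v| <= C * enorm v * enorm (x - y) `^ alpha.
Hypothesis taylor : forall a b,
  `|g b - g a - 'd g a (b - a)| <= C * enorm (b - a) `^ alpha * enorm (b - a).

Let powle u v : enorm u <= enorm v -> enorm u `^ alpha <= enorm v `^ alpha.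
Proof. by move=> uv; rewrite ge0_ler_powR ?nnegrE ?enorm_ge0 ?(ltW alpha_gt0). Qed.

Let G_taylor x y : `|G y - G x - D x (y - x)| <= C * enorm (y - x) `^ alpha * enorm (y - x).
Proof.
have -> : G y - G x - D x (y - x) = - (g (P y) - g (P x) - 'd g (P x) (P y - P x)).
  by rewrite !GE DE edotBl PB; ring.
rewrite normrN; apply: (le_trans (taylor _ _)).
rewrite -(PB y x).
apply: ler_pM.
- apply: mulr_ge0.
  exact: C0.
  exact: powR_ge0.
- exact: enorm_ge0.
- apply: (ler_wpM2l C0).
  apply: powle.
  exact: enormP.
- exact: enormP.
Qed.

(** Otherwise [w], the difference between [v] and the normalized gradient, would decrease [G] to
    first order and yet make an acute angle with [v]: a short step along [w] would enter [Omega] and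
    contradict that [v] points outward. *)
Lemma outward_normal_chart x v : enorm (x - p) < r -> bdry Omega x ->
  outward_unit_normal Omega x v -> v = (enorm (N x))^-1 *: N x.
Proof.
move=> xp bx [v1 vO]; set a := enorm (N x).
have a0 : 0 < a by rewrite (lt_le_trans _ (N_ge1 x)).
suff Nv : a <= edot (N x) v.
  apply/subr0_eq/edot_eq0/eqP; rewrite eq_le edot_ge0 andbT.
  rewrite !(edotBl, edotBr, edotZl, edotZr) -!enorm_sqr v1 (edotC v).
  rewrite -/a expr1n (_ : _ - _ = 2 - 2 * (a^-1 * edot (N x) v)); last first.
    by field; rewrite gt_eqF.
  have : 1 <= a^-1 * edot (N x) v by rewrite mulrC ler_pdivlMr // mul1r.
  lra.
rewrite leNgt; apply/negP => Nva.
pose w := v - a^-1 *: N x.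
have Nw : edot (N x) w < 0.
  rewrite /w edotBr edotZr -enorm_sqr -/a expr2 mulrA mulVf ?gt_eqF // mul1r; lra.
have vw : 0 < edot w v.
  rewrite /w edotBl edotZl -enorm_sqr v1 expr1n subr_gt0 mulrC ltr_pdivrMr //; lra.
have w0 : 0 < enorm w.
  rewrite lt_def enorm_ge0 andbT; apply/eqP => /enorm_eq0 w0.
  by move: vw; rewrite w0 edot0l ltxx.
pose eps := edot w v / (2 * enorm w).
have eps0 : 0 < eps by rewrite divr_gt0 ?mulr_gt0.
have [d [d0 dO]] := vO _ eps0.
(* Once t^alpha < [c], the Taylor remainder is smaller than the linear decrease of [G] along
   [t *: w]. *)
pose c := - edot (N x) w / (C * enorm w * enorm w `^ alpha + 1).
have q0 : 0 <= C * enorm w * enorm w `^ alpha by rewrite !mulr_ge0 ?powR_ge0 ?enorm_ge0.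
have c0 : 0 < c by rewrite divr_gt0 ?oppr_gt0 // ltr_wpDl.
have [t [t0 td tr ta]] : exists t : R, [/\ 0 < t, t * enorm w < d,
    t * enorm w < r - enorm (x - p) & t `^ alpha < c].
  have m0 : 0 < Num.min d (r - enorm (x - p)) / enorm w.
    by rewrite divr_gt0 // lt_min d0 subr_gt0.
  near ((0 : R)^'+) => t; exists t.
  have tm : t * enorm w < Num.min d (r - enorm (x - p)).
    by rewrite -ltr_pdivlMr //; near: t; exact: nbhs_right_lt.
  split.
  - by near: t; exact: nbhs_right_gt.
  - by apply: (lt_le_trans tm); rewrite ge_min lexx.
  - by apply: (lt_le_trans tm); rewrite ge_min lexx orbT.
  - near: t; exact: (@cvgr_lt _ _ _ _ _ _ (powR_cvg0 alpha_gt0) c c0).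
pose y := x + t *: w.
have yx : y - x = t *: w by rewrite /y addrC addKr.
have tw : enorm (y - x) = t * enorm w by rewrite yx enormZ gtr0_norm.
have yp : enorm (y - p) < r.
  apply: (le_lt_trans (enorm_tri y x p)); rewrite -ltrBrDr tw; exact: tr.
have Gy : G y < 0.
  have := G_taylor x y; rewrite tw yx (bdry_chart xp).1 // subr0 -ND edotZr.
  move=> /ler_normlP[_]; rewrite powRM ?enorm_ge0 ?(ltW t0) // => h.
  have : t `^ alpha * (C * enorm w * enorm w `^ alpha + 1) < - edot (N x) w.
    by rewrite -ltr_pdivlMr // ltr_wpDl.
  have ta0 := powR_ge0 t alpha; move: h; set q := C * enorm w * _.
  have -> : C * (t `^ alpha * enorm w `^ alpha) * (t * enorm w) = t * (t `^ alpha * q).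
    by rewrite /q; ring.
  by move=> h1 h2; nra.
have Oy : Omega y by apply/(chart yp); rewrite -subr_lt0.
have yd : enorm (y - x) < d by rewrite tw.
have [/(_ Oy) + _] := dO y yd; rewrite tw yx edotZl.
have -> : eps * (t * enorm w) = t * (edot w v / 2).
  by rewrite /eps; field; rewrite gt_eqF.
by rewrite ler_pM2l //; lra.
Unshelve. all: by end_near. Qed.

Variable nu : 'rV[R]_n -> 'rV[R]_n.
Hypothesis nuO : outward_normal_field Omega nu.

Let nuE x : enorm (x - p) < r -> bdry Omega x -> nu x = (enorm (N x))^-1 *: N x.
Proof. by move=> xp bx; apply: outward_normal_chart => //; exact: nuO. Qed.

(** [G] vanishes at both points, so its differential along [y - x] is nothing but the Taylor
    remainder; normalizing divides by [enorm (N x) >= 1]. *)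
Lemma normal_tangent_chart x y : enorm (x - p) < r -> enorm (y - p) < r ->
  bdry Omega x -> bdry Omega y ->
  `|edot (nu x) (x - y)| <= C * enorm (x - y) `^ alpha * enorm (x - y).
Proof.
move=> xp yp bx by_; rewrite (nuE xp bx) edotZl normrM ger0_norm ?invr_ge0 ?enorm_ge0 //.
apply: (@le_trans _ _ `|edot (N x) (x - y)|).
  by rewrite ler_piMl // invf_le1 ?N_ge1 // (lt_le_trans ltr01).
have := G_taylor x y; rewrite (bdry_chart xp).1 // (bdry_chart yp).1 // subr0 sub0r normrN.
by rewrite -ND -opprB edotNr normrN enormN.
Qed.

Lemma normal_holder_chart x y : enorm (x - p) < r -> enorm (y - p) < r ->
  bdry Omega x -> bdry Omega y ->
  enorm (nu x - nu y) <= 2 * C * enorm (x - y) `^ alpha.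
Proof.
move=> xp yp bx by_; rewrite (nuE xp bx) (nuE yp by_).
have NN : enorm (N x - N y) <= C * enorm (x - y) `^ alpha.
  (* The difference of the gradients is tested on itself, which makes its squared norm a difference
     of differentials. *)
  set v := N x - N y; have [->|v0] := eqVneq v 0.
    by rewrite enorm0 mulr_ge0 ?powR_ge0.
  have vgt : 0 < enorm v.
    by rewrite lt_def enorm_ge0 andbT; apply: contra v0 => /eqP /enorm_eq0 ->.
  have vv : enorm v * enorm v = D x v - D y v.
    by rewrite -(ND x v) -(ND y v) -edotBl; exact: enorm_sqr.
  have Dxy : D x v - D y v = - ('d g (P x) (P v) - 'd g (P y) (P v)).
    rewrite !DE.
    have aux (a b c : R) : a - b - (a - c) = - (b - c) by ring.
    exact: aux.
  rewrite -(ler_pM2r vgt) vv Dxy.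
  apply: (le_trans (ler_norm _)).
  rewrite normrN.
  apply: (le_trans (dgC _ _ _)).
  rewrite -(PB x y) [leRHS]mulrAC.
  apply: ler_pM.
  - exact: (mulr_ge0 C0 (enorm_ge0 _)).
  - exact: powR_ge0.
  - by apply: (ler_wpM2l C0); exact: enormP.
  - by apply: powle; exact: enormP.
apply: (le_trans (normalize_lip (N_ge1 x) (N_ge1 y))).
by rewrite -[leRHS]mulrA ler_pM2l.
Qed.

Section Reflection.
Variable x : 'rV[R]_n.

(** The shift along [e] is chosen so that [G (rho y) = - G y] when [G x = 0]: [rho] preserves the
    boundary and exchanges its sides. [delta] takes the same value at [y] and at [rho y], hence
    [rho] is an involution. *)
Let delta y := g (P (x + x - y)) + g (P y) - 2 * g (P x).
Let rho y := (x + x - y) + delta y *: e.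

(** The two moving terms of [delta] go through one application of the mean value theorem, so that a
    common intermediate point [q] appears. The derivative is then a difference of ['d g] at the
    mirror points [P q] and [P (x + x - q)], whose distance is at most [2 * d]; estimated
    separately, the terms would not be small. *)
Let delta_lip d y z : enorm (y - x) <= d -> enorm (z - x) <= d ->
  `|delta y - delta z| <= 2 * C * d `^ alpha * enorm (y - z).
Proof.
move=> yd zd; set w := y - z.
have d0 : 0 <= d by rewrite (le_trans (enorm_ge0 _) yd).
pose f1 s := g (P (x + x - z) - s *: P w).
pose f2 s := g (P z + s *: P w).
pose df s := 'd g (P z + s *: P w) (P w) - 'd g (P (x + x - z) - s *: P w) (P w).
have dg u : differentiable g u by case: gC1.
have fd s : is_derive s (1 : R) (f2 + f1 : R -> R^o) (df s).
  by apply: is_deriveD; [exact: line_is_derive|exact: line_is_deriveN].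
have fc : {within `[0, 1], continuous (f2 + f1 : R -> R)}.
  apply: continuous_subspaceT => s.
  apply: differentiable_continuous; apply/derivable1_diffP.
  exact: (@ex_derive _ _ _ _ _ _ _ (fd _)).
have [c c01 E] := @MVT_segment R (f2 + f1) df 0 1 ler01 (fun s _ => fd s) fc.
move: E; rewrite subr0 mulr1 => E.
have zw : z + w = y by rewrite /w addrC subrK.
have Pc v s : P v + s *: P w = P (v + s *: w) by rewrite addrC -PD addrC.
have Pc' v s : P v - s *: P w = P (v - s *: w) by rewrite -!scaleNr Pc.
have Edelta : delta y - delta z = df c.
  rewrite -E /delta /f1 /f2 !fctE !Pc !Pc' !scale1r !scale0r subr0 addr0 zw.
  rewrite (_ : x + x - z - w = x + x - y); last rewrite /w; last by apply/rowP => i; rewrite !mxE; ring.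
  have aux (c1 c2 c3 c4 c5 : R) : c1 + c2 - 2 * c5 - (c3 + c4 - 2 * c5) = c2 + c1 - (c4 + c3).
    by ring.
  exact: aux.
rewrite Edelta /df.
move: c01; rewrite in_itv /= => /andP[c0 c1].
rewrite Pc Pc' (_ : x + x - z - c *: w = x + x - (z + c *: w)); last by apply/rowP => i; rewrite !mxE; ring.
set q := z + c *: w.
apply: (le_trans (dgC _ _ _)).
have qx : enorm (q - x) <= d.
  have -> : q - x = (1 - c) *: (z - x) + c *: (y - x).
    by rewrite /q -zw; apply/rowP => i; rewrite !mxE; ring.
  apply: (le_trans (enormD _ _)).
  rewrite !enormZ (ger0_norm c0) (@ger0_norm _ (1 - c)) ?subr_ge0 //.
  have aux (A B : R) : 0 <= A -> 0 <= B -> A <= d -> B <= d -> (1 - c) * A + c * B <= d.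
    by move=> *; nra.
  by apply: aux => //; exact: enorm_ge0.
have -> : P q - P (x + x - q) = P (2 *: (q - x)).
  by rewrite -PB; congr P; apply/rowP => i; rewrite !mxE; ring.
have p2 : enorm (P (2 *: (q - x))) `^ alpha <= 2 * d `^ alpha.
  apply: (@le_trans _ _ ((2 * d) `^ alpha)).
    apply: (ge0_ler_powR (ltW alpha_gt0)).
    - exact: enorm_ge0.
    - exact: (mulr_ge0 (ler0n _ 2) d0).
    - by apply: (le_trans (enormP _)); rewrite enormZ ger0_norm // ler_pM2l.
  rewrite powRM //; apply: (ler_wpM2r (powR_ge0 _ _)).
  rewrite -[leRHS]powRr1 //; apply: ler_powR; first by rewrite ler1n.
  by case/andP: alpha01 => _ /ltW.
have aux (A B : R) : 2 * C * A * B = C * B * (2 * A) by ring.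
rewrite aux; apply: ler_pM => //.
- exact: (mulr_ge0 C0 (enorm_ge0 _)).
- exact: powR_ge0.
- by apply: (ler_wpM2l C0); exact: enormP.
Qed.

Let Prho y : P (rho y) = P (x + x - y).
Proof. by rewrite /rho addrC PD (_ : P e = 0) ?scaler0 ?add0r // -(scale1r e) Pe. Qed.

Let rhoK y : rho (rho y) = y.
Proof.
have -> : rho (rho y) = x + x - rho y + delta y *: e.
  congr (_ + _ *: _); rewrite /delta Prho (_ : P (x + x - rho y) = P y); first by ring.
  by rewrite PB Prho -PB opprB addrC subrK.
by rewrite /rho opprD addrA subrK opprB addrC subrK.
Qed.

Let delta0 : delta x = 0.
Proof. by rewrite /delta addrK; ring. Qed.

Let rho_near d y : enorm (y - x) <= d ->
  enorm (rho y - (x + x - y)) <= 2 * C * d `^ alpha * enorm (y - x).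
Proof.
move=> yd; have d0 := le_trans (enorm_ge0 _) yd.
rewrite /rho addrAC subrr add0r enormZ e1 mulr1 -[delta y]subr0 -delta0.
by apply: delta_lip => //; rewrite subrr enorm0.
Qed.

Let rho_lip d y z : enorm (y - x) <= d -> enorm (z - x) <= d ->
  enorm (rho y - rho z) <= (1 + 2 * C * d `^ alpha) * enorm (y - z).
Proof.
move=> yd zd.
have -> : rho y - rho z = (delta y - delta z) *: e - (y - z).
  by rewrite /rho; apply/rowP => i; rewrite !mxE; ring.
apply: (le_trans (enormB _ _)); rewrite enormZ e1 mulr1 addrC mulrDl mul1r lerD2l.
exact: delta_lip.
Qed.

Let rho_continuous : continuous rho.
Proof.
have c1 : continuous (fun y : 'rV[R]_n => x + x - y).
  move=> y; apply: (@cvgB _ _ _ (nbhs y) (nbhs_filter y)); [exact: cvg_cst|exact: cvg_id].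
have c2 : continuous (delta : 'rV[R]_n -> R^o).
  move=> y; apply: (@cvgB _ R^o _ (nbhs y) (nbhs_filter y)); last exact: cvg_cst.
  apply: (@cvgD _ R^o _ (nbhs y) (nbhs_filter y)); last exact: gP_continuous.
  exact: (continuous_comp (c1 y) (@gP_continuous _)).
move=> y; apply: (@cvgD _ _ _ (nbhs y) (nbhs_filter y)); first exact: c1.
by apply: (@cvgZr_tmp _ _ _ (nbhs y) (nbhs_filter y)); exact: c2.
Qed.

Let G_rho y : G x = 0 -> G (rho y) = - G y.
Proof.
rewrite !GE Prho /rho edotDl edotZl ee mulr1 edotBl edotDl /delta => h.
have -> : edot x e = g (P x) by lra.
ring.
Qed.

Variable sigma : {measure set (Borel R n) -> \bar R}.
Hypothesis sigmaH : surface_measure Omega sigma.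

Lemma almost_reflection_chart c : enorm (x - p) < r / 4 -> bdry Omega x ->
  1 + 2 * C + 4 * (1 + 2 * C) / r <= c -> almost_reflection sigma alpha c x rho.
Proof.
move=> xp bx cge.
have C4 : 0 < 4 * (1 + 2 * C) / r by rewrite divr_gt0 // mulr_gt0 // ltr_pwDl // mulr_ge0.
have c1 : 1 <= c by have := C0; lra.
have c2C : 2 * C <= c by lra.
have c0 : 0 < c by lra.
(* This is what the last summand in the lower bound on [c] is for: points within [c^-1] of [x] and
   their images under [rho] all stay in the ball of radius [r] around [p]. *)
have cr : (1 + 2 * C) * c^-1 <= r / 4.
  have : 4 * (1 + 2 * C) <= c * r by rewrite -ler_pdivrMr //; have := C0; lra.
  rewrite ler_pdivrMr //; lra.
have xr : enorm (x - p) < r by have := r0; lra.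
split.
- exact: rho_continuous.
- exact: rhoK.
- move=> d y _ yd; apply: (le_trans (rho_near (ltW yd))).
  by rewrite ler_wpM2r ?enorm_ge0 // ler_wpM2r ?powR_ge0.
move=> d A /andP[d0 dc] mA Ad.
have d1 : d <= 1 by apply: (le_trans dc); rewrite invf_le1.
have da1 : d `^ alpha <= 1.
  apply: (@le_trans _ _ (1 `^ alpha)); last by rewrite powR1.
  exact: (ge0_ler_powR (ltW alpha_gt0) (ltW d0) ler01 d1).
have mrA : measurable (rho @^-1` A : set (Borel R n)).
  by rewrite -[X in measurable X]setTI; exact: (continuous_Borel_measurable rho_continuous).
have L0 : 0 <= c * d `^ alpha by rewrite mulr_ge0 ?powR_ge0 // ltW.
(* For an involution the preimage of [A] is its image. As [rho] preserves the boundary inside the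
   chart, the Lipschitz comparison applies to the traces on the boundary. *)
rewrite !sigmaH //; apply: (@hausdorff_lipschitz _ _ _ _ rho).
- by rewrite ltr_pwDl.
- move=> z [Az bz]; exists (rho z); last exact: rhoK.
  split=> //.
  have yd : enorm (rho z - x) < d by exact: Ad.
  have d4 : d * (1 + 2 * C) <= r / 4.
    apply: le_trans cr; rewrite [leLHS]mulrC; apply: ler_wpM2l dc.
    by rewrite addr_ge0 ?mulr_ge0.
  have zx : enorm (z - x) <= d * (1 + 2 * C).
    have := rho_near (ltW yd); rewrite rhoK => h.
    have := enormD (z - (x + x - rho z)) (x - rho z).
    have -> : z - (x + x - rho z) + (x - rho z) = z - x.
      by apply/rowP => i; rewrite !mxE; ring.
    rewrite (enormBC x) => h2; apply: (le_trans h2).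
    have := enorm_ge0 (rho z - x); have := C0; have := powR_ge0 d alpha.
    move: h yd da1; set u := enorm (rho z - x); set q := _ `^ _ => h yd da1 q0 C0' u0.
    have : 2 * C * q * u <= 2 * C * u by rewrite ler_wpM2r // ler_piMr // mulr_ge0.
    have : 2 * C * u <= 2 * C * d by rewrite ler_wpM2l ?mulr_ge0 // ltW.
    lra.
  have zp : enorm (z - p) < r.
    by apply: (le_lt_trans (enorm_tri z x p)); have := le_trans zx d4; have := r0; lra.
  have yp : enorm (rho z - p) < r.
    apply: (le_lt_trans (enorm_tri _ x p)).
    have : d <= d * (1 + 2 * C) by rewrite ler_peMr ?(ltW d0) // lerDl mulr_ge0.
    have := r0; lra.
  apply/(bdry_chart yp); rewrite G_rho ?(bdry_chart zp).1 ?oppr0 //.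
  exact: (bdry_chart xr).1.
- move=> y z [Ay _] [Az _]; apply: (le_trans (rho_lip (ltW (Ad _ Ay)) (ltW (Ad _ Az)))).
  by rewrite ler_wpM2r ?enorm_ge0 // lerD2l ler_wpM2r ?powR_ge0.
Qed.

End Reflection.

Variable sigma : {measure set (Borel R n) -> \bar R}.
Hypothesis sigmaH : surface_measure Omega sigma.

Lemma regular_at_chart c x : enorm (x - p) < r / 4 -> bdry Omega x ->
  1 + 2 * C + 4 * (1 + 2 * C) / r <= c -> regular_at Omega nu sigma alpha c x.
Proof.
move=> xp bx cge; split; last by eexists; exact: almost_reflection_chart.
have C4 : 0 < 4 * (1 + 2 * C) / r by rewrite divr_gt0 // mulr_gt0 // ltr_pwDl // mulr_ge0.
have c0 : 0 < c by have := C0; lra.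
move=> y by_ xy.
have yp : enorm (y - p) < r.
  apply: (le_lt_trans (enorm_tri y x p)); rewrite enormBC.
  have : c^-1 <= r / 4.
    have : 4 * (1 + 2 * C) <= c * r by rewrite -ler_pdivrMr //; have := C0; lra.
    rewrite -[c^-1]mul1r ler_pdivrMr //; have := C0; lra.
  have := r0; lra.
have xr : enorm (x - p) < r by have := r0; lra.
split.
  apply: (le_trans (normal_holder_chart xr yp bx by_)).
  by rewrite ler_wpM2r ?powR_ge0 //; lra.
apply: (le_trans (normal_tangent_chart xr yp bx by_)).
by rewrite ler_wpM2r ?enorm_ge0 // ler_wpM2r ?powR_ge0 //; have := C0; lra.
Qed.

End Chart.

(** * Uniform geometry of the boundary *)

Section Domain.
Variables (R : realType) (n : nat) (alpha : R) (Omega : set 'rV[R]_n).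
Variables (nu : 'rV[R]_n -> 'rV[R]_n) (sigma : {measure set (Borel R n) -> \bar R}).
Hypotheses (alpha01 : 0 < alpha < 1) (domO : C1alpha_domain alpha Omega).
Hypotheses (nuO : outward_normal_field Omega nu) (sigmaH : surface_measure Omega sigma).
Implicit Types x y : 'rV[R]_n.

Lemma bdry_closed : closed (bdry Omega).
Proof.
rewrite /bdry setDE; apply: closedI; first exact: closed_closure.
by apply: open_closedC; exact: open_interior.
Qed.

Lemma bdry_bounded : exists2 M : R, 0 <= M & forall x, bdry Omega x -> enorm x <= M.
Proof.
have [[_ [M OM]] _] := domO; exists `|M| => // x [clx _].
rewrite leNgt; apply/negP => Mx; have [|y [Oy xy]] := clx [set y | enorm (y - x) < enorm x - `|M|].
  by apply: near_enorm; rewrite subr_gt0.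
have := OM y Oy; have := ler_norm M; have := enormD (x - y) y.
by rewrite subrK enormBC; move: xy => /=; lra.
Qed.

Lemma bdry_compact : compact (bdry Omega).
Proof.
apply: bounded_closed_compact; last exact: bdry_closed.
have [M _ bM] := bdry_bounded; exists M; split; first exact: num_real.
by move=> r Mr x /bM xM; apply: (le_trans (norm_le_enorm x)); apply: (le_trans xM); exact: ltW.
Qed.

Lemma bdry_regular : exists2 c : R, 1 <= c &
  forall x, bdry Omega x -> regular_at Omega nu sigma alpha c x.
Proof.
have /compact_near_coveringP/near_covering_withinP cov := bdry_compact.
have [M [_ McP]] : \forall c \near +oo, bdry Omega `<=` regular_at Omega nu sigma alpha c.
  apply: cov => p bp; have [[oO _] /(_ p bp)[e [r [g [e1 r0 gC ch]]]]] := domO.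
  have alpha0 : 0 < alpha by case/andP: alpha01.
  have [C C0 [dgC gT]] := C1alpha_taylor alpha0 gC.
  have r4 : 0 < r / 4 by rewrite divr_gt0.
  near=> x c => bx.
  have xp : enorm (x - p) < r / 4 by near: x; exact: near_enorm.
  have cC : 1 + 2 * C + 4 * (1 + 2 * C) / r <= c.
    by near: c; apply: nbhs_pinfty_ge; exact: num_real.
  exact: (regular_at_chart alpha01 oO e1 r0 gC ch C0 dgC gT nuO sigmaH xp bx cC).
exists (Num.max 1 (M + 1)); first by rewrite le_max lexx.
by apply: McP; rewrite lt_max ltrDl ltr01 orbT.
Unshelve. all: by end_near. Qed.

Lemma normal_holder : exists2 K : R, 0 <= K & forall x y, bdry Omega x -> bdry Omega y ->
  enorm (nu x - nu y) <= K * enorm (x - y) `^ alpha /\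
  `|edot (nu x) (x - y)| <= K * enorm (x - y) `^ alpha * enorm (x - y).
Proof.
have alpha0 : 0 < alpha by case/andP: alpha01.
have [c c1 reg] := bdry_regular; have c0 : 0 < c := lt_le_trans ltr01 c1.
(* For points at distance at least [c^-1] the claimed bounds exceed the trivial ones, the normals
   being unit vectors. *)
pose K := 2 * c `^ alpha; have K0 : 0 <= K by rewrite mulr_ge0 ?powR_ge0.
exists (c + K); first by rewrite addr_ge0 // ltW.
move=> x y bx by_; have [xy|xy] := ltP (enorm (x - y)) c^-1.
  have [/(_ y by_ xy)[h1 h2] _] := reg x bx.
  have cK : c <= c + K by rewrite lerDl.
  split; first by apply: (le_trans h1); by apply: (ler_wpM2r (powR_ge0 _ _)).
  apply: (le_trans h2); apply: ler_wpM2r; first exact: enorm_ge0.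
  by apply: (ler_wpM2r (powR_ge0 _ _)).
have far : 2 <= (c + K) * enorm (x - y) `^ alpha.
  apply: (@le_trans _ _ (K * c^-1 `^ alpha)).
    rewrite /K -mulrA -powRM ?invr_ge0 ?(ltW c0) // mulfV ?gt_eqF //.
    by rewrite powR1 mulr1.
  apply: ler_pM; [exact: K0|exact: powR_ge0|by rewrite lerDr ltW|].
  by apply: ge0_ler_powR => //; rewrite ?nnegrE ?invr_ge0 ?(ltW c0) ?(ltW alpha0) //; exact: enorm_ge0.
have [nx _] := nuO bx; have [ny _] := nuO by_.
split.
  by apply: le_trans far; apply: (le_trans (enormB _ _)); rewrite nx ny; lra.
apply: (@le_trans _ _ (2 * enorm (x - y))); last by apply: (ler_wpM2r (enorm_ge0 _)).
apply: (le_trans (cauchy_schwarz _ _)); rewrite nx mul1r.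
have := enorm_ge0 (x - y); lra.
Qed.

End Domain.

(** * Growth of the surface measure on balls *)

Section Growth.
Variables (R : realType) (m : nat).
Implicit Types x y v w : 'rV[R]_m.+1.

Lemma exists_large_coord v : enorm v = 1 -> exists i, m.+1%:R^-1 <= `|v ord0 i|.
Proof.
move=> v1; apply: contrapT => /forallNP h.
have : enorm v < 1; last by rewrite v1 ltxx.
apply: (le_lt_trans (enorm_le_sum v)).
apply: (@lt_le_trans _ _ (\sum_(i < m.+1) m.+1%:R^-1)).
  apply: ltr_sum => [|i _]; last by rewrite ltNge; apply/negP; exact: h.
  by apply/hasP; exists ord0 => //; exact: mem_index_enum.
by rewrite sumr_const card_ord -(mulr_natl m.+1%:R^-1) mulfV.
Qed.

(** A vector nearly orthogonal to [v] is controlled by its coordinates other than [i]: dividing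
    [edot v w] by the large coordinate of [v] bounds the coordinate [i] of [w] by the others plus at
    most half of [enorm w], which is absorbed. *)
Lemma enorm_le_transversal v w i (eps : R) : enorm v = 1 -> m.+1%:R^-1 <= `|v ord0 i| ->
  m.+1%:R * eps <= 1 / 2 -> `|edot v w| <= eps * enorm w ->
  enorm w <= 2 * m.+2%:R * \sum_(j < m) `|w ord0 (lift i j)|.
Proof.
move=> v1 vi epsm vw; set S := \sum_(j < m) _.
have S0 : 0 <= S by apply: sumr_ge0.
have wS : enorm w <= `|w ord0 i| + S.
  by apply: (le_trans (enorm_le_sum w)); rewrite (bigD1_ord i).
have viw : `|v ord0 i| * `|w ord0 i| <= eps * enorm w + S.
  have -> : `|v ord0 i| * `|w ord0 i| =
      `|edot v w - \sum_(j < m) v ord0 (lift i j) * w ord0 (lift i j)|.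
    by rewrite -normrM edotE (bigD1_ord i) //= addrK.
  apply: (le_trans (ler_normB _ _)); apply: lerD => //.
  apply: (le_trans (ler_norm_sum _ _ _)); apply: ler_sum => j _.
  rewrite normrM -[leRHS]mul1r; apply: (ler_wpM2r (normr_ge0 _)).
  by rewrite -v1; exact: coord_le_enorm.
have wi : `|w ord0 i| <= m.+1%:R * (eps * enorm w + S).
  apply: le_trans (_ : m.+1%:R * (`|v ord0 i| * `|w ord0 i|) <= _); last by rewrite ler_pM2l.
  rewrite mulrA -[leLHS]mul1r; apply: (ler_wpM2r (normr_ge0 _)).
  by rewrite -ler_pdivrMl // mulr1.
have h : m.+1%:R * eps * enorm w <= 1 / 2 * enorm w by apply: (ler_wpM2r (enorm_ge0 _)).
have -> : m.+2%:R = m.+1%:R + 1 :> R by rewrite natr1.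
by move: wi h wS; set a := m.+1%:R; set b := `|w ord0 i|; set c := enorm w; lra.
Qed.

(** The set is cut by a grid in the [m] coordinates other than a large one of [v]. By transversality
    a cell has diameter of order [rad / k.+1], and the [k.+1 ^ m] cells together cost a multiple of
    [rad ^+ m] that does not depend on the mesh. *)
Lemma hausdorff_transversal_le : exists2 K : R, 0 <= K &
  forall (B : set 'rV[R]_m.+1) x v (rad eps : R), (0 < m)%N -> 0 < rad ->
    enorm v = 1 -> m.+1%:R * eps <= 1 / 2 ->
    (forall y, B y -> enorm (y - x) < rad) ->
    (forall y z, B y -> B z -> `|edot v (y - z)| <= eps * enorm (y - z)) ->
    (hausdorff m B <= (K * rad ^+ m)%:E)%E.
Proof.
pose L : R := 4 * m.+2%:R * m%:R.
have L0 : 0 <= L by rewrite !mulr_ge0.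
exists (unit_ball_vol R m * (L / 2) ^+ m).
  by rewrite mulr_ge0 ?unit_ball_vol_ge0 // exprn_ge0 // divr_ge0.
move=> B x v rad eps m0 rad0 v1 epsm Brad Bflat.
have [i vi] := exists_large_coord v1.
apply/ereal_supP => _ [d /= d0 <-].
have Lr0 : 0 <= L * rad by rewrite mulr_ge0 // ltW.
(* Fine enough for the diameter bound [L * rad / k.+1] of the cells to be at most [d]. *)
pose k := Num.truncn (L * rad / d).
have kd : L * rad / k.+1%:R <= d.
  rewrite ler_pdivrMr // [leRHS]mulrC -ler_pdivrMr //.
  by have /andP[_ /ltW] := truncn_itv (divr_ge0 Lr0 (ltW d0)).
pose h := 2 * rad / k.+1%:R; have h0 : 0 < h by rewrite divr_gt0 // mulr_gt0.
pose idx y (j : 'I_m) : R := ((y - x) ord0 (lift i j) + rad) / h.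
have idx_itv y j : B y -> 0 <= idx y j < k.+1%:R.
  move=> By; have := le_lt_trans (coord_le_enorm (y - x) (lift i j)) (Brad _ By).
  rewrite ltr_norml /idx => /andP[lo hi]; apply/andP; split.
    by apply: divr_ge0; [lra|exact: ltW].
  rewrite ltr_pdivrMr // /h mulrC mulfVK //; lra.
pose F (q : {ffun 'I_m -> 'I_k.+1}) :=
  [set y | B y /\ forall j, Num.truncn (idx y j) = q j].
have FB : B `<=` \bigcup_q F q.
  move=> y By; exists [ffun j => inord (Num.truncn (idx y j))] => //; split=> // j.
  rewrite ffunE inordK //.
  have /andP[i0 i1] := idx_itv y j By.
  have /andP[t0 _] := truncn_itv i0.
  by rewrite -(ltr_nat R); exact: le_lt_trans i1.
apply: le_trans (hausdorff_delta_finite_cover (e := L * rad / k.+1%:R) m0 _ FB _) _.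
- by rewrite divr_ge0.
- move=> q y z [By yq] [Bz zq].
  apply: (le_trans (enorm_le_transversal v1 vi epsm (Bflat _ _ By Bz))).
  have cell j : `|(y - z) ord0 (lift i j)| <= h.
    have /andP[y0 _] := idx_itv y j By; have /andP[z0 _] := idx_itv z j Bz.
    have := truncn_itv y0; have := truncn_itv z0; rewrite yq zq.
    set t := nat_of_ord _; rewrite -natr1 => /andP[z1 z2] /andP[y1 y2].
    have E : (y - z) ord0 (lift i j) = (idx y j - idx z j) * h.
      by rewrite /idx -mulrBl mulfVK ?gt_eqF // !mxE; ring.
    rewrite E normrM (gtr0_norm h0) -[leRHS]mul1r ler_pM2r // ler_norml.
    by apply/andP; split; lra.
  apply: (@le_trans _ _ (2 * m.+2%:R * (m%:R * h))).
    rewrite ler_pM2l ?mulr_gt0 //.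
    apply: (@le_trans _ _ (\sum_(j < m) h)); first by apply: ler_sum => j _; exact: cell.
    by rewrite sumr_const card_ord mulr_natl.
  by rewrite /L /h le_eqVlt; apply/orP; left; apply/eqP; field.
rewrite lee_fin card_ffun !card_ord natrX le_eqVlt; apply/orP; left; apply/eqP.
rewrite mulrCA -[in RHS]mulrA; congr (_ * _); rewrite -!exprMn; congr (_ ^+ _).
by field.
Qed.

End Growth.

Section BorelSets.
Variables (R : realType) (n : nat).

Definition eball (x : 'rV[R]_n) (r : R) : set 'rV[R]_n := [set y | enorm (y - x) < r].

Lemma open_eball (x : 'rV[R]_n) (r : R) : open (eball x r).
Proof.
rewrite openE => y yr; have d0 : 0 < r - enorm (y - x) by rewrite subr_gt0.
apply: filterS (near_enorm y d0) => z zy.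
by apply: (le_lt_trans (enorm_tri z y x)); rewrite -ltrBrDr.
Qed.

Lemma measurable_eball (x : 'rV[R]_n) (r : R) :
  measurable (eball x r : set (Borel R n)).
Proof. by apply: sub_sigma_algebra; exact: open_eball. Qed.

Lemma closed_measurable (A : set 'rV[R]_n) : closed A -> measurable (A : set (Borel R n)).
Proof.
move=> cA; rewrite -[A]setCK; apply: measurableC.
by apply: sub_sigma_algebra; exact: closed_openC.
Qed.

End BorelSets.

Section SurfaceGrowth.
Variables (R : realType) (m : nat) (alpha : R) (Omega : set 'rV[R]_m.+1).
Variables (nu : 'rV[R]_m.+1 -> 'rV[R]_m.+1) (sigma : {measure set (Borel R m.+1) -> \bar R}).
Hypotheses (m0 : (0 < m)%N) (alpha01 : 0 < alpha < 1) (domO : C1alpha_domain alpha Omega).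
Hypotheses (nuO : outward_normal_field Omega nu) (sigmaH : surface_measure Omega sigma).
Implicit Types x y : 'rV[R]_m.+1.

Lemma measurable_bdry : measurable (bdry Omega : set (Borel R m.+1)).
Proof. by apply: closed_measurable; exact: bdry_closed. Qed.

Lemma measurable_bdry_eball x r :
  measurable (bdry Omega `&` eball x r : set (Borel R m.+1)).
Proof. by apply: measurableI; [exact: measurable_bdry|exact: measurable_eball]. Qed.

Lemma surface_growth_small : exists K r0 : R, [/\ 0 <= K, 0 < r0 &
  forall x r, bdry Omega x -> 0 < r <= r0 ->
  (sigma (bdry Omega `&` eball x r) <= (K * r ^+ m)%:E)%E].
Proof.
have alpha0 : 0 < alpha by case/andP: alpha01.
have [K1 K10 normal] := normal_holder alpha01 domO nuO sigmaH.
have [K K0 growth] := @hausdorff_transversal_le R m.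
(* In a ball of radius [r] around [x], chords of the boundary deviate from the tangent plane at [x]
   by at most 3 K1 r^alpha relative to their length: a factor 2 from the chord, which may be as long
   as [2 * r], and 1 from the turning of the normal. [q] brings this below the threshold of the grid
   argument. *)
pose q : R := 6 * m.+1%:R * K1 + 1.
have q0 : 0 < q by rewrite ltr_wpDl // !mulr_ge0.
exists K, (q^-1 `^ alpha^-1); split=> //; first by rewrite powR_gt0 // invr_gt0.
move=> x r bx /andP[r0 rle].
have ra : r `^ alpha <= q^-1.
  apply: (@le_trans _ _ ((q^-1 `^ alpha^-1) `^ alpha)).
    by apply: ge0_ler_powR => //; rewrite ?nnegrE ?powR_ge0 ?(ltW alpha0) ?(ltW r0).
  by rewrite -powRrM mulVf ?gt_eqF // powRr1 // invr_ge0 ltW.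
rewrite sigmaH; last exact: measurable_bdry_eball.
have [vx _] := nuO bx.
apply: (growth _ x (nu x) r (3 * K1 * r `^ alpha)) => //.
- apply: (@le_trans _ _ (m.+1%:R * (3 * K1 * q^-1))).
    by rewrite ler_pM2l //; apply: ler_wpM2l ra; rewrite mulr_ge0.
  by rewrite !mulrA ler_pdivrMr // /q; lra.
- by move=> y [[_ yr] _].
move=> y z [[by_ yr] _] [[bz zr] _].
have {}yr : enorm (y - x) < r := yr; have {}zr : enorm (z - x) < r := zr.
have [_ h1] := normal y z by_ bz; have [h2 _] := normal x y bx by_.
have -> : edot (nu x) (y - z) = edot (nu y) (y - z) + edot (nu x - nu y) (y - z).
  by rewrite edotBl addrCA subrr addr0.
apply: (le_trans (ler_normD _ _)).
have w0 := enorm_ge0 (y - z).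
have yz2 : enorm (y - z) `^ alpha <= 2 * r `^ alpha.
  apply: (@le_trans _ _ ((2 * r) `^ alpha)).
    apply: (ge0_ler_powR (ltW alpha0)) => //; first by rewrite nnegrE mulr_ge0 ?(ltW r0).
    apply: (le_trans (enorm_tri y x z)); rewrite (enormBC x z).
    by rewrite mulr_natl mulr2n; apply: lerD; exact: ltW.
  rewrite powRM ?(ltW r0) //; apply: (ler_wpM2r (powR_ge0 _ _)).
  rewrite -[leRHS]powRr1 //; apply: ler_powR; first by rewrite ler1n.
  by case/andP: alpha01 => _ /ltW.
have xy : enorm (x - y) `^ alpha <= r `^ alpha.
  apply: (ge0_ler_powR (ltW alpha0)); [exact: enorm_ge0|by rewrite nnegrE ltW|].
  by rewrite enormBC ltW.
have h3 : `|edot (nu x - nu y) (y - z)| <= K1 * r `^ alpha * enorm (y - z).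
  apply: (le_trans (cauchy_schwarz _ _)); apply: (ler_wpM2r w0).
  by apply: (le_trans h2); apply: (ler_wpM2l K10).
have h4 : `|edot (nu y) (y - z)| <= K1 * (2 * r `^ alpha) * enorm (y - z).
  by apply: (le_trans h1); apply: (ler_wpM2r w0); apply: (ler_wpM2l K10).
apply: (le_trans (lerD h4 h3)).
by rewrite le_eqVlt; apply/orP; left; apply/eqP; ring.
Qed.

(* Otherwise the complements of sets of finite measure would form a proper
   filter on the compact boundary without cluster point. *)
Lemma surface_finite : (sigma (bdry Omega) < +oo)%E.
Proof.
have [K [r0 [K0 r00 growth]]] := surface_growth_small.
apply: contrapT => infty.
pose F : set_system 'rV[R]_m.+1 := [set A | exists E : set (Borel R m.+1),
  [/\ measurable E, bdry Omega `\` A `<=` E & (sigma E < +oo)%E]].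
have FF : ProperFilter F.
  split.
    move=> [E [mE sub fE]]; apply: infty; apply: le_lt_trans fE.
    by apply: le_measure; rewrite ?inE //; [exact: measurable_bdry|rewrite setD0 in sub].
  split.
  - exists set0; split; [exact: measurable0|by rewrite setDT|by rewrite measure0].
  - move=> A B [E [mE AE fE]] [E' [mE' BE' fE']].
    exists (E `|` E'); split; first exact: measurableU.
      move=> x [bx]; rewrite /setI /= => /not_andP[nA|nB]; first by left; exact: AE.
      by right; exact: BE'.
    apply: (@le_lt_trans _ _ (sigma E + sigma E')%E); first exact: measureU2.
    by rewrite lte_add_pinfty.
  - move=> A B AB [E [mE AE fE]]; exists E; split=> // x [bx nB]; apply: AE.
    by split=> // /AB.
have Fb : F (bdry Omega).
  exists set0; split; [exact: measurable0|by rewrite setDv|by rewrite measure0].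
have [x [bx]] := bdry_compact domO FF Fb.
move=> /(_ (~` eball x r0) (eball x r0))[].
- exists (bdry Omega `&` eball x r0); split.
  + exact: measurable_bdry_eball.
  + by rewrite setDE setCK.
  + by apply: (le_lt_trans (growth x r0 bx _)); rewrite ?r00 ?lexx ?ltry.
- exact: near_enorm.
by move=> y [].
Qed.

Lemma surface_growth : exists2 K : R, 0 <= K & forall x r, bdry Omega x -> 0 < r ->
  (sigma (bdry Omega `&` eball x r) <= (K * r ^+ m)%:E)%E.
Proof.
have [K [r0 [K0 r00 growth]]] := surface_growth_small.
pose s := fine (sigma (bdry Omega)); have s0 : 0 <= s by rewrite fine_ge0.
have sE : sigma (bdry Omega) = s%:E by rewrite fineK // ge0_fin_numE // surface_finite.
(* The second summand serves the radii beyond [r0], for which the total mass [s] is a sufficient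
   bound. *)
exists (K + s / r0 ^+ m); first by rewrite addr_ge0 // divr_ge0 // exprn_ge0 // ltW.
move=> x r bx r_0; have [rle|rgt] := leP r r0.
  apply: (le_trans (growth x r bx _)); first by rewrite r_0 rle.
  rewrite lee_fin; apply: ler_wpM2r; first by rewrite exprn_ge0 // ltW.
  by rewrite lerDl divr_ge0 // exprn_ge0 // ltW.
apply: (@le_trans _ _ (sigma (bdry Omega))).
  by apply: le_measure; rewrite ?inE; [exact: measurable_bdry_eball|exact: measurable_bdry|exact: subIsetl].
rewrite sE lee_fin mulrDl; apply: ler_wpDl; first by rewrite mulr_ge0 // exprn_ge0 // ltW.
rewrite mulrAC ler_pdivlMr ?exprn_gt0 // ler_wpM2l // lerXn2r ?nnegrE ?(ltW r00) ?(ltW r_0) //.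
exact: ltW.
Qed.

End SurfaceGrowth.

(** * Borel measurability and Gaussian integrals over the boundary *)

Section BorelFunctions.
Variables (R : realType) (n : nat).

Lemma within_continuous_Borel_measurable (D : set 'rV[R]_n) (f : 'rV[R]_n -> R) :
  closed D -> {within D, continuous f} -> measurable_fun (D : set (Borel R n)) (f : Borel R n -> R).
Proof.
move=> cD fc; apply: (measurability _ (RGenOInfty.measurableE R)) => //.
move=> _ [_ [a ->] <-].
have /continuousP/(_ _ (@open_gt R a)) := fc; rewrite open_subspaceP => -[V oV VD].
have -> : D `&` f @^-1` `]a, +oo[ = V `&` D.
  rewrite VD; apply/seteqP; split=> x /=; rewrite in_itv /= andbT => -[]; by [].
by apply: measurableI; [exact: sub_sigma_algebra|exact: closed_measurable].
Qed.

Lemma continuous_Borel_measurable_real (f : 'rV[R]_n -> R) (D : set (Borel R n)) :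
  measurable D -> continuous f -> measurable_fun D (f : Borel R n -> R).
Proof.
move=> mD fc; apply: (@measurable_funS _ _ _ _ setT) => //.
apply: within_continuous_Borel_measurable; first exact: closedT.
exact: continuous_subspaceT.
Qed.

End BorelFunctions.

(** The heat kernel has [c = 4]. Comparing kernels at different times or points widens it to at most
    16, and absorbing a power of [r] doubles it once more; 32 dominates every case. *)
Definition bump (R : realType) (c s r : R) : R := expR (- (r ^+ 2 / (c * s))).

Lemma bump_ge0 (R : realType) (c s r : R) : 0 <= bump c s r.
Proof. exact: expR_ge0. Qed.

Lemma bump_le1 (R : realType) (c s r : R) : 0 <= c * s -> bump c s r <= 1.
Proof. by move=> cs; rewrite /bump -expR0 ler_expR oppr_le0; apply: mulr_ge0; rewrite ?sqr_ge0 ?invr_ge0. Qed.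

Lemma enorm_sub_continuous (R : realType) (n : nat) (x : 'rV[R]_n) :
  continuous (fun y : 'rV[R]_n => enorm (x - y)).
Proof.
rewrite (_ : (fun y => _) = @enorm R n \o (fun y => x - y)) // => y.
apply: continuous_comp; last exact: enorm_continuous.
by apply: (@cvgB _ _ _ (nbhs y) (nbhs_filter y)); [exact: cvg_cst|exact: cvg_id].
Qed.

Lemma bump_continuous (R : realType) (n : nat) (c s : R) (x : 'rV[R]_n) :
  continuous (fun y : 'rV[R]_n => bump c s (enorm (x - y))).
Proof.
rewrite (_ : (fun y => _) = expR \o (fun y => - (enorm (x - y) ^+ 2 / (c * s)))) // => y.
apply: continuous_comp; last exact: continuous_expR.
apply: (@cvgN _ R^o _ (nbhs y) (nbhs_filter y)).
apply: (@cvgM _ _ (nbhs y) (nbhs_filter y)); last exact: cvg_cst.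
by apply: (@cvgM _ _ (nbhs y) (nbhs_filter y)); exact: enorm_sub_continuous.
Qed.

Section Gauss.
Variables (R : realType) (m : nat).
Variables (sigma : {measure set (Borel R m.+1) -> \bar R}) (S : set (Borel R m.+1)) (K : R).
Hypotheses (mS : measurable S) (K0 : 0 <= K).
Hypothesis growth : forall x r, S x -> 0 < r -> (sigma (S `&` eball x r) <= (K * r ^+ m)%:E)%E.
Implicit Types x y : 'rV[R]_m.+1.

Local Notation gauss s x y := (bump 32 s (enorm (x - y))).

Lemma gauss_decay : exists2 C : R, 0 <= C & forall u : R, 0 <= u ->
  u ^+ m.+1 * expR (- (u ^+ 2 / 32)) <= C.
Proof.
have k0 : 0 <= m.+1%:R / 2 :> R by rewrite divr_ge0.
have [C C0 CP] := powR_absorb k0.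
exists (32 `^ (m.+1%:R / 2) * C); first by rewrite mulr_ge0 ?powR_ge0 ?ltW.
move=> u u0; set w := u ^+ 2 / 32.
have w0 : 0 <= w by rewrite divr_ge0 ?exprn_ge0.
have -> : u ^+ m.+1 = 32 `^ (m.+1%:R / 2) * w `^ (m.+1%:R / 2).
  rewrite -powRM // /w mulrC divfK // -[u ^+ 2]powR_mulrn // -powRrM mulrCA mulfV // mulr1.
  by rewrite powR_mulrn.
rewrite -mulrA; apply: (ler_wpM2l (powR_ge0 _ _)).
apply: (le_trans (CP _ w0)); rewrite -[leRHS]mulr1; apply: (ler_wpM2l (ltW C0)).
by rewrite -expR0 ler_expR oppr_le0 divr_ge0.
Qed.

(** The Gaussian lies below a series of indicators of balls of radius 2^k sqrt(s), with weights of
    order 2^(-k(m+1)). This decay has one power more than the growth of the measure, which leaves a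
    geometric series. *)
Lemma integral_bump : exists2 C : R, 0 <= C & forall s x, 0 < s -> S x ->
  (\int[sigma]_(y in S) (gauss s x y)%:E <= (C * s `^ (m%:R / 2))%:E)%E.
Proof.
have [D D0 DP] := gauss_decay.
(* The 1 serves the innermost ball. The factor 2 ^+ m.+1 appears because a point whose first ball
   has index k+1 is only known to satisfy u >= 2^k. *)
pose A : R := 1 + 2 ^+ m.+1 * D.
have A0 : 0 <= A by rewrite addr_ge0 // mulr_ge0 // exprn_ge0.
exists (2 * A * K); first by rewrite !mulr_ge0.
move=> s x s0 Sx; set q := Num.sqrt s.
have q0 : 0 < q by rewrite sqrtr_gt0.
have qm : s `^ (m%:R / 2) = q ^+ m.
  by rewrite mulrC powRrM powR12_sqrt ?(ltW s0) // powR_mulrn // sqrtr_ge0.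
pose B k : set (Borel R m.+1) := eball x (2 ^+ k * q).
pose a k : R := A * 2^-1 ^+ (k * m.+1).
have a0 k : 0 <= a k by rewrite mulr_ge0 // exprn_ge0 // invr_ge0.
have mB k : measurable (B k) by exact: measurable_eball.
pose f k (y : Borel R m.+1) : \bar R := (a k * \1_(B k) y)%:E.
have f0 k y : (0 <= f k y)%E by rewrite lee_fin mulr_ge0.
have mf k : measurable_fun S (f k).
  by apply/measurable_EFinP; apply: measurable_funM => //; exact: measurable_indic.
apply: (@le_trans _ _ (\int[sigma]_(y in S) \sum_(0 <= k <oo) f k y)%E).
  apply: ge0_le_integral => //.
  - by move=> y _; rewrite lee_fin bump_ge0.
  - apply/measurable_EFinP; apply: continuous_Borel_measurable_real => //.
    exact: bump_continuous.
  - by apply: ge0_emeasurable_sum => // k y _ _; exact: f0.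
  move=> y Sy; pose u := enorm (y - x) / q.
  have u0 : 0 <= u by rewrite divr_ge0 ?enorm_ge0 ?(ltW q0).
  have gE : gauss s x y = expR (- (u ^+ 2 / 32)).
    rewrite /bump enormBC; congr (expR (- _)).
    have qq : q ^+ 2 = s by rewrite sqr_sqrtr // ltW.
    by rewrite /u exprMn exprVn qq invfM (mulrC 32^-1) mulrA.
  have [k Bk ak] : exists2 k, B k y & gauss s x y <= a k.
    have [u1|u1] := ltP u 1.
      exists 0%N; first by rewrite /B /eball /= expr0 -ltr_pdivrMr.
      rewrite /a mul0n expr0 mulr1 gE; apply: (@le_trans _ _ 1).
        by rewrite -expR0 ler_expR oppr_le0 divr_ge0 ?exprn_ge0.
      by rewrite lerDl mulr_ge0 // exprn_ge0.
    have exk : exists k, u < 2 ^+ k.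
      exists (Num.truncn u).+1; have /andP[_ ut] := truncn_itv u0.
      by apply: (lt_le_trans ut); rewrite -natrX ler_nat ltnW // ltn_expl.
    case: (ex_minnP exk) => -[|k] uk kmin; first by move: uk; rewrite expr0 ltNge u1.
    exists k.+1; first by rewrite /B /eball /= -ltr_pdivrMr.
    have ku : 2 ^+ k <= u by rewrite leNgt; apply/negP => /kmin; rewrite ltnn.
    have k20 : 0 < 2 ^+ k :> R by rewrite exprn_gt0.
    have h := DP _ u0; rewrite -gE in h.
    have h2 : (2 ^+ k) ^+ m.+1 * gauss s x y <= D.
      apply: le_trans h; apply: (ler_wpM2r (bump_ge0 _ _ _)).
      by rewrite lerXn2r // nnegrE ltW.
    have e1 : (2^-1 ^+ k.+1) ^+ m.+1 = ((2 ^+ k.+1) ^+ m.+1)^-1 :> R by rewrite !exprVn.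
    have e2 : (2 ^+ k.+1) ^+ m.+1 = 2 ^+ m.+1 * (2 ^+ k) ^+ m.+1 :> R.
      by rewrite (exprS 2 k) exprMn.
    rewrite /a exprM e1 ler_pdivlMr ?exprn_gt0 // e2 mulrC -mulrA.
    apply: (@le_trans _ _ (2 ^+ m.+1 * D)); last by rewrite lerDr.
    by apply: ler_wpM2l; first exact: exprn_ge0.
  apply: (@le_trans _ _ (f k y)); first by rewrite /f indicE mem_set // mulr1 lee_fin.
  rewrite (nneseries_split 0 k.+1) // add0n big_nat_recr //= -addeA addeCA.
  by apply: leeDl; apply: adde_ge0; [exact: sume_ge0|exact: nneseries_ge0].
rewrite integral_nneseries //.
apply: (@le_trans _ _ (\sum_(0 <= k <oo) (2 * A * K * q ^+ m / (2 ^ k.+1)%:R)%:E)%E); last first.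
  by apply: (le_trans (epsilon_trick0 _ _)); rewrite ?qm // !mulr_ge0 // exprn_ge0 // ltW.
apply: lee_nneseries => [k _ _|k _]; first by apply: integral_ge0.
rewrite (integralZl_indic mS (fun=> B k)) //; last by rewrite ltNge a0.
rewrite integral_indic // setIC.
apply: (@le_trans _ _ ((a k)%:E * (K * (2 ^+ k * q) ^+ m)%:E)%E).
  apply: lee_wpmul2l; first by rewrite lee_fin.
  by apply: growth => //; rewrite mulr_gt0 // exprn_gt0.
rewrite -EFinM lee_fin le_eqVlt; apply/orP; left; apply/eqP.
set p : R := 2 ^+ k; have p0 : p != 0 by rewrite expf_neq0.
have e1 : 2^-1 ^+ (k * m.+1) = (p * p ^+ m)^-1 :> R by rewrite exprM 2!exprVn -exprS.
have e2 : (2 ^ k.+1)%:R = 2 * p :> R by rewrite natrX exprS.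
rewrite /a e1 e2 exprMn; have := expf_neq0 m p0; move: (p ^+ m) => P P0.
by field; rewrite p0 P0.
Qed.

End Gauss.

(** * Pointwise estimates of the heat kernel *)

Section PowerLemmas.
Variable R : realType.
Implicit Types (a b c k r s : R).

Lemma powR_mul s a b : 0 < s -> s `^ a * s `^ b = s `^ (a + b).
Proof. by move=> s0; rewrite powRD // (gt_eqF s0) implybT. Qed.

Lemma powR_mulr s a : 0 <= s -> 0 <= a -> s `^ a * s = s `^ (a + 1).
Proof.
move=> s0 a0; rewrite powRD ?powRr1 //; apply/implyP => /eqP h; exfalso.
by move: h; lra.
Qed.

Lemma le_bump c c' s s' r : 0 < c * s <= c' * s' -> bump c s r <= bump c' s' r.
Proof.
move=> /andP[cs0 le]; rewrite ler_expR lerN2; apply: ler_wpM2l; first exact: sqr_ge0.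
by rewrite lef_pV2 // posrE ?(lt_le_trans cs0).
Qed.

Lemma powR_bump k c : 0 <= k -> 0 < c -> exists2 C, 0 <= C &
  forall s r, 0 < s -> 0 <= r -> r `^ k * bump c s r <= C * s `^ (k / 2) * bump (2 * c) s r.
Proof.
move=> k0 c0; have k2 : 0 <= k / 2 by rewrite divr_ge0.
have [C C0 CP] := powR_absorb k2.
exists (C * c `^ (k / 2)); first by rewrite mulr_ge0 ?powR_ge0 // ltW.
move=> s r s0 r0; pose w := r ^+ 2 / (c * s).
have cs0 : 0 < c * s by rewrite mulr_gt0.
have w0 : 0 <= w by rewrite divr_ge0 ?sqr_ge0 // ltW.
have rk : r `^ k = c `^ (k / 2) * s `^ (k / 2) * w `^ (k / 2).
  rewrite -!powRM ?(ltW c0) ?(ltW s0) ?(ltW cs0) // /w mulrC divfK ?gt_eqF //.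
  by rewrite -powR_mulrn // -powRrM mulrCA mulfV // mulr1.
have -> : bump (2 * c) s r = expR (- (w / 2)).
  by congr (expR (- _)); rewrite /w; field; rewrite !gt_eqF.
have aux (p q e : R) : C * p * q * e = p * q * (C * e) by ring.
rewrite rk aux -[leLHS]mulrA.
by apply: ler_wpM2l; [rewrite mulr_ge0 ?powR_ge0|exact: CP].
Qed.

End PowerLemmas.

Section Kernel.
Variables (R : realType) (m : nat).
Implicit Types (u x y z v w : 'rV[R]_m.+1) (s h : R).

Lemma enorm_line_sqr u v (t : R) :
  enorm (u + t *: v) ^+ 2 = enorm u ^+ 2 + 2 * t * edot v u + t ^+ 2 * enorm v ^+ 2.
Proof.
by rewrite !enorm_sqr !(edotDl, edotDr, edotZl, edotZr) (edotC u v); ring.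
Qed.

Definition heat_const : R := (4 * pi) `^ (- (m.+1%:R / 2)).

Lemma heat_const_ge0 : 0 <= heat_const. Proof. exact: powR_ge0. Qed.

Lemma heat_kernelE s z : 0 < s ->
  heat_kernel s z = heat_const * s `^ (- (m.+1%:R / 2)) * bump 4 s (enorm z).
Proof.
by move=> s0; rewrite /heat_kernel s0 powRM ?mulr_ge0 ?pi_ge0 ?(ltW s0).
Qed.

Definition grad_heat s v z : R := edot v z / (2 * s) * heat_kernel s z.

(** Along a line the squared norm is a quadratic polynomial, so a one-variable derivative suffices.
    For [s <= 0] both sides vanish; this covers the endpoint [tau = t] of the time integral. *)
Lemma derive_heat_kernel s v x y :
  'D_v (fun z : 'rV[R]_m.+1 => heat_kernel s (z - y) : R^o) x = - grad_heat s v (x - y).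
Proof.
have [s0|s0] := ltP 0 s; last first.
  rewrite /grad_heat {2}/heat_kernel ltNge s0 /= mulr0 oppr0.
  rewrite (_ : (fun z => _) = cst 0) ?derive_cst //.
  by apply/funext => z; rewrite /heat_kernel ltNge s0.
pose c := heat_const * s `^ (- (m.+1%:R / 2)).
pose u := x - y.
pose q (t : R) : R := - ((enorm u ^+ 2 + 2 * t * edot v u + t ^+ 2 * enorm v ^+ 2) / (4 * s)).
have fE t : heat_kernel s (x + t *: v - y) = c * expR (q t).
  have E : enorm (x + t *: v - y) ^+ 2 = enorm u ^+ 2 + 2 * t * edot v u + t ^+ 2 * enorm v ^+ 2.
    by rewrite addrAC; exact: enorm_line_sqr.
  by rewrite (heat_kernelE _ s0) /bump E.
have dq : is_derive (0 : R) (1 : R) q (- (2 * edot v u / (4 * s))).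
  rewrite /q; apply: is_derive_eq.
  by rewrite /GRing.scale /= ?(expr0n, mulr0, mul0r, addr0, add0r, mulr1); ring.
have df : is_derive (0 : R) (1 : R) (fun t => c * expR (q t) : R^o) (- grad_heat s v u).
  have de : is_derive (0 : R) (1 : R) (expR \o q) (expR (q 0) * - (2 * edot v u / (4 * s))).
    exact: is_derive1_comp.
  have q0 : q 0 = - (enorm u ^+ 2 / (4 * s)).
    by rewrite /q mulr0 mul0r expr0n mul0r !addr0.
  have -> : - grad_heat s v u = c * (expR (q 0) * - (2 * edot v u / (4 * s))).
    by rewrite q0 /grad_heat (heat_kernelE _ s0) -/c /bump; field; rewrite gt_eqF.
  exact: (is_deriveZ c de).
rewrite -(@derive_val _ _ _ _ _ _ _ df).
suff E : (fun h : R => h^-1 *: (heat_kernel s (h *: v + x - y) - heat_kernel s (x - y) : R^o)) =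
    (fun h : R => h^-1 *: (c * expR (q (h *: (1 : R) + 0)) - c * expR (q 0) : R^o)).
  by rewrite /derive /= E.
apply/funext => t.
have -> : t *: (1 : R) + 0 = t by rewrite addr0 /GRing.scale /= mulr1.
by rewrite -(fE t) -(fE 0) scale0r addr0 (addrC x (t *: v)).
Qed.

End Kernel.

Local Opaque bump.

Section RadialEstimates.
Variables (R : realType) (m : nat) (alpha : R).
Hypothesis alpha0 : 0 < alpha.
Implicit Types (s h r k : R).

Let p : R := m.+1%:R / 2 + 1.
Let p0 : 0 <= p. Proof. by rewrite addr_ge0 // divr_ge0. Qed.
Let pE : p = m%:R / 2 + 3 / 2.
Proof. by rewrite /p -natr1; field. Qed.

(** Normalized for the dimension [m] of the boundary: its integral there is bounded uniformly in
    [s], so the factor in front of it in a pointwise bound survives integration up to a constant. *)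
Definition scaled_bump s r : R := s `^ (- (m%:R / 2)) * bump 32 s r.

Lemma scaled_bump_ge0 s r : 0 <= scaled_bump s r.
Proof. exact: (mulr_ge0 (powR_ge0 _ _) (bump_ge0 _ _ _)). Qed.

(* [- p] is the exponent of the time in the gradient of the heat kernel. *)
Lemma powR_scaled_bump k j c : 0 <= k -> 0 < c <= 16 -> exists2 C, 0 <= C &
  forall s r, 0 < s -> 0 <= r ->
    r `^ k * (s `^ (- p - j) * bump c s r) <= C * s `^ (k / 2 - 3 / 2 - j) * scaled_bump s r.
Proof.
move=> k0 /andP[c0 c16]; have [C C0 CP] := powR_bump k0 c0.
exists C => // s r s0 r0; rewrite /scaled_bump.
have -> : C * s `^ (k / 2 - 3 / 2 - j) * (s `^ (- (m%:R / 2)) * bump 32 s r) =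
    s `^ (- p - j) * (C * s `^ (k / 2) * bump 32 s r).
  have e : s `^ (k / 2 - 3 / 2 - j) * s `^ (- (m%:R / 2)) = s `^ (- p - j) * s `^ (k / 2).
    by rewrite !powR_mul // pE; congr (_ `^ _); ring.
  have aux (a b d e' f : R) : a * b = d * e' -> C * a * (b * f) = d * (C * e' * f).
    by move=> ab; rewrite -[LHS]mulrA (mulrA a) ab; ring.
  exact: aux.
rewrite mulrCA; apply: (ler_wpM2l (powR_ge0 _ _)).
apply: (le_trans (CP s r s0 r0)); apply: ler_wpM2l; first exact: (mulr_ge0 C0 (powR_ge0 _ _)).
by apply: le_bump; rewrite !mulr_gt0 //= ler_pM2r //; lra.
Qed.

Lemma bump_lip c s s' r r' b : 0 < s -> 0 < s' -> 0 < c ->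
  expR (- (r ^+ 2 / (c * s))) <= b -> expR (- (r' ^+ 2 / (c * s'))) <= b ->
  `|bump c s r - bump c s' r'| <= `|r ^+ 2 / (c * s) - r' ^+ 2 / (c * s')| * b.
Proof.
move=> s0 s0' c0 h1 h2; apply: (le_trans (expRN_lip _ _)).
apply: ler_wpM2l; first exact: normr_ge0.
by rewrite minEle; case: ifP.
Qed.

(** The power and the Gaussian are varied one after the other. Each change costs a factor of order
    h/s: directly for the power, as h r^2/s^2 for the Gaussian, against which r^2 is worth s. *)
Lemma time_difference : exists2 C, 0 <= C & forall s h r, 0 < s -> 0 <= h <= s -> 0 <= r ->
  r `^ alpha * r * `|(s + h) `^ (- p) * bump 4 (s + h) r - s `^ (- p) * bump 4 s r| <=
  C * (h * s `^ (alpha / 2 - 2)) * scaled_bump s r.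
Proof.
have k1 : 0 <= alpha + 1 by rewrite addr_ge0 // ltW.
have k3 : 0 <= alpha + 1 + 2 by rewrite addr_ge0.
have c8 : 0 < (8 : R) <= 16 by lra.
have [C1 C10 B1] := powR_scaled_bump 1 k1 c8.
have [C2 C20 B2] := powR_scaled_bump 2 k3 c8.
exists (p * C1 + C2); first by rewrite addr_ge0 // mulr_ge0.
move=> s h r s0 /andP[h0 hs] r0.
have sh0 : 0 < s + h by lra.
have b8 : bump 4 (s + h) r <= bump 8 s r by apply: le_bump; apply/andP; split; lra.
have b8' : bump 4 s r <= bump 8 s r by apply: le_bump; apply/andP; split; lra.
have T1 : `|(s + h) `^ (- p) * bump 4 (s + h) r - s `^ (- p) * bump 4 (s + h) r| <=
    p * h * s `^ (- p - 1) * bump 8 s r.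
  rewrite -mulrBl normrM (ger0_norm (bump_ge0 _ _ _)); apply: ler_pM => //.
  - exact: bump_ge0.
  - exact: powRN_lip.
have T2 : `|s `^ (- p) * bump 4 (s + h) r - s `^ (- p) * bump 4 s r| <=
    h * r ^+ 2 * s `^ (- p - 2) * bump 8 s r.
  rewrite -mulrBr normrM (ger0_norm (powR_ge0 _ _)).
  have -> : s `^ (- p - 2) = s `^ (- p) * s ^- 2.
    by rewrite -powR_mul // powR_invn ?(ltW s0).
  have -> : h * r ^+ 2 * (s `^ (- p) * s ^- 2) * bump 8 s r =
      s `^ (- p) * (h * r ^+ 2 * s ^- 2 * bump 8 s r) by ring.
  apply: (ler_wpM2l (powR_ge0 _ _)).
  apply: (le_trans (bump_lip sh0 s0 _ b8 b8')) => //.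
  apply: (ler_wpM2r (bump_ge0 _ _ _)).
  have -> : r ^+ 2 / (4 * (s + h)) - r ^+ 2 / (4 * s) = - (r ^+ 2 * h / (4 * (s + h) * s)).
    by field; rewrite !gt_eqF.
  rewrite normrN ger0_norm; last first.
    by apply: divr_ge0; rewrite ?mulr_ge0 ?sqr_ge0 ?(ltW s0) ?(ltW sh0).
  rewrite [h * _]mulrC; apply: ler_wpM2l; first by rewrite mulr_ge0 ?sqr_ge0.
  rewrite lef_pV2 ?posrE ?mulr_gt0 ?exprn_gt0 // expr2.
  by apply: ler_wpM2r; [exact: ltW|lra].
have T : `|(s + h) `^ (- p) * bump 4 (s + h) r - s `^ (- p) * bump 4 s r| <=
    p * h * s `^ (- p - 1) * bump 8 s r + h * r ^+ 2 * s `^ (- p - 2) * bump 8 s r.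
  apply: (le_trans (ler_distD (s `^ (- p) * bump 4 (s + h) r) _ _)).
  exact: (lerD T1 T2).
rewrite powR_mulr ?(ltW alpha0) //.
apply: (le_trans (ler_wpM2l (powR_ge0 _ _) T)).
have e1 := B1 s r s0 r0; have e2 := B2 s r s0 r0.
have E1 : (alpha + 1) / 2 - 3 / 2 - 1 = alpha / 2 - 2 by field.
have E2 : (alpha + 1 + 2) / 2 - 3 / 2 - 2 = alpha / 2 - 2 by field.
rewrite E1 in e1; rewrite E2 in e2.
have E3 : r `^ (alpha + 1 + 2) = r `^ (alpha + 1) * r ^+ 2.
  rewrite powRD ?powR_mulrn //; apply/implyP => /eqP hh; exfalso; move: hh; lra.
rewrite E3 in e2.
move: e1 e2; set A := r `^ _; set S1 := s `^ (- p - 1); set S2 := s `^ (- p - 2).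
set B := bump _ _ _; set Q := s `^ _; set G := scaled_bump _ _ => e1 e2.
have := ler_wpM2l (mulr_ge0 p0 h0) e1; have := ler_wpM2l h0 e2.
have -> : A * (p * h * S1 * B + h * r ^+ 2 * S2 * B) =
  p * h * (A * (S1 * B)) + h * (A * r ^+ 2 * (S2 * B)) by ring.
have -> : (p * C1 + C2) * (h * Q) * G = p * h * (C1 * Q * G) + h * (C2 * Q * G) by ring.
by move=> f1 f2; apply: lerD.
Qed.

End RadialEstimates.

Local Opaque scaled_bump.

Ltac nonneg := repeat first
  [ assumption | exact: expR_ge0 | exact: powR_ge0 | exact: bump_ge0 | exact: ler0n
  | apply: mulr_ge0 | apply: addr_ge0 ].

Section GradHeat.
Variables (R : realType) (m : nat).
Implicit Types (x y z v w : 'rV[R]_m.+1) (s h r k K : R).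

Local Notation p := (m.+1%:R / 2 + 1 : R).
Local Notation sb := (@scaled_bump R m).

Definition half_heat_const : R := heat_const R m / 2.
Local Notation hc := half_heat_const.

Let hc0 : 0 <= hc.
Proof. by rewrite divr_ge0 // heat_const_ge0. Qed.

Lemma grad_heatE s v z : 0 < s ->
  grad_heat s v z = edot v z * hc * (s `^ (- p) * bump 4 s (enorm z)).
Proof.
move=> s0; rewrite /grad_heat (heat_kernelE _ s0) opprD -powR_mul // powR_inv1 ?(ltW s0) //.
by rewrite /half_heat_const; field; rewrite gt_eqF.
Qed.

Local Opaque half_heat_const.

Lemma grad_heatBl s v w z : grad_heat s (v - w) z = grad_heat s v z - grad_heat s w z.
Proof. by rewrite /grad_heat edotBl !mulrBl. Qed.

Lemma grad_heatNl s v z : grad_heat s (- v) z = - grad_heat s v z.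
Proof. by rewrite /grad_heat edotNl !mulNr. Qed.

Lemma norm_grad_heat s v z : 0 < s -> `|grad_heat s v z| =
  `|edot v z| * hc * (s `^ (- p) * bump 4 s (enorm z)).
Proof.
move=> s0; rewrite (grad_heatE _ _ s0) normrM normrM (ger0_norm hc0) (@ger0_norm _ (_ `^ _ * _)) //.
exact: (mulr_ge0 (powR_ge0 _ _) (bump_ge0 _ _ _)).
Qed.

Lemma grad_heat_le (be : R) : 0 <= be -> exists2 C, 0 <= C & forall s v z, 0 < s ->
  enorm z `^ be * `|grad_heat s v z| <= C * enorm v * s `^ (be / 2 - 1) * sb s (enorm z).
Proof.
move=> be0; have k1 : 0 <= be + 1 by rewrite addr_ge0.
have c4 : 0 < (4 : R) <= 16 by lra.
have [C C0 CP] := powR_scaled_bump m 0 k1 c4.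
have H0 := hc0; exists (hc * C); first by nonneg.
move=> s v z s0; rewrite (norm_grad_heat _ _ s0).
have r0 := enorm_ge0 z; have v0 := enorm_ge0 v.
have := CP s (enorm z) s0 r0; rewrite subr0 subr0.
have -> : (be + 1) / 2 - 3 / 2 = be / 2 - 1 by field.
rewrite -powR_mulr //; have := cauchy_schwarz v z.
have A0 := powR_ge0 (enorm z) be.
have B0 : 0 <= s `^ (- p) * bump 4 s (enorm z) := mulr_ge0 (powR_ge0 _ _) (bump_ge0 _ _ _).
move: r0 v0 A0 B0.
set d := `|_|; set r := enorm z; set V := enorm v; set A := r `^ be; set B := _ * bump _ _ _.
set Q := s `^ _; set G := sb _ _ => r0 v0 A0 B0 dle h.
apply: (@le_trans _ _ (hc * V * (A * r * B))).
  have -> : A * (d * hc * B) = hc * A * B * d by ring.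
  have -> : hc * V * (A * r * B) = hc * A * B * (V * r) by ring.
  by apply: ler_wpM2l dle; nonneg.
have -> : hc * C * V * Q * G = hc * V * (C * Q * G) by ring.
by apply: ler_wpM2l h; nonneg.
Qed.

Section Tangent.
Variables (alpha K : R).
Hypotheses (alpha0 : 0 < alpha) (K0 : 0 <= K).

(** Tangency contributes an extra [enorm z] to the power [alpha], worth s^(alpha/2) against the
    Gaussian: the exponent in time rises from the critical -1 to an integrable one. *)
Lemma grad_heat_tangent_le : exists2 C, 0 <= C & forall s v z, 0 < s ->
  `|edot v z| <= K * enorm z `^ alpha * enorm z ->
  `|grad_heat s v z| <= C * s `^ (alpha / 2 - 1) * sb s (enorm z).
Proof.
have k1 : 0 <= alpha + 1 by rewrite addr_ge0 // ltW.
have c4 : 0 < (4 : R) <= 16 by lra.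
have [C C0 CP] := powR_scaled_bump m 0 k1 c4.
have H0 := hc0; exists (K * hc * C); first by nonneg.
move=> s v z s0 vz; rewrite (norm_grad_heat _ _ s0).
have r0 := enorm_ge0 z.
have := CP s (enorm z) s0 r0; rewrite subr0 subr0.
have -> : (alpha + 1) / 2 - 3 / 2 = alpha / 2 - 1 by field.
rewrite -powR_mulr ?(ltW alpha0) //.
have B0 : 0 <= s `^ (- p) * bump 4 s (enorm z) := mulr_ge0 (powR_ge0 _ _) (bump_ge0 _ _ _).
move: vz B0; set d := `|_|; set r := enorm z; set A := r `^ alpha; set B := _ * bump _ _ _.
set Q := s `^ _; set G := sb _ _ => vz B0 h.
apply: (@le_trans _ _ (K * hc * (A * r * B))).
  have -> : d * hc * B = hc * B * d by ring.
  have -> : K * hc * (A * r * B) = hc * B * (K * A * r) by ring.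
  by apply: ler_wpM2l vz; nonneg.
have -> : K * hc * C * Q * G = K * hc * (C * Q * G) by ring.
by apply: ler_wpM2l h; nonneg.
Qed.

Lemma grad_heat_time : exists2 C, 0 <= C & forall s h v z, 0 < s -> 0 <= h <= s ->
  `|edot v z| <= K * enorm z `^ alpha * enorm z ->
  `|grad_heat (s + h) v z - grad_heat s v z| <=
    C * (h * s `^ (alpha / 2 - 2)) * sb s (enorm z).
Proof.
have [C C0 CP] := time_difference m alpha0.
have H0 := hc0; exists (K * hc * C); first by nonneg.
move=> s h v z s0 hs vz; have sh0 : 0 < s + h by move: s0 hs => ? /andP[? ?]; lra.
rewrite (grad_heatE _ _ s0) (grad_heatE _ _ sh0) -mulrBr normrM normrM (ger0_norm hc0).
have := CP s h (enorm z) s0 hs (enorm_ge0 z).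
set T := `|_ - _|; have T0 : 0 <= T := normr_ge0 _.
move: vz; set d := `|_|; set r := enorm z; set A := r `^ alpha.
set Q := h * _; set G := sb _ _ => vz h'.
apply: (@le_trans _ _ (K * hc * (A * r * T))).
  have -> : d * hc * T = hc * T * d by ring.
  have -> : K * hc * (A * r * T) = hc * T * (K * A * r) by ring.
  by apply: ler_wpM2l vz; nonneg.
have -> : K * hc * C * Q * G = K * hc * (C * Q * G) by ring.
by apply: ler_wpM2l h'; nonneg.
Qed.

(** In the application [v] is the normal at a boundary point [x'], [z] is [x' - y] and [y - z] is
    [x - x']: both are nearly orthogonal to [v]. The scalar product and the Gaussian are varied
    separately. *)
Lemma grad_heat_space : exists2 C, 0 <= C & forall s v y z, 0 < s ->
  enorm (y - z) ^+ 2 <= s ->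
  `|edot v (y - z)| <= K * enorm (y - z) `^ alpha * enorm (y - z) ->
  `|edot v z| <= K * enorm z `^ alpha * enorm z ->
  `|grad_heat s v y - grad_heat s v z| <=
    C * (enorm (y - z) * s `^ (alpha / 2 - 3 / 2)) * (sb s (enorm y) + sb s (enorm z)).
Proof.
have a1 : 0 <= alpha + 1 by rewrite addr_ge0 // ltW.
have a2 : 0 <= alpha + 1 + 1 by rewrite addr_ge0.
have c4 : 0 < (4 : R) <= 16 by lra.
have c8 : 0 < (8 : R) <= 16 by lra.
have [C1 C10 B1] := powR_scaled_bump m 0 (lexx 0) c4.
have [C2 C20 B2] := powR_scaled_bump m 1 a2 c8.
have [C3 C30 B3] := powR_scaled_bump m (1 / 2) a1 c8.
(* From r <= q + h and h^2 <= s follows r^2 <= 2 q^2 + 2 s: moving the center costs the factor [e4]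
   once the width is doubled. *)
pose H := hc; pose e4 : R := expR (1 / 4).
have e40 : 0 <= e4 := expR_ge0 _.
exists (K * H * (C1 + e4 * (C2 + C3))).
  by have H0 : 0 <= H := hc0; nonneg.
move=> s v y z s0 hs vyz vz; set h := enorm (y - z) in hs vyz *.
have h0 : 0 <= h := enorm_ge0 _.
set r := enorm z in vz *; set q := enorm y.
have r0 : 0 <= r := enorm_ge0 _; have q0 : 0 <= q := enorm_ge0 _.
have qr : `|q - r| <= h.
  rewrite ler_norml /q /r /h; apply/andP; split.
    by have := enorm_tri z y 0; rewrite !subr0 (enormBC z y); lra.
  by have := enorm_tri y z 0; rewrite !subr0; lra.
have hss : h <= s `^ (1 / 2).
  rewrite div1r powR12_sqrt ?(ltW s0) // -[leLHS]ger0_norm // -sqrtr_sqr.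
  exact: ler_wsqrtr.
set t := s `^ (1 / 2) in hss; have t0 : 0 <= t := powR_ge0 _ _.
have tt : t ^+ 2 = s by rewrite /t div1r powR12_sqrt ?(ltW s0) // sqr_sqrtr // ltW.
have ha : h `^ alpha <= s `^ (alpha / 2).
  have -> : s `^ (alpha / 2) = t `^ alpha by rewrite /t -powRrM; congr (_ `^ _); field.
  exact: (ge0_ler_powR (ltW alpha0)).
have b8 : bump 4 s r <= e4 * bump 8 s r.
  apply: (@le_trans _ _ (bump 8 s r)); first by apply: le_bump; apply/andP; split; lra.
  rewrite -[leLHS]mul1r; apply: (ler_wpM2r (bump_ge0 _ _ _)).
  by rewrite /e4 -[leLHS]expR0 ler_expR divr_ge0.
have b8' : bump 4 s q <= e4 * bump 8 s r.
  have -> : e4 * bump 8 s r = expR (1 / 4 - r ^+ 2 / (8 * s)) by rewrite -expRD.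
  have -> : bump 4 s q = expR (- (q ^+ 2 / (4 * s))) by [].
  rewrite ler_expR -(@ler_pM2r _ (8 * s)) ?mulr_gt0 //.
  have -> : (1 / 4 - r ^+ 2 / (8 * s)) * (8 * s) = 2 * s - r ^+ 2 by field; rewrite gt_eqF.
  have -> : - (q ^+ 2 / (4 * s)) * (8 * s) = - (2 * q ^+ 2) by field; rewrite gt_eqF.
  have rqh : r ^+ 2 <= (q + h) ^+ 2.
    rewrite lerXn2r ?nnegrE ?addr_ge0 //.
    by move: qr => /ler_normlP[qr' _]; move: qr'; clear; lra.
  by have := sqr_ge0 (q - h); move: rqh hs; clear; lra.
have T2 : `|bump 4 s q - bump 4 s r| <= h * (2 * r + t) / (4 * s) * (e4 * bump 8 s r).
  apply: (le_trans (bump_lip s0 s0 _ b8' b8)) => //.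
  apply: ler_wpM2r; first exact: (mulr_ge0 e40 (bump_ge0 _ _ _)).
  rewrite -mulrBl normrM (@ger0_norm _ (4 * s)^-1) ?invr_ge0 ?mulr_ge0 ?(ltW s0) //.
  apply: ler_wpM2r; first by rewrite invr_ge0 mulr_ge0 // ltW.
  rewrite subr_sqr normrM; apply: ler_pM => //.
  rewrite ger0_norm ?addr_ge0 //.
  by move: qr => /ler_normlP[_ qr']; lra.
rewrite (grad_heatE _ _ s0) (grad_heatE _ _ s0) -/q -/r -/H.
set P := s `^ (- p); have P0 : 0 <= P := powR_ge0 _ _.
have -> : edot v y * H * (P * bump 4 s q) - edot v z * H * (P * bump 4 s r) =
  edot v (y - z) * H * (P * bump 4 s q) + edot v z * H * P * (bump 4 s q - bump 4 s r).
  by rewrite edotBr; ring.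
apply: (le_trans (ler_normD _ _)).
have e1 := B1 s q s0 q0; have e2 := B2 s r s0 r0; have e3 := B3 s r s0 r0.
rewrite powRr0 mul1r !subr0 mul0r sub0r -/P in e1.
have E2 : (alpha + 1 + 1) / 2 - 3 / 2 - 1 = alpha / 2 - 3 / 2 by field.
have E3 : (alpha + 1) / 2 - 3 / 2 - 1 / 2 = alpha / 2 - 3 / 2 by field.
rewrite E2 in e2; rewrite E3 in e3; clear E2 E3.
rewrite -(powR_mulr r0 a1) in e2.
have E4 : s `^ (- p - 1 / 2) = t * s `^ (- p - 1).
  by rewrite /t powR_mul //; congr (_ `^ _); field.
rewrite E4 in e3; clear E4.
have E5 : s `^ (- p - 1) = P / s.
  by rewrite /P -powR_mul // powR_inv1 // ltW.
rewrite E5 in e2 e3; clear E5.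
have E6 : s `^ (alpha / 2) * s `^ (- (3 / 2)) = s `^ (alpha / 2 - 3 / 2) by rewrite powR_mul.
rewrite -(powR_mulr r0 (ltW alpha0)) in e2 e3.
set Q := s `^ (alpha / 2 - 3 / 2) in e2 e3 E6 *.
have G0 x : 0 <= sb s (enorm x) := scaled_bump_ge0 m s _.
have Gq := G0 y; have Gr := G0 z; rewrite -/q in Gq; rewrite -/r in Gr.
set gq := sb s q in e1 Gq *; set gr := sb s r in e2 e3 Gr *.
have Q0 : 0 <= Q := powR_ge0 _ _.
have H0 : 0 <= H := hc0.
have F1 : `|edot v (y - z) * H * (P * bump 4 s q)| <= K * H * C1 * (h * Q) * gq.
  rewrite normrM normrM (ger0_norm H0) (@ger0_norm _ (P * _)) ?mulr_ge0 ?bump_ge0 //.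
  apply: (@le_trans _ _ (K * s `^ (alpha / 2) * h * H * (C1 * s `^ (- (3 / 2)) * gq))).
    apply: ler_pM => //; [by rewrite mulr_ge0|by rewrite mulr_ge0 // bump_ge0|].
    apply: (ler_wpM2r H0); apply: (le_trans vyz); apply: (ler_wpM2r h0).
    exact: (ler_wpM2l K0).
  by rewrite -E6 le_eqVlt; apply/orP; left; apply/eqP; ring.
have F2 : `|edot v z * H * P * (bump 4 s q - bump 4 s r)| <=
    K * H * (e4 * (C2 + C3)) * (h * Q) * gr.
  rewrite normrM normrM normrM (ger0_norm H0) (ger0_norm P0).
  apply: (@le_trans _ _ (K * r `^ alpha * r * H * P *
                         (h * (2 * r + t) / (4 * s) * (e4 * bump 8 s r)))).
    apply: ler_pM => //; first by nonneg.
    by apply: (ler_wpM2r P0); exact: (ler_wpM2r H0).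
  have := lerD e2 e3; set A := r `^ alpha; set B := bump 8 s r.
  have -> : C2 * Q * gr + C3 * Q * gr = (C2 + C3) * Q * gr by ring.
  move=> e23.
  have -> : K * A * r * H * P * (h * (2 * r + t) / (4 * s) * (e4 * B)) =
     K * H * e4 * h * (A * r * r * (P / s * B) / 2 + A * r * (t * (P / s) * B) / 4).
    by field; rewrite gt_eqF.
  have -> : K * H * (e4 * (C2 + C3)) * (h * Q) * gr = K * H * e4 * h * ((C2 + C3) * Q * gr).
    by ring.
  apply: ler_wpM2l; first by nonneg.
  apply: le_trans e23.
  have B0 : 0 <= B := bump_ge0 _ _ _; have A0 : 0 <= A := powR_ge0 _ _.
  have si0 : 0 <= s^-1 by rewrite invr_ge0 ltW.
  have U0 : 0 <= A * r * r * (P / s * B) by nonneg.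
  have V0 : 0 <= A * r * (t * (P / s) * B) by nonneg.
  by move: U0 V0; clear; lra.
apply: (le_trans (lerD F1 F2)).
have HQ : 0 <= K * H * (h * Q) by nonneg.
have X1 : 0 <= K * H * (h * Q) * C1 * gr by nonneg.
have X2 : 0 <= K * H * (h * Q) * (e4 * (C2 + C3)) * gq by nonneg.
by move: X1 X2; clear; lra.
Qed.

End Tangent.

(** [grad_heat] is odd in its last argument, so for [y] close to [- z] only the defect [y + z] and
    the difference of the norms remain, both at most [kap * enorm z]. *)
Lemma grad_heat_reflection : exists2 C, 0 <= C & forall s w y z (kap : R), 0 < s ->
  0 <= kap <= 1 / 2 -> enorm (y + z) <= kap * enorm z ->
  `|grad_heat s w z + grad_heat s w y| <= C * kap * enorm w * s `^ (- 1) * sb s (enorm z).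
Proof.
have c16 : 0 < (16 : R) <= 16 by lra.
have [C1 C10 B1] := powR_scaled_bump m 0 (ler0n R 1) c16.
have [C2 C20 B2] := powR_scaled_bump m 1 (ler0n R 3) c16.
pose H := hc; have H0 : 0 <= H := hc0.
exists (H * (C1 + C2)); first by rewrite mulr_ge0 // addr_ge0.
move=> s w y z kap s0 /andP[k0 k2] yz.
set r := enorm z in yz *; set q := enorm y; set W := enorm w.
have r0 : 0 <= r := enorm_ge0 _; have q0 : 0 <= q := enorm_ge0 _.
have W0 : 0 <= W := enorm_ge0 _.
have qr : `|q - r| <= kap * r.
  rewrite ler_norml /q; apply/andP; split.
    have := enormB (y + z) y; rewrite (addrC y) addrK -/r; move: yz; rewrite (addrC y).
    by set a := enorm (z + y); clear; lra.
  have := enormB (y + z) z; rewrite addrK -/r; move: yz.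
  by set a := enorm (y + z); set b := enorm y; clear; lra.
have kr : kap * r <= r / 2 by rewrite mulrC; apply: ler_wpM2l; lra.
have /andP[q1 q2] : r / 2 <= q <= 3 / 2 * r.
  by move: qr kr => /ler_normlP[]; clear; lra.
have b1 : bump 4 s r <= bump 16 s r by apply: le_bump; apply/andP; split; lra.
(* Since [kap <= 1 / 2], one has q >= r/2, whose square accounts for the factor 4 in the width. *)
have b2 : bump 4 s q <= bump 16 s r.
  have -> : bump 16 s r = expR (- (r ^+ 2 / (16 * s))) by [].
  have -> : bump 4 s q = expR (- (q ^+ 2 / (4 * s))) by [].
  rewrite ler_expR lerN2 -(@ler_pM2r _ (16 * s)) ?mulr_gt0 //.
  have -> : r ^+ 2 / (16 * s) * (16 * s) = r ^+ 2 by field; rewrite gt_eqF.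
  have -> : q ^+ 2 / (4 * s) * (16 * s) = 4 * q ^+ 2 by field; rewrite gt_eqF.
  by move: r0 q1; clear; nra.
have T : `|bump 4 s r - bump 4 s q| <= kap * r ^+ 2 / s * bump 16 s r.
  apply: (le_trans (bump_lip s0 s0 _ b1 b2)) => //.
  apply: (ler_wpM2r (bump_ge0 _ _ _)).
  rewrite -mulrBl normrM (@ger0_norm _ (4 * s)^-1) ?invr_ge0 ?mulr_ge0 ?(ltW s0) //.
  rewrite ler_pdivrMr ?mulr_gt0 //.
  have -> : kap * r ^+ 2 / s * (4 * s) = (kap * r) * (4 * r) by field; rewrite gt_eqF.
  rewrite distrC subr_sqr normrM; apply: ler_pM => //.
  by rewrite ger0_norm ?addr_ge0 //; move: q2 r0; clear; lra.
rewrite (grad_heatE _ _ s0) (grad_heatE _ _ s0) -/q -/r -/H.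
set P := s `^ (- p); have P0 : 0 <= P := powR_ge0 _ _.
have -> : edot w z * H * (P * bump 4 s r) + edot w y * H * (P * bump 4 s q) =
  H * P * (edot w z * (bump 4 s r - bump 4 s q) + edot w (y + z) * bump 4 s q).
  by rewrite edotDr; ring.
have e1 := B1 s r s0 r0; have e2 := B2 s r s0 r0.
have E1 : 1%:R / 2 - 3 / 2 - 0 = - 1 :> R by field.
have E2 : 3%:R / 2 - 3 / 2 - 1 = - 1 :> R by field.
rewrite E1 in e1; rewrite E2 in e2.
rewrite subr0 powRr1 // -/P in e1.
have E5 : s `^ (- p - 1) = P / s.
  by rewrite /P -powR_mul // powR_inv1 // ltW.
rewrite E5 (powR_mulrn 3 r0) in e2.
set Q := s `^ (- 1) in e1 e2 *; set g := sb s r in e1 e2 *.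
set B := bump 16 s r in e1 e2 b1 b2 T.
have B0 : 0 <= B := bump_ge0 _ _ _.
rewrite normrM (@ger0_norm _ (H * P)); last exact: mulr_ge0.
apply: (@le_trans _ _ (H * P * (W * r * (kap * r ^+ 2 / s * B) + W * (kap * r) * B))).
  apply: ler_wpM2l; first exact: mulr_ge0.
  apply: (le_trans (ler_normD _ _)); rewrite !normrM; apply: lerD.
    by apply: ler_pM => //; exact: cauchy_schwarz.
  rewrite (ger0_norm (bump_ge0 _ _ _)); apply: ler_pM => //; first exact: bump_ge0.
  by apply: (le_trans (cauchy_schwarz _ _)); exact: (ler_wpM2l W0).
have -> : H * P * (W * r * (kap * r ^+ 2 / s * B) + W * (kap * r) * B) =
  H * W * kap * (r ^+ 3 * (P / s * B) + r * (P * B)) by field; rewrite gt_eqF.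
have -> : H * (C1 + C2) * kap * W * Q * g = H * W * kap * (C2 * Q * g + C1 * Q * g) by ring.
by apply: ler_wpM2l; [nonneg|exact: lerD].
Qed.

End GradHeat.

(** * Integrals over the boundary *)

Section AlmostInvariant.
Context d (T : measurableType d) (R : realType) (sigma : {measure set T -> \bar R}).
Variables (rho : T -> T) (D : set T) (k : R).
Hypotheses (mrho : measurable_fun setT rho) (mD : measurable D) (rhoD : rho @^-1` D = D).
Hypothesis k0 : 0 <= k.
Hypothesis rhok : forall A, measurable A -> A `<=` D ->
  (sigma (rho @^-1` A) <= k%:E * sigma A)%E.

Let push : {measure set T -> \bar R} :=
  measure_function_pushforward__canonical__measure_function_Measure sigma mrho.

Lemma ge0_integral_almost_invariant (f : T -> \bar R) :
  (forall y, (0 <= f y)%E) -> measurable_fun setT f ->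
  (\int[sigma]_(y in D) f (rho y) <= k%:E * \int[sigma]_(y in D) f y)%E.
Proof.
move=> f0 mf; have mfD : measurable_fun D f by exact: measurable_funTS.
have -> : (\int[sigma]_(y in D) f (rho y) = \int[push]_(y in D) f y)%E.
  by rewrite (ge0_integral_pushforward mrho) // rhoD.
(* The push-forward is dominated only on subsets of [D]. Adding its restriction to the complement of
   [D] makes the domination global, and integrals over [D] do not see this term. *)
pose m2 : {measure set T -> \bar R} := mscale (NngNum k0) sigma.
pose m3 : {measure set T -> \bar R} := mrestr push (measurableC mD).
pose m : {measure set T -> \bar R} := measure_add m2 m3.
have le_m S : measurable S -> (push S <= m S)%E.
  move=> mS; have -> : m S = (m2 S + push (S `&` ~` D))%E by exact: (measure_addE m2 m3).
  have mSD : measurable (S `&` D) by exact: measurableI.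
  have mSC : measurable (S `&` ~` D) by apply: measurableI => //; exact: measurableC.
  have {1}-> : S = (S `&` D) `|` (S `&` ~` D) by rewrite -setIUr setUv setIT.
  apply: (@le_trans _ _ (push (S `&` D) + push (S `&` ~` D))%E); first exact: measureU2.
  apply: leeD => //; apply: (le_trans (rhok mSD _)); first exact: subIsetr.
  rewrite /m2 /mscale /=; apply: lee_wpmul2l; first by rewrite lee_fin.
  by apply: le_measure; rewrite ?inE //; exact: subIsetl.
apply: (le_trans (ge0_le_measure_integral le_m mD f0 mf)).
rewrite /m ge0_integral_measure_add // ge0_integral_mscale //.
have m3D : m3 D = 0%E by rewrite (_ : m3 D = push (D `&` ~` D)) // setICr measure0.
by rewrite [X in (_ + X)%E]null_set_integral // adde0.
Qed.

End AlmostInvariant.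

Lemma Rintegral_dominated d (T : measurableType d) (R : realType)
    (mu : {measure set T -> \bar R}) (D : set T) (f g : T -> R) (B : R) :
  measurable D -> measurable_fun D f -> measurable_fun D g ->
  (forall y, D y -> `|f y| <= g y) -> (\int[mu]_(y in D) (g y)%:E <= B%:E)%E ->
  mu.-integrable D (EFin \o f) /\ `|Rintegral mu D f| <= B.
Proof.
move=> mD mf mg fg gB.
have le : (\int[mu]_(y in D) `|(f y)%:E| <= B%:E)%E.
  apply: le_trans gB; apply: ge0_le_integral => //.
  - by apply/measurable_EFinP; exact: measurableT_comp.
  - exact/measurable_EFinP.
have intf : mu.-integrable D (EFin \o f).
  apply/integrableP; split; first exact/measurable_EFinP.
  by apply: le_lt_trans le _; exact: ltry.
apply: (conj intf); apply: (le_trans (le_normr_Rintegral mD intf)).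
rewrite /Rintegral; move: le; have : (0 <= \int[mu]_(y in D) `|(f y)%:E|)%E by exact: integral_ge0.
by case: (\int[mu]_(y in D) `|(f y)%:E|)%E.
Qed.

Lemma exprn1D_le (R : realType) (m : nat) (k : R) : 0 <= k <= 1 -> (1 + k) ^+ m <= 1 + 3 ^+ m * k.
Proof.
move=> /andP[k0 k1]; elim: m => [|j IH]; first by rewrite !expr0 mul1r lerDl.
rewrite exprSr (le_trans (ler_wpM2r _ IH)) ?addr_ge0 //.
have : 1 <= 3 ^+ j :> R by rewrite exprn_ege1 // ler1n.
rewrite exprS; move: (3 ^+ j) => t t1.
have h1 : k <= t * k by rewrite ler_peMl.
have h2 : t * k * k <= t * k by rewrite ler_piMr // mulr_ge0 // (le_trans ler01).
by lra.
Qed.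

Section Boundary.
Variables (R : realType) (m : nat) (alpha : R) (Omega : set 'rV[R]_m.+1).
Variables (nu : 'rV[R]_m.+1 -> 'rV[R]_m.+1) (sigma : {measure set (Borel R m.+1) -> \bar R}).
Hypotheses (m0 : (0 < m)%N) (alpha01 : 0 < alpha < 1) (domO : C1alpha_domain alpha Omega).
Hypotheses (nuO : outward_normal_field Omega nu) (sigmaH : surface_measure Omega sigma).
Implicit Types (x y v w : 'rV[R]_m.+1) (s : R).

Local Notation S := (bdry Omega : set (Borel R m.+1)).
Local Notation sb := (@scaled_bump R m).

Let mS : measurable S. Proof. exact: measurable_bdry. Qed.

Lemma scaled_bumpE s r : sb s r = s `^ (- (m%:R / 2)) * bump 32 s r.
Proof. by []. Qed.

Lemma measurable_scaled_bump s x :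
  measurable_fun S ((fun y => sb s (enorm (x - y))) : Borel R m.+1 -> R).
Proof.
apply: measurable_funM; first exact: measurable_cst.
by apply: continuous_Borel_measurable_real => //; exact: bump_continuous.
Qed.

Lemma measurable_grad_heat s v x (D : set (Borel R m.+1)) : 0 < s -> measurable D ->
  measurable_fun D ((fun y => grad_heat s v (x - y)) : Borel R m.+1 -> R).
Proof.
move=> s0 mD; apply: continuous_Borel_measurable_real => // y.
rewrite (_ : (fun y => _) = (fun y => (edot x v - edot y v) * half_heat_const R m *
   (s `^ (- (m.+1%:R / 2 + 1)) * bump 4 s (enorm (x - y))))); last first.
  by apply/funext => z; rewrite (grad_heatE _ _ s0) (edotC v) edotBl.
apply: (@cvgM _ _ (nbhs y) (nbhs_filter y)).
  apply: (@cvgM _ _ (nbhs y) (nbhs_filter y)); last exact: cvg_cst.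
  apply: (@cvgB _ R^o _ (nbhs y) (nbhs_filter y)); first exact: cvg_cst.
  exact: (@edot_continuous R m.+1 v y).
apply: (@cvgM _ _ (nbhs y) (nbhs_filter y)); first exact: cvg_cst.
exact: bump_continuous.
Qed.

Lemma integral_scaled_bump : exists2 B : R, 0 <= B & forall s x, 0 < s -> S x ->
  (\int[sigma]_(y in S) (sb s (enorm (x - y)))%:E <= B%:E)%E.
Proof.
have [K K0 growth] := surface_growth m0 alpha01 domO nuO sigmaH.
have [B B0 BP] := integral_bump mS K0 growth.
exists B => // s x s0 Sx.
under eq_integral => y _ do rewrite scaled_bumpE EFinM.
have mb : measurable_fun S (fun y : Borel R m.+1 => (bump 32 s (enorm (x - y)))%:E).
  apply/measurable_EFinP; apply: continuous_Borel_measurable_real => //.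
  exact: bump_continuous.
rewrite (ge0_integralZl sigma mS mb); last 2 first.
- by move=> y _; rewrite lee_fin bump_ge0.
- by rewrite lee_fin powR_ge0.
apply: (@le_trans _ _ ((s `^ (- (m%:R / 2)))%:E * (B * s `^ (m%:R / 2))%:E)%E).
  by apply: lee_wpmul2l; [rewrite lee_fin powR_ge0|exact: BP].
rewrite -EFinM lee_fin mulrCA powR_mul // addrC subrr powRr0 mulr1.
exact: lexx.
Qed.

Lemma bdry_dominated : exists2 B : R, 0 <= B & forall (f : Borel R m.+1 -> R) s x c,
  0 < s -> S x -> 0 <= c -> measurable_fun S f ->
  (forall y, S y -> `|f y| <= c * sb s (enorm (x - y))) ->
  sigma.-integrable S (EFin \o f) /\ `|Rintegral sigma S f| <= c * B.
Proof.
have [B B0 BP] := integral_scaled_bump.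
exists B => // f s x c s0 Sx c0 mf fle.
apply: (@Rintegral_dominated _ (Borel R m.+1) R sigma S f (fun y => c * sb s (enorm (x - y)))) => //.
  apply: measurable_funM; first exact: measurable_cst.
  exact: measurable_scaled_bump.
under eq_integral => y _ do rewrite EFinM.
have mb : measurable_fun S (fun y : Borel R m.+1 => (sb s (enorm (x - y)))%:E).
  by apply/measurable_EFinP; exact: measurable_scaled_bump.
rewrite (ge0_integralZl sigma mS mb) //; last by move=> y _; rewrite lee_fin scaled_bump_ge0.
by rewrite EFinM; apply: lee_wpmul2l; [rewrite lee_fin|exact: BP].
Qed.

Lemma surface_off_bdry (A : set (Borel R m.+1)) : measurable A -> A `&` S = set0 -> sigma A = 0%E.
Proof.
by move=> mA AS; rewrite sigmaH // AS -(set0I (bdry Omega)) -sigmaH // measure0.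
Qed.

End Boundary.

Local Opaque grad_heat.

(* The exact point reflection would turn [grad_heat] into its opposite. *)
Lemma integral_almost_odd d (T : measurableType d) (R : realType)
    (sigma : {measure set T -> \bar R}) (f e : T -> R) (rho : T -> T) (D : set T) (k : R) :
  measurable_fun setT rho -> measurable D -> rho @^-1` D = D -> 0 <= k ->
  (forall A, measurable A -> A `<=` D -> (sigma (rho @^-1` A) <= k%:E * sigma A)%E) ->
  measurable_fun setT f -> measurable_fun D e -> (forall y, D y -> 0 <= e y) ->
  (forall y, D y -> `|f y + f (rho y)| <= e y) ->
  (\int[sigma]_(y in D) (Num.max (f y) 0)%:E <=
   k%:E * \int[sigma]_(y in D) (Num.max (- f y) 0)%:E + \int[sigma]_(y in D) (e y)%:E)%E.
Proof.
move=> mrho mD rhoD k0 rhok mf me e0 fe.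
have mq : measurable_fun setT (fun y => (Num.max (- f y) 0)%:E).
  by apply/measurable_EFinP; apply: measurable_maxr => //; exact: measurableT_comp.
have q0 y : (0 <= (Num.max (- f y) 0)%:E)%E by rewrite lee_fin le_max lexx orbT.
(* The positive part of [f] at [y] is at most its negative part at [rho y] plus the defect; almost
   invariance brings the negative part back to [y]. *)
apply: le_trans (leeD (ge0_integral_almost_invariant mrho mD rhoD k0 rhok q0 mq) (lexx _)).
have mqr : measurable_fun D (fun y => (Num.max (- f (rho y)) 0)%:E).
  apply: measurable_funTS; apply/measurable_EFinP; apply: measurable_maxr => //.
  by do 2 apply: measurableT_comp => //.
rewrite -ge0_integralD //; last exact/measurable_EFinP.
apply: ge0_le_integral => //.
- by move=> y _; rewrite lee_fin le_max lexx orbT.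
- by apply: measurable_funTS; apply/measurable_EFinP; exact: measurable_maxr.
- by apply: emeasurable_funD => //; exact/measurable_EFinP.
move=> y Dy; rewrite -EFinD lee_fin ge_max.
have := fe y Dy; have := e0 y Dy.
have : - f (rho y) <= Num.max (- f (rho y)) 0 by rewrite le_max lexx.
have : 0 <= Num.max (- f (rho y)) 0 by rewrite le_max lexx orbT.
have := ler_norm (f y + f (rho y)).
set a := Num.max _ _; set b := `|_|; move: (f y) (f (rho y)) (e y) a b => u v t a b h1 h2 h3 h4 h5.
by apply/andP; split; lra.
Qed.

(** * Cancellation in the integral of the gradient of the heat kernel *)

Section Cancellation.
Variables (R : realType) (m : nat) (alpha : R) (Omega : set 'rV[R]_m.+1).
Variables (nu : 'rV[R]_m.+1 -> 'rV[R]_m.+1) (sigma : {measure set (Borel R m.+1) -> \bar R}).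
Hypotheses (m0 : (0 < m)%N) (alpha01 : 0 < alpha < 1) (domO : C1alpha_domain alpha Omega).
Hypotheses (nuO : outward_normal_field Omega nu) (sigmaH : surface_measure Omega sigma).
Implicit Types (x y v w : 'rV[R]_m.+1) (s : R).

Local Notation S := (bdry Omega : set (Borel R m.+1)).
Local Notation sb := (@scaled_bump R m).

Let alpha0 : 0 < alpha. Proof. by case/andP: alpha01. Qed.
Let mS : measurable S. Proof. exact: measurable_bdry. Qed.

(** It lets the oddness argument run on a subset of the whole space invariant under the involution,
    since [sigma] does not charge the complement of the boundary. *)
Lemma ge0_integral_bdry (D : set (Borel R m.+1)) (f : Borel R m.+1 -> \bar R) :
  measurable D -> measurable_fun D f -> (forall y, D y -> (0 <= f y)%E) ->
  (\int[sigma]_(y in D) f y = \int[sigma]_(y in D `&` S) f y)%E.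
Proof.
move=> mD mf f0; have mSC : measurable (~` S) by exact: measurableC.
rewrite (ge0_negligible_integral mSC mD mf f0) ?setDE ?setCK //.
by apply: (surface_off_bdry sigmaH) => //; rewrite setICl.
Qed.

(** Near [x] the almost reflection cancels the integral up to a multiple of [kap]; away from [x] the
    bound s^(-1) is improved by a power of the distance. The radius [d], of order s^(1/4), balances
    the two parts. *)
Lemma integral_grad_heat_le (T : R) : 0 < T -> exists2 C : R, 0 <= C &
  forall s w x, 0 < s <= T -> S x ->
  `|Rintegral sigma S (fun y : Borel R m.+1 => grad_heat s w (x - y))| <=
    C * enorm w * s `^ (alpha / 4 - 1).
Proof.
move=> T0; have [c c1 reg] := bdry_regular alpha01 domO nuO sigmaH.
have [B B0 BP] := bdry_dominated m0 alpha01 domO nuO sigmaH.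
have [B' B'0 BP'] := integral_scaled_bump m0 alpha01 domO nuO sigmaH.
have [C1 C10 P1] := grad_heat_le m (lexx (0 : R)).
have [C2 C20 P2] := @grad_heat_reflection R m.
have [C3 C30 P3] := grad_heat_le m (ltW alpha0).
have c0 : 0 < c := lt_le_trans ltr01 c1.
(* Chosen so that c th^alpha = 1/2, whence [kap <= 1 / 2]; moreover [th <= c^-1], so that the
   reflection is under control at this radius. *)
pose th : R := (2 * c)^-1 `^ alpha^-1.
have c2 : 0 < (2 * c)^-1 by rewrite invr_gt0 mulr_gt0.
have th0 : 0 < th by rewrite powR_gt0.
have thc : th <= c^-1.
  apply: (@le_trans _ _ (2 * c)^-1).
    apply: ge1r_powR; last by rewrite invf_ge1 // ltW //; case/andP: alpha01.
    by rewrite c2 /= invf_le1 ?mulr_gt0 //; lra.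
  by rewrite lef_pV2 ?posrE ?mulr_gt0 //; lra.
have tha : th `^ alpha = (2 * c)^-1.
  by rewrite -powRrM mulVf ?gt_eqF // powRr1 // ltW.
pose k0 : R := 2^-1 * T `^ (- (alpha / 4)).
pose k1 : R := ((th / 2) `^ alpha * T `^ (- (alpha / 4)))^-1.
have k00 : 0 <= k0 by rewrite mulr_ge0 ?invr_ge0 ?powR_ge0.
have k10 : 0 <= k1 by rewrite invr_ge0 mulr_ge0 ?powR_ge0.
exists (3 ^+ m * k0 * (C1 * B') + C2 * k0 * B' + k1 * C3 * B').
  by nonneg; exact: exprn_ge0.
move=> s w x /andP[s0 sT] Sx.
have [_ [rho [rhoc rhoK near_rho meas_rho]]] := reg x Sx.
have sT1 : 0 < s / T <= 1 by rewrite divr_gt0 //= ler_pdivrMr // mul1r.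
(* Dividing by [T] keeps [d <= th] for all times up to [T]. The constants [k0] and [k1] collect what
   remains when [kap] and (d/2)^(-alpha) are written as multiples of powers of s. *)
pose d : R := th * (s / T) `^ (1 / 4).
have d0 : 0 < d by rewrite mulr_gt0 // powR_gt0 //; case/andP: sT1.
have sT4 : (s / T) `^ (1 / 4) <= 1.
  case/andP: sT1 => sT0 sT1; apply: (@le_trans _ _ (1 `^ (1 / 4))); last by rewrite powR1.
  by apply: ge0_ler_powR => //; rewrite ?nnegrE ?(ltW sT0).
have dth : d <= th by rewrite ler_piMr // ltW.
have dc : 0 < d <= c^-1 by rewrite d0 (le_trans dth).
have sTa b : (s / T) `^ b = s `^ b * T `^ (- b).
  by rewrite powRM ?invr_ge0 ?(ltW s0) ?(ltW T0) // -powR_inv1 ?(ltW T0) // -powRrM mulN1r.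
have da : d `^ alpha = th `^ alpha * (s `^ (alpha / 4) * T `^ (- (alpha / 4))).
  rewrite powRM ?powR_ge0 ?(ltW th0) // -powRrM.
  by rewrite (_ : 1 / 4 * alpha = alpha / 4) ?sTa //; field.
pose kap := c * d `^ alpha.
have kapE : kap = k0 * s `^ (alpha / 4).
  by rewrite /kap da tha /k0; field; rewrite gt_eqF.
have kap0 : 0 <= kap by rewrite /kap mulr_ge0 ?powR_ge0 // ltW.
have kap2 : kap <= 1 / 2.
  apply: (@le_trans _ _ (c * th `^ alpha)).
    apply: (ler_wpM2l (ltW c0)); apply: ge0_ler_powR => //; by rewrite ?nnegrE ltW.
  by rewrite tha le_eqVlt; apply/orP; left; apply/eqP; field; rewrite gt_eqF.
pose f w' (y : Borel R m.+1) : R := grad_heat s w' (x - y).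
have mf w' : measurable_fun setT (f w') by exact: measurable_grad_heat.
(* The ball itself need not be invariant under [rho]; its intersection with its preimage is, because
   [rho] is an involution. *)
pose D : set (Borel R m.+1) := eball x d `&` rho @^-1` (eball x d).
have mrho : measurable_fun setT (rho : Borel R m.+1 -> Borel R m.+1).
  exact: continuous_Borel_measurable.
have mD : measurable D.
  apply: measurableI; first exact: measurable_eball.
  rewrite -[X in measurable X]setTI; apply: mrho => //; exact: measurable_eball.
have rhoD : rho @^-1` D = D.
  by rewrite /D preimage_setI setIC; congr (_ `&` _); apply/seteqP; split=> y /=; rewrite rhoK.
pose e (y : Borel R m.+1) : R := C2 * kap * enorm w * s `^ (- 1) * sb s (enorm (x - y)).
have ae0 : 0 <= C2 * kap * enorm w * s `^ (- 1).
  exact: (mulr_ge0 (mulr_ge0 (mulr_ge0 C20 kap0) (enorm_ge0 w)) (powR_ge0 _ _)).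
have e0 y : 0 <= e y by exact: (mulr_ge0 ae0 (scaled_bump_ge0 _ _ _)).
have msb : measurable_fun setT (fun y : Borel R m.+1 => sb s (enorm (x - y))).
  apply: measurable_funM; first exact: measurable_cst.
  by apply: continuous_Borel_measurable_real => //; exact: bump_continuous.
have me : measurable_fun setT e.
  by apply: measurable_funM => //; exact: measurable_cst.
have fe w' y : enorm w' = enorm w -> D y -> `|f w' y + f w' (rho y)| <= e y.
  move=> ww [Dy _]; rewrite /e -ww.
  apply: P2 => //; first by rewrite kap0.
  rewrite addrAC addrC addrA (enormBC x y).
  rewrite (_ : _ + _ = - (rho y - (x + x - y))); last first.
    by apply/rowP => i; rewrite !mxE; ring.
  by rewrite enormN; exact: near_rho.
have kD A : measurable A -> A `<=` D ->
    (sigma (rho @^-1` A) <= ((1 + kap) ^+ m)%:E * sigma A)%E.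
  by move=> mA AD; apply: meas_rho => // y /AD [].
have k1p : 0 <= (1 + kap) ^+ m by rewrite exprn_ge0 // addr_ge0.
have odd w' : enorm w' = enorm w -> (\int[sigma]_(y in D) (Num.max (f w' y) 0)%:E <=
   ((1 + kap) ^+ m)%:E * \int[sigma]_(y in D) (Num.max (- f w' y) 0)%:E +
   \int[sigma]_(y in D) (e y)%:E)%E.
  move=> ww; apply: (integral_almost_odd mrho mD rhoD k1p kD) => //.
  - exact: measurable_funTS.
  - by move=> y Dy; exact: fe.
have mDS : measurable (D `&` S) by exact: measurableI.
have le_sb (D' : set (Borel R m.+1)) a : measurable D' -> D' `<=` S -> 0 <= a ->
    (\int[sigma]_(y in D') (a * sb s (enorm (x - y)))%:E <= (a * B')%:E)%E.
  move=> mD' D'S a0.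
  apply: (@le_trans _ _ (\int[sigma]_(y in S) (a * sb s (enorm (x - y)))%:E)%E).
    apply: ge0_subset_integral => //.
    - apply: measurable_funTS; apply/measurable_EFinP; apply: measurable_funM => //.
    - by move=> y _; rewrite lee_fin mulr_ge0 // scaled_bump_ge0.
  under eq_integral => y _ do rewrite EFinM.
  rewrite ge0_integralZl //.
  - by rewrite EFinM; apply: lee_wpmul2l; [rewrite lee_fin|exact: BP'].
  - by apply: measurable_funTS; exact/measurable_EFinP.
  - by move=> y _; rewrite lee_fin scaled_bump_ge0.
pose W := C1 * enorm w * s `^ (- 1).
have W0 : 0 <= W by exact: (mulr_ge0 (mulr_ge0 C10 (enorm_ge0 w)) (powR_ge0 _ _)).
have fW y : `|f w y| <= W * sb s (enorm (x - y)).
  by have := P1 s w (x - y) s0; rewrite powRr0 mul1r mul0r sub0r.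
have mmax w' D' : measurable_fun D' (fun y : Borel R m.+1 => Num.max (f w' y) 0).
  by apply: measurable_funTS; exact: measurable_maxr.
have fN y : f (- w) y = - f w y.
  exact: grad_heatNl.
have max_sb w' y : `|f w' y| = `|f w y| -> `|Num.max (f w' y) 0| <= W * sb s (enorm (x - y)).
  move=> fw; apply: le_trans (fW y); rewrite -fw.
  rewrite ger0_norm ?le_max ?lexx ?orbT //.
  by rewrite ge_max ler_norm normr_ge0.
(* As [f (- w) = - f w], the negative part of [f w] is the positive part of [f (- w)]. Applied to
   [w] and to [- w], the one-sided estimate [odd] bounds the difference of the two integrals from
   both sides. *)
pose pos w' : R := Rintegral sigma (D `&` S) (fun y => Num.max (f w' y) 0).
have mWsb D' : measurable_fun D' (fun y : Borel R m.+1 => W * sb s (enorm (x - y))).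
  by apply: measurable_funTS; apply: measurable_funM.
have posP w' : (forall y, `|f w' y| = `|f w y|) ->
    [/\ sigma.-integrable (D `&` S) (EFin \o (fun y => Num.max (f w' y) 0)),
       pos w' <= W * B' &
       (\int[sigma]_(y in D) (Num.max (f w' y) 0)%:E = (pos w')%:E)%E].
  move=> fw; have [int bnd] := Rintegral_dominated mDS (mmax w' _) (mWsb _)
    (fun y _ => max_sb w' y (fw y)) (le_sb _ _ mDS (@subIsetr _ _ _) W0).
  split=> //; first exact: (le_trans (ler_norm _) bnd).
  have mm : measurable_fun D (fun y : Borel R m.+1 => (Num.max (f w' y) 0)%:E).
    by apply/measurable_EFinP; exact: mmax.
  rewrite (ge0_integral_bdry mD mm); last by move=> y _; rewrite lee_fin le_max lexx orbT.
  rewrite /pos /Rintegral fineK //.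
  exact: (integrable_fin_num mDS int).
have [int1 b1 E1] := posP w (fun=> erefl).
have [int2 b2 E2] : [/\ sigma.-integrable (D `&` S) (EFin \o (fun y => Num.max (f (- w) y) 0)),
       pos (- w) <= W * B' &
       (\int[sigma]_(y in D) (Num.max (f (- w) y) 0)%:E = (pos (- w))%:E)%E].
  by apply: posP => y; rewrite fN normrN.
set a := C2 * kap * enorm w * s `^ (- 1) in ae0 e e0 me fe odd *.
have eB : (\int[sigma]_(y in D) (e y)%:E <= (a * B')%:E)%E.
  have mme : measurable_fun D (fun y : Borel R m.+1 => (e y)%:E).
    by apply/measurable_EFinP; exact: measurable_funTS.
  rewrite (ge0_integral_bdry mD mme); last by move=> y _; rewrite lee_fin.
  by apply: le_sb => //; exact: subIsetr.
have up1 : pos w <= (1 + kap) ^+ m * pos (- w) + a * B'.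
  rewrite -lee_fin -E1 EFinD EFinM -E2.
  apply: (le_trans (odd w erefl)); apply: leeD => //.
  apply: lee_wpmul2l; first by rewrite lee_fin.
  by under eq_integral => y _ do rewrite -fN.
have up2 : pos (- w) <= (1 + kap) ^+ m * pos w + a * B'.
  rewrite -lee_fin -E2 EFinD EFinM -E1.
  apply: (le_trans (odd (- w) (enormN w))); apply: leeD => //.
  apply: lee_wpmul2l; first by rewrite lee_fin.
  by under eq_integral => y _ do rewrite fN opprK.
have kapm : (1 + kap) ^+ m <= 1 + 3 ^+ m * kap.
  by apply: exprn1D_le; rewrite kap0 (le_trans kap2) // ler_pdivrMr // mul1r ler1n.
have pos0 w' : 0 <= pos w' by apply: Rintegral_ge0 => y _; rewrite le_max lexx orbT.
have inner : `|Rintegral sigma (D `&` S) (f w)| <= 3 ^+ m * kap * (W * B') + a * B'.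
  have -> : Rintegral sigma (D `&` S) (f w) = pos w - pos (- w).
    rewrite /pos -RintegralB //; apply: eq_Rintegral => y _.
    rewrite fN; case: (leP (f w y) 0) => fy0.
      by rewrite max_l ?oppr_ge0 // sub0r opprK.
    by rewrite max_r ?subr0 // oppr_le0 ltW.
  have p1 := pos0 w; have p2 := pos0 (- w).
  have t0 : 0 <= 3 ^+ m * kap by rewrite mulr_ge0 // exprn_ge0.
  have u1 := ler_wpM2r p1 kapm; have u2 := ler_wpM2r p2 kapm.
  have v1 := ler_wpM2l t0 b1; have v2 := ler_wpM2l t0 b2.
  move: up1 up2 u1 u2 v1 v2 t0; clear.
  set X := (1 + kap) ^+ m; set t := 3 ^+ m * kap; set p := pos w; set q := pos (- w).
  set V := W * B'; set U := a * B' => h1 h2 h3 h4 h5 h6 h7.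
  rewrite ler_norml; apply/andP; split; lra.
have outer : `|Rintegral sigma (S `\` D) (f w)| <= k1 * C3 * enorm w * s `^ (alpha / 4 - 1) * B'.
  have mSD : measurable (S `\` D) by exact: measurableD.
  have c0' : 0 <= k1 * C3 * enorm w * s `^ (alpha / 4 - 1).
    exact: (mulr_ge0 (mulr_ge0 (mulr_ge0 k10 C30) (enorm_ge0 w)) (powR_ge0 _ _)).
  have [] := @Rintegral_dominated _ _ _ sigma (S `\` D) (f w)
    (fun y => k1 * C3 * enorm w * s `^ (alpha / 4 - 1) * sb s (enorm (x - y)))
    (k1 * C3 * enorm w * s `^ (alpha / 4 - 1) * B') mSD.
  - exact: measurable_funTS.
  - by apply: measurable_funTS; apply: measurable_funM.
  - move=> y [Sy nDy].
    (* A point closer than [d / 2] has its image within 3/2 of that distance, hence closer than [d],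
       and would belong to [D]. *)
    have yd : d / 2 <= enorm (x - y).
      rewrite leNgt; apply/negP => xy; apply: nDy.
      have yx : enorm (y - x) < d by rewrite enormBC; apply: (lt_trans xy); rewrite ltr_pdivrMr // ltr_pMr // ltr1n.
      split; first exact: yx.
      have h := near_rho d y dc yx.
      rewrite /preimage /eball /=.
      have -> : rho y - x = (rho y - (x + x - y)) + (x - y).
        by apply/rowP => i; rewrite !mxE; ring.
      apply: (le_lt_trans (enormD _ _)); move: h; rewrite (enormBC y x) -/kap => h.
      have : kap * enorm (x - y) <= 1 / 2 * enorm (x - y) by apply: ler_wpM2r kap2; exact: enorm_ge0.
      by move: h xy d0; clear; lra.
    have da2 : (d / 2) `^ alpha <= enorm (x - y) `^ alpha.
      by apply: ge0_ler_powR => //; rewrite ?nnegrE ?enorm_ge0 ?(ltW alpha0) ?divr_ge0 ?(ltW d0).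
    have dE : (d / 2) `^ alpha = k1^-1 * s `^ (alpha / 4).
      rewrite /k1 invrK /d mulrAC (@powRM _ (th / 2)) ?powR_ge0 ?divr_ge0 ?(ltW th0) // -powRrM.
      by rewrite (_ : 1 / 4 * alpha = alpha / 4) ?sTa; [ring|field].
    have k1p' : 0 < k1 by rewrite invr_gt0 mulr_gt0 ?powR_gt0 ?divr_gt0.
    have sa0 : 0 < s `^ (alpha / 4) by rewrite powR_gt0.
    have h := P3 s w (x - y) s0.
    have sE : s `^ (alpha / 2 - 1) = s `^ (alpha / 4) * s `^ (alpha / 4 - 1).
      by rewrite powR_mul //; congr (_ `^ _); field.
    have h2 : k1^-1 * s `^ (alpha / 4) * `|f w y| <=
        C3 * enorm w * (s `^ (alpha / 4) * s `^ (alpha / 4 - 1)) * sb s (enorm (x - y)).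
      rewrite -sE -dE; apply: le_trans h; exact: ler_wpM2r.
    have k1s : 0 < k1^-1 * s `^ (alpha / 4) by rewrite mulr_gt0 // invr_gt0.
    rewrite -(ler_pM2l k1s).
    apply: (le_trans h2); rewrite le_eqVlt; apply/orP; left; apply/eqP.
    by field; rewrite gt_eqF.
  - by apply: le_sb => //; exact: subDsetl.
  - by [].
have SE : S = (D `&` S) `|` (S `\` D) by rewrite setIC setDE -setIUr setUv setIT.
have intS : sigma.-integrable S (EFin \o f w).
  have [] := BP (f w) s x W s0 Sx W0 _ _ => //; first exact: measurable_funTS.
rewrite -/(f w) [X in Rintegral _ X]SE Rintegral_setU //; last 3 first.
- exact: measurableD.
- by rewrite -SE.
- by apply/disj_setPS => y [[Dy _] [_ nDy]].
apply: (le_trans (ler_normD _ _)); apply: (le_trans (lerD inner outer)).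
rewrite /a /W kapE.
have -> : s `^ (alpha / 4 - 1) = s `^ (alpha / 4) * s `^ (- 1) by rewrite powR_mul.
by rewrite le_eqVlt; apply/orP; left; apply/eqP; ring.
Qed.

End Cancellation.

(** * Integration in time *)

Section TimeIntegral.
Variable R : realType.
Implicit Types (t u v p a b c : R).
Local Notation mu := (@lebesgue_measure R).

Lemma powR_sub_is_derive t p v : v < t ->
  is_derive v (1 : R) (fun x => (t - x) `^ p : R^o) (- (p * (t - v) `^ (p - 1))).
Proof.
move=> vt; have tv : 0 < t - v by rewrite subr_gt0.
have d1 : is_derive v (1 : R) (fun x : R => t - x : R^o) (- 1).
  have := is_deriveB (is_derive_cst (t : R^o) v (1 : R)) (is_derive_id v (1 : R)).
  by rewrite sub0r.
have d2 := is_derive1_powR p tv.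
have := @is_derive1_comp R (fun x => x `^ p) (fun x => t - x) v _ _ d2 d1.
by rewrite mulrN1.
Qed.

Lemma powR_sub_continuous t p v : v < t -> {for v, continuous (fun x => (t - x) `^ p)}.
Proof.
move=> vt; apply: differentiable_continuous; apply/derivable1_diffP.
exact: (@ex_derive _ _ _ _ _ _ _ (powR_sub_is_derive p vt)).
Qed.

Lemma integral_powR_sub t p u v : p != 0 -> u < v -> v < t ->
  (\int[mu]_(x in `[u, v]) ((t - x) `^ (p - 1))%:E = (((t - u) `^ p - (t - v) `^ p) / p)%:E)%E.
Proof.
move=> p0 uv vt; pose F x : R := - (p^-1 * (t - x) `^ p).
have dF x : x < t -> is_derive x (1 : R) (F : R -> R^o) ((t - x) `^ (p - 1)).
  move=> xt; have d := powR_sub_is_derive p xt.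
  have := is_deriveN (is_deriveZ p^-1 d).
  by rewrite /GRing.scale /= mulrN opprK mulrA mulVf // mul1r.
have cF x : x < t -> {for x, continuous F}.
  move=> xt; apply: differentiable_continuous; apply/derivable1_diffP.
  exact: (@ex_derive _ _ _ _ _ _ _ (dF x xt)).
rewrite (@continuous_FTC2 _ _ F) //.
- rewrite -EFinB; congr (_%:E); rewrite /F; field; exact: p0.
- apply: continuous_subspace_itv => x; rewrite in_itv /= => /andP[_ xv].
  by apply: powR_sub_continuous; exact: le_lt_trans xv vt.
- split.
  + move=> x; rewrite in_itv /= => /andP[_ xv].
    exact: (@ex_derive _ _ _ _ _ _ _ (dF x (lt_trans xv vt))).
  + by apply: cvg_at_right_filter; apply: cF; exact: lt_trans uv vt.
  + by apply: cvg_at_left_filter; apply: cF.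
- move=> x; rewrite in_itv /= => /andP[_ xv].
  by rewrite derive1E; exact: (@derive_val _ _ _ _ _ _ _ (dF x (lt_trans xv vt))).
Qed.

Lemma measurable_powR_sub t p (D : set R) : measurable D ->
  measurable_fun D (fun x => (t - x) `^ p).
Proof.
move=> mD; apply: (@measurable_funS _ _ _ _ setT) => //.
apply: (@measurableT_comp _ _ _ _ _ _ (fun x => x `^ p)); first exact: measurable_powR.
exact: measurable_funB.
Qed.

Lemma integral_powR_sub_singular t p u : 0 < p -> u < t ->
  (\int[mu]_(x in `[u, t[) ((t - x) `^ (p - 1))%:E <= ((t - u) `^ p / p)%:E)%E.
Proof.
move=> p0 ut; have tu : 0 < t - u by rewrite subr_gt0.
(* The singular endpoint is reached by monotone convergence. With [k.+1] the first interval would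
   shrink to a point, while the fundamental theorem is applied on nondegenerate ones. *)
pose F k : set R := `[u, t - (t - u) / k.+2%:R]%classic.
have vt k : t - (t - u) / k.+2%:R < t by rewrite ltrBlDr ltrDl divr_gt0.
have uv k : u < t - (t - u) / k.+2%:R.
  rewrite ltrBrDr addrC -ltrBrDr ltr_pdivrMr //.
  by rewrite ltr_pMr // ltr1n.
have -> : `[u, t[%classic = \bigcup_k F k.
  apply/seteqP; split=> x /=.
    rewrite in_itv /= => /andP[ux xt].
    have tx : 0 < t - x by rewrite subr_gt0.
    pose k := Num.truncn ((t - u) / (t - x)).
    have /andP[_ hk] := truncn_itv (divr_ge0 (ltW tu) (ltW tx)).
    exists k => //; rewrite /F /= in_itv /= ux /= lerBrDr addrC -lerBrDr.
    rewrite ler_pdivrMr // mulrC -ler_pdivrMr //.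
    by apply: (le_trans (ltW hk)); rewrite ler_nat.
  move=> [k _]; rewrite /F /= !in_itv /= => /andP[-> xk] /=; exact: le_lt_trans xk (vt k).
have mF k : measurable (F k) by exact: measurable_itv.
have ndF : nondecreasing_seq F.
  move=> i j ij; rewrite subsetEset => x; rewrite /F /= !in_itv /= => /andP[-> xi] /=.
  apply: (le_trans xi); rewrite lerD2l lerN2; apply: ler_wpM2l; first exact: ltW.
  by rewrite lef_pV2 ?posrE // ler_nat.
have cvg : (\int[mu]_(x in F k) ((t - x) `^ (p - 1))%:E)%E @[k --> \oo] -->
    (\int[mu]_(x in \bigcup_k F k) ((t - x) `^ (p - 1))%:E)%E.
  apply: ge0_nondecreasing_set_cvg_integral => //.
  - by move=> k; apply/measurable_EFinP; exact: measurable_powR_sub.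
  - by move=> k x _; rewrite lee_fin powR_ge0.
rewrite -(cvg_lim _ cvg) //; apply: lime_le; first by apply/cvg_ex; eexists; exact: cvg.
apply: nearW => k; rewrite integral_powR_sub ?gt_eqF // lee_fin ler_pM2r ?invr_gt0 //.
by rewrite lerBlDr lerDl powR_ge0.
Qed.

(** The common form of both cuts of the time integral. At distance less than [H] from [t] only the
    integrable singularity is used; farther away, the decay gained by subtracting kernels. The term
    in [g] is for the tangential part, integrable over the whole interval. Bounds are asked on the
    half-open interval only, the endpoint being negligible. *)
Lemma Rintegral_time_le t T H a b g c1 c2 c3 (j : R -> R) :
  0 <= t <= T -> 0 < H -> 0 < a -> 0 < b -> 0 < g -> 0 <= c1 -> 0 <= c2 -> 0 <= c3 ->
  measurable_fun `[0, t[ j ->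
  (forall x, 0 <= x < t -> `|j x| <= c1 * (t - x) `^ (a - 1)) ->
  (forall x, 0 <= x < t -> H <= t - x ->
     `|j x| <= c2 * (t - x) `^ (- b - 1) + c3 * (t - x) `^ (g - 1)) ->
  mu.-integrable `[0, t] (EFin \o j) /\
  `|Rintegral mu `[0, t] j| <= c1 / a * H `^ a + c2 / b * H `^ (- b) + c3 / g * T `^ g.
Proof.
move=> /andP[t0 tT] H0 a0 b0 g0 c10 c20 c30 mj j1 j2.
have T0 : 0 <= T := le_trans t0 tT.
set B := (X in _ <= X).
have B0 : 0 <= B by rewrite /B; do ?[apply: addr_ge0]; rewrite mulr_ge0 ?powR_ge0 // divr_ge0 // ltW.
have mjn (D : set R) : measurable D -> D `<=` `[0, t[ -> measurable_fun D (fun x => `|j x|%:E).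
  move=> mD Dt; apply/measurable_EFinP; apply: (measurable_funS _ Dt) => //.
  exact: measurableT_comp.
have mp c p (D : set R) : measurable D -> measurable_fun D (fun x => (c * (t - x) `^ p)%:E).
  move=> mD; apply/measurable_EFinP; apply: measurable_funM => //.
  exact: measurable_powR_sub.
have intp c p (D : set R) b' : measurable D -> 0 <= c ->
    (\int[mu]_(x in D) ((t - x) `^ p)%:E <= b'%:E)%E ->
    (\int[mu]_(x in D) (c * (t - x) `^ p)%:E <= (c * b')%:E)%E.
  move=> mD c0 h; under eq_integral => x _ do rewrite EFinM.
  rewrite ge0_integralZl //.
  - by rewrite EFinM; apply: lee_wpmul2l => //; rewrite lee_fin.
  - by apply/measurable_EFinP; exact: measurable_powR_sub.
  - by move=> x _; rewrite lee_fin powR_ge0.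
have powT p : 0 < p -> (\int[mu]_(x in `[0%R, t[) ((t - x) `^ (p - 1))%:E <= (T `^ p / p)%:E)%E.
  move=> p0; have [t_0|t_0] := ltP 0 t; last first.
    rewrite set_itv_ge ?bnd_simp -?leNgt // integral_set0 lee_fin.
    by rewrite divr_ge0 ?powR_ge0 // ltW.
  apply: (le_trans (integral_powR_sub_singular p0 t_0)); rewrite lee_fin subr0.
  rewrite ler_pM2r ?invr_gt0 //; apply: ge0_ler_powR => //; exact: ltW.
have mt : measurable (`[0, t[%classic : set R) by exact: measurable_itv.
have x1 : 0 <= c1 / a * H `^ a by rewrite mulr_ge0 ?powR_ge0 // divr_ge0 // ltW.
have x2 : 0 <= c2 / b * H `^ (- b) by rewrite mulr_ge0 ?powR_ge0 // divr_ge0 // ltW.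
have x3 : 0 <= c3 / g * T `^ g by rewrite mulr_ge0 ?powR_ge0 // divr_ge0 // ltW.
have total : (\int[mu]_(x in `[0%R, t[) `|j x|%:E <= B%:E)%E.
  have [vt|vt] := leP (t - H) 0.
    apply: (@le_trans _ _ (c1 / a * H `^ a)%:E); last first.
      by rewrite lee_fin /B -addrA lerDl addr_ge0.
    apply: (@le_trans _ _ (\int[mu]_(x in `[0%R, t[) (c1 * (t - x) `^ (a - 1))%:E)%E).
      apply: ge0_le_integral => //; [exact: mjn|exact: mp].
    rewrite -mulrA [a^-1 * _]mulrC; apply: intp => //.
    have [t_0|t_0] := ltP 0 t; last first.
      rewrite set_itv_ge ?bnd_simp -?leNgt // integral_set0 lee_fin.
      by rewrite divr_ge0 ?powR_ge0 // ltW.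
    apply: (le_trans (integral_powR_sub_singular a0 t_0)); rewrite lee_fin subr0.
    rewrite ler_pM2r ?invr_gt0 //; apply: ge0_ler_powR; rewrite ?nnegrE ?(ltW a0) ?(ltW H0) //.
    by move: vt; rewrite subr_le0.
  have tH : t - H < t by rewrite ltrBlDr ltrDl.
  have split : `[0, t[%classic = `[0, t - H[%classic `|` `[t - H, t[%classic :> set R.
    by rewrite -itv_bndbnd_setU // bnd_simp ltW.
  have m1 : measurable (`[0, t - H[%classic : set R) by exact: measurable_itv.
  have m2 : measurable (`[t - H, t[%classic : set R) by exact: measurable_itv.
  have s1 : (`[0, t - H[%classic : set R) `<=` `[0, t[%classic.
    by rewrite split; exact: subsetUl.
  have s2 : (`[t - H, t[%classic : set R) `<=` `[0, t[%classic.
    by rewrite split; exact: subsetUr.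
  rewrite split ge0_integral_setU //; last 2 first.
  - by rewrite -split; exact: mjn.
  - apply/disj_setPS => x [/=]; rewrite ?in_itv /= => /andP[_ h1] /andP[h2 _].
    by move: (lt_le_trans h1 h2); rewrite ltxx.
  have -> : B = (c2 / b * H `^ (- b) + c3 / g * T `^ g) + c1 / a * H `^ a by rewrite /B; ring.
  rewrite EFinD; apply: leeD.
    rewrite EFinD.
    apply: (@le_trans _ _ (\int[mu]_(x in `[0%R, (t - H)%R[)
       ((c2 * (t - x) `^ (- b - 1))%:E + (c3 * (t - x) `^ (g - 1))%:E))%E).
      apply: ge0_le_integral => //; [exact: mjn|by apply: emeasurable_funD; exact: mp|].
      move=> x xt; have := s1 _ xt; move: xt; rewrite /= ?in_itv /= => /andP[_ xH] xt.
      rewrite -EFinD lee_fin; apply: j2 => //.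
      by rewrite lerBrDr addrC -lerBrDr ltW.
    rewrite ge0_integralD //; last 4 first.
    - by move=> x _; rewrite lee_fin mulr_ge0 ?powR_ge0.
    - exact: mp.
    - by move=> x _; rewrite lee_fin mulr_ge0 ?powR_ge0.
    - exact: mp.
    apply: leeD.
      rewrite -mulrA [b^-1 * _]mulrC; apply: intp => //.
      have nb : - b != 0 by rewrite oppr_eq0 gt_eqF.
      apply: (@le_trans _ _ (\int[mu]_(x in `[0%R, (t - H)%R]) ((t - x) `^ (- b - 1))%:E)%E).
        apply: ge0_subset_integral => //.
        - by apply/measurable_EFinP; exact: measurable_powR_sub.
        - by move=> x _; rewrite lee_fin powR_ge0.
        - by apply: subset_itvl; rewrite bnd_simp.
      rewrite integral_powR_sub // lee_fin subr0 subKr invrN mulrN -mulNr opprB.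
      by rewrite ler_pM2r ?invr_gt0 // lerBlDr lerDl powR_ge0.
    rewrite -mulrA [g^-1 * _]mulrC; apply: intp => //.
    apply: le_trans (powT g g0); apply: ge0_subset_integral => //.
    - by apply/measurable_EFinP; exact: measurable_powR_sub.
    - by move=> x _; rewrite lee_fin powR_ge0.
  apply: (@le_trans _ _ (\int[mu]_(x in `[(t - H)%R, t[) (c1 * (t - x) `^ (a - 1))%:E)%E).
    apply: ge0_le_integral => //; [exact: mjn|exact: mp|].
    by move=> x /s2 /=; rewrite ?in_itv /= => xt; rewrite lee_fin j1.
  rewrite -mulrA [a^-1 * _]mulrC; apply: intp => //.
  by apply: (le_trans (integral_powR_sub_singular a0 tH)); rewrite subKr.
have [int bnd] : mu.-integrable `[0, t[ (EFin \o j) /\ `|Rintegral mu `[0, t[ j| <= B.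
  apply: (@Rintegral_dominated _ (measurableTypeR R) R lebesgue_measure _ j (fun x => `|j x|)) => //.
  exact: measurableT_comp.
have mjc : measurable_fun `[0, t] (EFin \o j).
  by apply/measurable_EFinP/measurable_fun_itv_bndo_bndcP.
have int' : mu.-integrable `[0, t] (EFin \o j).
  apply/integrableP; split => //.
  rewrite -integral_itv_bndo_bndc; last exact: mjn.
  by move/integrableP : int => [_].
by split=> //; rewrite -Rintegral_itv_bndo_bndc.
Qed.

End TimeIntegral.

(** * Boundary operators on a time slice of the density *)

Section SliceOperator.
Variables (R : realType) (m : nat) (alpha : R) (Omega : set 'rV[R]_m.+1).
Variables (nu : 'rV[R]_m.+1 -> 'rV[R]_m.+1) (sigma : {measure set (Borel R m.+1) -> \bar R}).
Hypotheses (m0 : (0 < m)%N) (alpha01 : 0 < alpha < 1) (domO : C1alpha_domain alpha Omega).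
Hypotheses (nuO : outward_normal_field Omega nu) (sigmaH : surface_measure Omega sigma).
Implicit Types (x y v w : 'rV[R]_m.+1) (s M : R) (phi : Borel R m.+1 -> R).

Local Notation S := (bdry Omega : set (Borel R m.+1)).
Local Notation sb := (@scaled_bump R m).

Let alpha0 : 0 < alpha. Proof. by case/andP: alpha01. Qed.
Let mS : measurable S. Proof. exact: measurable_bdry. Qed.

(** Up to sign, the inner integral of the potential with the normal replaced by a fixed vector. It
    is used for [w = nu x - nu x'], a small vector that need not be nearly orthogonal to the chords
    from [x]. *)
Definition tangential_op s w x phi : R :=
  Rintegral sigma S (fun y => grad_heat s w (x - y) * phi y).

Definition slice_op s x phi : R :=
  Rintegral sigma S (fun y => - grad_heat s (nu x) (x - y) * phi y).

Definition bounded_slice M phi := measurable_fun S phi /\ forall y, S y -> `|phi y| <= M.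

Let mgrad s w x phi : 0 < s -> measurable_fun S phi ->
  measurable_fun S ((fun y => grad_heat s w (x - y) * phi y) : Borel R m.+1 -> R).
Proof. by move=> s0 mphi; apply: measurable_funM => //; exact: measurable_grad_heat. Qed.

Let mgradN s w x phi : 0 < s -> measurable_fun S phi ->
  measurable_fun S ((fun y => - grad_heat s w (x - y) * phi y) : Borel R m.+1 -> R).
Proof.
move=> s0 mphi; apply: measurable_funM => //; apply: measurableT_comp => //.
exact: measurable_grad_heat.
Qed.

Let tangent : exists2 K : R, 0 <= K & forall x y, S x -> S y ->
  enorm (nu x - nu y) <= K * enorm (x - y) `^ alpha /\
  `|edot (nu x) (x - y)| <= K * enorm (x - y) `^ alpha * enorm (x - y).
Proof. exact: (normal_holder alpha01 domO nuO sigmaH). Qed.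

Lemma slice_op_le : exists2 C, 0 <= C & forall s x phi M, 0 < s -> S x -> 0 <= M ->
  bounded_slice M phi ->
  sigma.-integrable S (EFin \o (fun y => - grad_heat s (nu x) (x - y) * phi y)) /\
  `|slice_op s x phi| <= C * M * s `^ (alpha / 2 - 1).
Proof.
have [K K0 tan] := tangent; have [B B0 BP] := bdry_dominated m0 alpha01 domO nuO sigmaH.
have [C C0 CP] := @grad_heat_tangent_le R m alpha K alpha0 K0.
exists (C * B); first exact: mulr_ge0.
move=> s x phi M s0 Sx M0 [mphi bphi].
have -> : C * B * M * s `^ (alpha / 2 - 1) = (M * (C * s `^ (alpha / 2 - 1))) * B by ring.
have c0 : 0 <= M * (C * s `^ (alpha / 2 - 1)) := mulr_ge0 M0 (mulr_ge0 C0 (powR_ge0 _ _)).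
apply: (BP _ s x _ s0 Sx c0); first exact: mgradN.
move=> y Sy; rewrite normrM normrN mulrC -mulrA; apply: ler_pM => //; first exact: bphi.
by apply: CP => //; exact: (tan x y Sx Sy).2.
Qed.

Lemma slice_op_time : exists2 C, 0 <= C & forall s h x phi M, 0 < s -> 0 <= h <= s ->
  S x -> 0 <= M -> bounded_slice M phi ->
  `|slice_op (s + h) x phi - slice_op s x phi| <= C * M * (h * s `^ (alpha / 2 - 2)).
Proof.
have [K K0 tan] := tangent; have [B B0 BP] := bdry_dominated m0 alpha01 domO nuO sigmaH.
have [C C0 CP] := @grad_heat_time R m alpha K alpha0 K0.
have [C' C'0 UP] := slice_op_le.
exists (C * B); first exact: mulr_ge0.
move=> s h x phi M s0 hs Sx M0 bphi; have [mphi bp] := bphi.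
have sh0 : 0 < s + h by case/andP: hs => h0 _; rewrite ltr_pwDl.
have [i1 _] := UP s x phi M s0 Sx M0 bphi; have [i2 _] := UP _ x phi M sh0 Sx M0 bphi.
rewrite /slice_op -RintegralB //.
have h0 : 0 <= h by case/andP: hs.
pose c := M * (C * (h * s `^ (alpha / 2 - 2))).
have c0 : 0 <= c := mulr_ge0 M0 (mulr_ge0 C0 (mulr_ge0 h0 (powR_ge0 _ _))).
have -> : C * B * M * (h * s `^ (alpha / 2 - 2)) = c * B by rewrite /c; ring.
apply: (BP _ s x _ s0 Sx c0 _ _).2; first by apply: measurable_funB; exact: mgradN.
move=> y Sy; rewrite -mulrBl normrM mulrC /c -mulrA; apply: ler_pM => //; first exact: bp.
rewrite -opprD normrN; apply: CP => //; exact: (tan x y Sx Sy).2.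
Qed.

Lemma bdry_dominated2 : exists2 B : R, 0 <= B & forall (f : Borel R m.+1 -> R) s x x' c,
  0 < s -> S x -> S x' -> 0 <= c -> measurable_fun S f ->
  (forall y, S y -> `|f y| <= c * (sb s (enorm (x - y)) + sb s (enorm (x' - y)))) ->
  `|Rintegral sigma S f| <= c * B.
Proof.
have [B B0 BP] := integral_scaled_bump m0 alpha01 domO nuO sigmaH.
exists (B + B); first exact: addr_ge0.
move=> f s x x' c s0 Sx Sx' c0 mf fle.
have mb z : measurable_fun S (fun y : Borel R m.+1 => sb s (enorm (z - y))).
  exact: measurable_scaled_bump.
apply: (@Rintegral_dominated _ (Borel R m.+1) R sigma S f
  (fun y => c * (sb s (enorm (x - y)) + sb s (enorm (x' - y)))) _ mS mf _ fle _).2.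
  by apply: measurable_funM => //; exact: measurable_funD.
under eq_integral => y _ do rewrite EFinM EFinD.
have b0 z y : (0 <= (sb s (enorm (z - y)))%:E)%E by rewrite lee_fin scaled_bump_ge0.
have mbE z : measurable_fun S (fun y : Borel R m.+1 => (sb s (enorm (z - y)))%:E).
  by apply/measurable_EFinP; exact: mb.
rewrite ge0_integralZl //.
- rewrite ge0_integralD // EFinM EFinD; apply: lee_wpmul2l; first by rewrite lee_fin.
  by apply: leeD; exact: BP.
- exact: emeasurable_funD.
- by move=> y _; exact: adde_ge0.
Qed.

(** Adding the tangential term replaces the normal at [x] by the one at [x'], after which both
    kernels involve the same vector and [grad_heat_space] applies. *)
Lemma slice_op_space : exists2 C, 0 <= C & forall s x x' phi M, 0 < s -> S x -> S x' ->
  enorm (x - x') ^+ 2 <= s -> 0 <= M -> bounded_slice M phi ->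
  `|slice_op s x phi - slice_op s x' phi + tangential_op s (nu x - nu x') x phi| <=
    C * M * (enorm (x - x') * s `^ (alpha / 2 - 3 / 2)).
Proof.
have [K K0 tan] := tangent; have [B B0 BP] := bdry_dominated m0 alpha01 domO nuO sigmaH.
have [B2 B20 BP2] := bdry_dominated2.
have [C C0 CP] := @grad_heat_space R m alpha K alpha0 K0.
have [C' C'0 UP] := slice_op_le.
have [C2 C20 P2] := grad_heat_le m (lexx (0 : R)).
exists (C * B2); first exact: mulr_ge0.
move=> s x x' phi M s0 Sx Sx' hs M0 bphi; have [mphi bp] := bphi.
have [i1 _] := UP s x phi M s0 Sx M0 bphi; have [i2 _] := UP s x' phi M s0 Sx' M0 bphi.
set h := enorm (x - x') in hs *; have h0 : 0 <= h := enorm_ge0 _.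
pose c := M * (C * (h * s `^ (alpha / 2 - 3 / 2))).
have c0 : 0 <= c := mulr_ge0 M0 (mulr_ge0 C0 (mulr_ge0 h0 (powR_ge0 _ _))).
have i3 : sigma.-integrable S (EFin \o (fun y => grad_heat s (nu x - nu x') (x - y) * phi y)).
  pose c3 := M * (C2 * enorm (nu x - nu x') * s `^ (- 1)).
  have c30 : 0 <= c3 := mulr_ge0 M0 (mulr_ge0 (mulr_ge0 C20 (enorm_ge0 _)) (powR_ge0 _ _)).
  apply: (BP _ s x c3 s0 Sx c30 _ _).1; first exact: mgrad.
  move=> y Sy; rewrite normrM mulrC /c3 -[leRHS]mulrA; apply: ler_pM => //; first exact: bp.
  by have := P2 s (nu x - nu x') (x - y) s0; rewrite powRr0 mul1r mul0r sub0r.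
have -> : C * B2 * M * (h * s `^ (alpha / 2 - 3 / 2)) = c * B2 by rewrite /c; ring.
have i12 : sigma.-integrable S (EFin \o (fun y => - grad_heat s (nu x) (x - y) * phi y -
    - grad_heat s (nu x') (x' - y) * phi y)).
  by have := integrableB mS i1 i2; apply: eq_integrable => // y _ /=; rewrite EFinB.
rewrite /slice_op /tangential_op -(RintegralB mS i1 i2) -(RintegralD mS i12 i3).
apply: (BP2 _ s x x' c s0 Sx Sx' c0).
  apply: measurable_funD; last exact: mgrad.
  by apply: measurable_funB; exact: mgradN.
move=> y Sy; rewrite grad_heatBl.
have -> : - grad_heat s (nu x) (x - y) * phi y - - grad_heat s (nu x') (x' - y) * phi y +
    (grad_heat s (nu x) (x - y) - grad_heat s (nu x') (x - y)) * phi y =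
    - (phi y * (grad_heat s (nu x') (x - y) - grad_heat s (nu x') (x' - y))) by ring.
rewrite normrN normrM /c -[leRHS]mulrA; apply: ler_pM => //; first exact: bp.
have E : x - y - (x' - y) = x - x' by rewrite opprB addrA subrK.
have := CP s (nu x') (x - y) (x' - y) s0; rewrite E -/h => CP'.
apply: CP' => //; last exact: (tan x' y Sx' Sy).2.
have := (tan x' x Sx' Sx).2; rewrite (enormBC x') -/h.
by rewrite -(opprB x) edotNr normrN.
Qed.

Lemma tangential_op_le : exists2 C, 0 <= C & forall s w x phi M, 0 < s -> S x -> 0 <= M ->
  bounded_slice M phi -> `|tangential_op s w x phi| <= C * M * (enorm w * s `^ (- 1)).
Proof.
have [B B0 BP] := bdry_dominated m0 alpha01 domO nuO sigmaH.
have [C C0 CP] := grad_heat_le m (lexx (0 : R)).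
exists (C * B); first exact: mulr_ge0.
move=> s w x phi M s0 Sx M0 [mphi bp].
pose c := M * (C * enorm w * s `^ (- 1)).
have c0 : 0 <= c := mulr_ge0 M0 (mulr_ge0 (mulr_ge0 C0 (enorm_ge0 _)) (powR_ge0 _ _)).
have -> : C * B * M * (enorm w * s `^ (- 1)) = c * B by rewrite /c; ring.
apply: (BP _ s x c s0 Sx c0 _ _).2; first exact: mgrad.
move=> y Sy; rewrite normrM mulrC /c -[leRHS]mulrA; apply: ler_pM => //; first exact: bp.
by have := CP s w (x - y) s0; rewrite powRr0 mul1r mul0r sub0r.
Qed.

Lemma tangential_op_holder (T be : R) : 0 < T -> 0 <= be -> exists2 C, 0 <= C &
  forall s w x phi M L, 0 < s <= T -> S x -> 0 <= M -> 0 <= L -> bounded_slice M phi ->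
  (forall y, S y -> `|phi y - phi x| <= L * enorm (x - y) `^ be) ->
  `|tangential_op s w x phi| <=
    C * enorm w * (L * s `^ (be / 2 - 1) + M * s `^ (alpha / 4 - 1)).
Proof.
move=> T0 be0; have [B B0 BP] := bdry_dominated m0 alpha01 domO nuO sigmaH.
have [C1 C10 P1] := grad_heat_le m be0.
have [C0' C0'0 P0] := grad_heat_le m (lexx (0 : R)).
have [C2 C20 P2] := integral_grad_heat_le m0 alpha01 domO nuO sigmaH T0.
exists (C1 * B + C2); first by rewrite addr_ge0 // mulr_ge0.
move=> s w x phi M L /andP[s0 sT] Sx M0 L0 [mphi bp] hold.
pose c := L * (C1 * enorm w * s `^ (be / 2 - 1)).
have c0 : 0 <= c := mulr_ge0 L0 (mulr_ge0 (mulr_ge0 C10 (enorm_ge0 _)) (powR_ge0 _ _)).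
have mdiff : measurable_fun S (fun y : Borel R m.+1 => phi y - phi x).
  by apply: measurable_funB => //; exact: measurable_cst.
have d1 y : S y -> `|grad_heat s w (x - y) * (phi y - phi x)| <= c * sb s (enorm (x - y)).
  move=> Sy; rewrite normrM mulrC.
  apply: (le_trans (ler_wpM2r (normr_ge0 _) (hold y Sy))).
  by rewrite /c -[leLHS]mulrA -[leRHS]mulrA; apply: (ler_wpM2l L0); exact: P1.
have [i1 h1] := BP _ s x c s0 Sx c0 (mgrad w x s0 mdiff) d1.
pose c1 := C0' * enorm w * s `^ (- 1).
have c10 : 0 <= c1 := mulr_ge0 (mulr_ge0 C0'0 (enorm_ge0 _)) (powR_ge0 _ _).
have mg : measurable_fun S (fun y : Borel R m.+1 => grad_heat s w (x - y)).
  exact: measurable_grad_heat.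
have d2 y : S y -> `|grad_heat s w (x - y)| <= c1 * sb s (enorm (x - y)).
  by move=> Sy; have := P0 s w (x - y) s0; rewrite powRr0 mul1r mul0r sub0r.
have [i2 _] := BP _ s x c1 s0 Sx c10 mg d2.
have -> : tangential_op s w x phi =
    Rintegral sigma S (fun y => grad_heat s w (x - y) * (phi y - phi x)) +
    Rintegral sigma S (fun y : Borel R m.+1 => grad_heat s w (x - y)) * phi x.
  rewrite -RintegralZr // -RintegralD //.
    by apply: eq_Rintegral => y _; ring.
  by have := integrableZr mS (phi x) i2; apply: eq_integrable => // y _ /=; rewrite EFinM.
apply: (le_trans (ler_normD _ _)); rewrite normrM.
have h2 := P2 s w x; rewrite s0 sT in h2.
have h3 := ler_pM (normr_ge0 _) (normr_ge0 _) (h2 erefl Sx) (bp x Sx).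
apply: (le_trans (lerD h1 h3)); rewrite /c.
set W := enorm w; have W0 : 0 <= W := enorm_ge0 _.
set Q1 := s `^ (be / 2 - 1); set Q2 := s `^ (alpha / 4 - 1).
have Q10 : 0 <= Q1 := powR_ge0 _ _; have Q20 : 0 <= Q2 := powR_ge0 _ _.
have x1 : 0 <= C1 * B * W * (M * Q2) by rewrite !mulr_ge0.
have x2 : 0 <= C2 * W * (L * Q1) by rewrite !mulr_ge0.
have -> : (C1 * B + C2) * W * (L * Q1 + M * Q2) = L * (C1 * W * Q1) * B + C2 * W * Q2 * M +
    (C1 * B * W * (M * Q2) + C2 * W * (L * Q1)) by ring.
by rewrite lerDl addr_ge0.
Qed.

End SliceOperator.

(** * Regularity of the potential *)

Section Density.
Variables (R : realType) (m : nat) (alpha T : R) (Omega : set 'rV[R]_m.+1).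
Variables (nu : 'rV[R]_m.+1 -> 'rV[R]_m.+1) (sigma : {measure set (Borel R m.+1) -> \bar R}).
Variable mu : R -> 'rV[R]_m.+1 -> R.
Hypotheses (m0 : (0 < m)%N) (alpha01 : 0 < alpha < 1) (domO : C1alpha_domain alpha Omega).
Hypotheses (nuO : outward_normal_field Omega nu) (sigmaH : surface_measure Omega sigma).
Hypothesis muC : C00 T Omega mu.
Implicit Types (x y v w : 'rV[R]_m.+1) (s t : R).

Local Notation S := (bdry Omega : set (Borel R m.+1)).
Local Notation leb := (@lebesgue_measure R).
Let A : set (R * 'rV[R]_m.+1) := [set p | `[0, T]%classic p.1 /\ bdry Omega p.2].
Let mS : measurable S. Proof. exact: measurable_bdry. Qed.

Lemma measurable_density_slice t : 0 <= t <= T ->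
  measurable_fun S (mu t : Borel R m.+1 -> R).
Proof.
move=> tT; apply: within_continuous_Borel_measurable; first exact: bdry_closed.
have [muc _] := muC.
apply/subspace_continuousP => y by_.
have /subspace_continuousP/(_ (t, y)) := muc.
have tyA : A (t, y) by split; rewrite //= in_itv.
move=> /(_ tyA) h.
apply: (cvg_comp (fun z => (t, z)) (fun p : R * 'rV[R]_m.+1 => mu p.1 p.2) _ h).
move=> U /= [[U1 U2] /= [nU1 nU2] sub].
rewrite /nbhs /= /within /=; apply: filterS nU2 => z U2z bz.
apply: (sub (t, z)); first by split => //=; exact: nbhs_singleton.
by split; rewrite //= in_itv.
Qed.

Lemma density_time_continuous t y : 0 < t < T -> bdry Omega y ->
  {for t, continuous (fun s => mu s y)}.
Proof.
move=> /andP[t0 tT] by_; have [muc _] := muC.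
have /subspace_continuousP/(_ (t, y)) := muc.
have tyA : A (t, y) by split; rewrite //= in_itv /= !ltW.
move=> /(_ tyA) h.
apply: (cvg_comp (fun s => (s, y)) (fun p : R * 'rV[R]_m.+1 => mu p.1 p.2) _ h).
move=> U /= [[U1 U2] /= [nU1 nU2] sub].
have near1 : \forall s \near t, 0 < s < T.
  by near=> s; apply/andP; split; near: s; [exact: lt_nbhsr|exact: lt_nbhsl].
near=> s; apply: (sub (s, y)); first split => /=.
- by near: s.
- exact: nbhs_singleton.
- split => //=; rewrite in_itv /=.
  have /andP[s0 sT] : 0 < s < T by near: s.
  by rewrite !ltW.
Unshelve. all: by end_near. Qed.

Lemma density_bounded : exists2 M : R, 0 <= M &
  forall t y, 0 <= t <= T -> bdry Omega y -> `|mu t y| <= M.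
Proof.
have [muc _] := muC.
have cA : compact A.
  rewrite (_ : A = `[0, T]%classic `*` bdry Omega); last by [].
  exact: (compact_setX (@segment_compact R 0 T) (bdry_compact domO)).
have /compact_bounded := continuous_compact muc cA.
move=> [M [_ hM]]; exists (`|M| + 1); first by rewrite addr_ge0.
move=> t y tT by_; apply: (hM (`|M| + 1)).
  by apply: (le_lt_trans (ler_norm M)); rewrite ltrDl.
by exists (t, y) => //; split; rewrite //= in_itv.
Qed.

Lemma powR_continuous (p s : R) : 0 < s -> {for s, continuous (fun r : R => r `^ p)}.
Proof.
move=> s0; apply: differentiable_continuous; apply/derivable1_diffP.
exact: (@ex_derive _ _ _ _ _ _ _ (is_derive1_powR p s0)).
Qed.

Lemma grad_heat_continuous v z s : 0 < s -> {for s, continuous (fun s => grad_heat s v z)}.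
Proof.
move=> s0.
pose F (r : R) := edot v z * half_heat_const R m *
   (r `^ (- (m.+1%:R / 2 + 1)) * expR (- (enorm z ^+ 2 / (4 * r)))).
have FE : \forall r \near s, F r = grad_heat r v z.
  near=> r; have r0 : 0 < r by near: r; exact: lt_nbhsr.
  by rewrite (grad_heatE _ _ r0).
rewrite /prop_for /continuous_at -(nbhs_singleton FE).
apply: cvg_trans (near_eq_cvg FE) _.
apply: cvgM; first exact: cvg_cst.
apply: cvgM.
  exact: powR_continuous.
apply: (@cvg_comp _ _ _ (fun r => - (enorm z ^+ 2 / (4 * r))) expR); last exact: continuous_expR.
apply: cvgN; apply: cvgM; first exact: cvg_cst.
apply: cvgV; first by rewrite gt_eqF // mulr_gt0.
by apply: cvgM; [exact: cvg_cst|exact: cvg_id].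
Unshelve. all: by end_near. Qed.

(** Measurability comes from continuity in [tau], by dominated convergence. Up to the midpoint [v]
    between a given time and [t], the kernel is bounded by a constant, which is integrable since the
    boundary has finite measure. *)
Lemma measurable_slice_op t x : 0 <= t <= T -> S x ->
  measurable_fun (`[0, t[%classic : set R) (fun tau => slice_op Omega nu sigma (t - tau) x (mu tau)).
Proof.
move=> /andP[t0 tT] Sx; apply/measurable_fun_itv_obnd_cbndP.
apply: open_continuous_measurable_fun; first exact: interval_open.
move=> a /set_mem /=; rewrite in_itv /= => /andP[a0 at_].
pose v := (a + t) / 2.
have av : a < v by rewrite /v; lra.
have vt : v < t by rewrite /v; lra.
have [M M0 bM] := density_bounded.
have [C C0 CP] := grad_heat_le m (lexx (0 : R)).
have [C1 C10 U1] := slice_op_le m0 alpha01 domO nuO sigmaH.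
pose G : R := C * enorm (nu x) * (t - v) `^ (- 1) * (t - v) `^ (- (m%:R / 2)) * M.
have sv : 0 < t - v by rewrite subr_gt0.
have in_T tau : 0 < tau < v -> 0 <= tau <= T by move=> /andP[? ?]; apply/andP; split; lra.
have s0 tau : tau < v -> 0 < t - tau by move=> tv; rewrite subr_gt0 (lt_trans tv).
apply: (@continuity_under_integral R _ (Borel R m.+1) sigma
  (fun tau y => - grad_heat (t - tau) (nu x) (x - y) * mu tau y) S mS 0 v _ _ (cst G)).
- move=> tau /=; rewrite in_itv /= => tv.
  have bs : bounded_slice Omega M (mu tau).
    split; first by apply: measurable_density_slice; exact: in_T.
    by move=> y Sy; apply: bM => //; exact: in_T.
  by case/andP: (tv) => _ /s0 s0'; exact: (U1 _ x _ M s0' Sx M0 bs).1.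
- apply: aeW => y Sy tau /set_mem /=; rewrite in_itv /= => /andP[tau0 tauv].
  apply: cvgM.
    apply: cvgN.
    apply: (@continuous_comp R R R (fun r : R => t - r) (fun s => grad_heat s (nu x) (x - y))).
      by apply: cvgB; [exact: cvg_cst|exact: cvg_id].
    by apply: grad_heat_continuous; exact: s0.
  apply: density_time_continuous => //.
  by rewrite tau0 (lt_le_trans _ tT) // (lt_trans tauv).
- have mG : measurable_fun S (fun _ : Borel R m.+1 => G%:E) by exact: measurable_cst.
  apply/integrableP; split; first exact: mG.
  have -> : (\int[sigma]_(y in S) `|(EFin \o cst G) y| = `|G|%:E * sigma S)%E.
    by rewrite -(integral_cst sigma mS).
  rewrite lte_mul_pinfty // ?lee_fin //; exact: (surface_finite m0 alpha01 domO nuO sigmaH).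
- move=> tau /=; rewrite in_itv /= => /andP[tau0 tauv]; apply: aeW => y Sy.
  have tau_s := s0 tau tauv.
  have le : t - v <= t - tau by rewrite lerD2l lerN2 ltW.
  have powN p : 0 <= p -> (t - tau) `^ (- p) <= (t - v) `^ (- p).
    move=> p0; rewrite !powRN lef_pV2 ?posrE ?powR_gt0 //.
    by apply: ge0_ler_powR => //; rewrite nnegrE ltW.
  have := CP (t - tau) (nu x) (x - y) tau_s; rewrite powRr0 mul1r mul0r sub0r => le1.
  rewrite normrM normrN /G; apply: ler_pM => //; last by apply: bM => //; apply: in_T; rewrite tau0.
  apply: (le_trans le1); apply: ler_pM.
  + exact: (mulr_ge0 (mulr_ge0 C0 (enorm_ge0 _)) (powR_ge0 _ _)).
  + exact: scaled_bump_ge0.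
  + by apply: ler_wpM2l; [exact: (mulr_ge0 C0 (enorm_ge0 _))|exact: powN].
  + rewrite scaled_bumpE -[leRHS]mulr1; apply: ler_pM => //; [exact: powR_ge0|exact: bump_ge0| |].
      by apply: powN; rewrite divr_ge0.
    by apply: bump_le1; rewrite mulr_ge0 // ltW.
- by rewrite inE /= in_itv /= a0 av.
Qed.

Lemma Wstar_slice_op t x : Wstar sigma Omega nu mu t x =
  Rintegral leb `[0, t]%classic (fun tau => slice_op Omega nu sigma (t - tau) x (mu tau)).
Proof.
apply: eq_Rintegral => tau _; apply: eq_Rintegral => y _.
by congr (_ * _); exact: derive_heat_kernel.
Qed.

End Density.

Section Potential.
Variables (R : realType) (m : nat) (alpha T : R) (Omega : set 'rV[R]_m.+1).
Variables (nu : 'rV[R]_m.+1 -> 'rV[R]_m.+1) (sigma : {measure set (Borel R m.+1) -> \bar R}).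
Variables (mu : R -> 'rV[R]_m.+1 -> R) (M : R).
Hypotheses (m0 : (0 < m)%N) (alpha01 : 0 < alpha < 1) (domO : C1alpha_domain alpha Omega).
Hypotheses (nuO : outward_normal_field Omega nu) (sigmaH : surface_measure Omega sigma).
Hypotheses (T0 : 0 < T) (muC : C00 T Omega mu).
Hypotheses (M0 : 0 <= M) (bM : forall t y, 0 <= t <= T -> bdry Omega y -> `|mu t y| <= M).
Implicit Types (x y v w : 'rV[R]_m.+1) (s t : R).

Local Notation S := (bdry Omega : set (Borel R m.+1)).
Local Notation leb := (@lebesgue_measure R).
Local Notation W := (Wstar sigma Omega nu mu).
Local Notation J := (fun t x tau => slice_op Omega nu sigma (t - tau) x (mu tau)).
Let alpha0 : 0 < alpha. Proof. by case/andP: alpha01. Qed.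
Let a0 : 0 < alpha / 2. Proof. by rewrite divr_gt0. Qed.

Let bs tau t : 0 <= tau < t -> t <= T -> bounded_slice Omega M (mu tau).
Proof.
move=> /andP[tau0 taut] tT.
have tauT : 0 <= tau <= T by rewrite tau0 (le_trans (ltW taut)).
by split=> [|y Sy]; [exact: measurable_density_slice muC _ tauT|exact: bM].
Qed.

Let slice_integrable : exists2 C, 0 <= C & forall t x, 0 <= t <= T -> S x ->
  leb.-integrable `[0, t] (EFin \o J t x) /\
  forall tau, 0 <= tau < t -> `|J t x tau| <= C * (t - tau) `^ (alpha / 2 - 1).
Proof.
have [C C0 CP] := slice_op_le m0 alpha01 domO nuO sigmaH.
have CM : 0 <= C * M := mulr_ge0 C0 M0.
exists (C * M) => // t x tT Sx.
have bnd tau : 0 <= tau < t -> `|J t x tau| <= C * M * (t - tau) `^ (alpha / 2 - 1).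
  move=> taut; have s0 : 0 < t - tau by case/andP: taut => _; rewrite subr_gt0.
  have tT' : t <= T by case/andP: tT.
  exact: (CP (t - tau) x _ M s0 Sx M0 (bs taut tT')).2.
split => //.
(* With the cut at [T + 1] the far region is empty, and the integrable singularity alone gives
   integrability. *)
have T1 : 0 < T + 1 by rewrite addr_gt0.
have mJ := measurable_slice_op m0 alpha01 domO nuO sigmaH muC tT Sx.
apply: (@Rintegral_time_le R t T (T + 1) _ 1 1 _ 0 0 _ tT T1 a0 ltr01 ltr01 CM (lexx _) (lexx _) mJ bnd _).1.
move=> tau /andP[tau0 _] le; case/andP: tT => _ tT.
have : T + 1 <= T by rewrite (le_trans le) // lerBlDr (le_trans tT) // lerDl.
by rewrite gerDl ler10.
Qed.

Let am1 : alpha / 2 - 1 <= 0. Proof. by case/andP: alpha01 => _ a1; lra. Qed.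

Let antitone p s s' : p <= 0 -> 0 < s <= s' -> s' `^ p <= s `^ p.
Proof.
move=> p0 /andP[s0 ss']; rewrite -(opprK p) powRN [leRHS]powRN.
rewrite lef_pV2 ?posrE ?powR_gt0 // ?(lt_le_trans s0) //.
by apply: ge0_ler_powR; rewrite ?oppr_ge0 // nnegrE ltW // (lt_le_trans s0).
Qed.

Lemma Wstar_time_holder : exists2 C, 0 <= C & forall t t' x,
  0 <= t' <= t -> t <= T -> S x -> `|W t x - W t' x| <= C * (t - t') `^ (alpha / 2).
Proof.
have [C1 C10 P1] := slice_integrable.
have [C2 C20 P2] := slice_op_time m0 alpha01 domO nuO sigmaH.
(* [- b - 1] is the exponent [alpha / 2 - 2] of the time difference of kernels. Its factor h times
   h^(-b) then equals h^(alpha/2), the order of the near part. *)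
pose a := alpha / 2; pose b := 1 - alpha / 2.
have b0 : 0 < b by rewrite /b; case/andP: alpha01 => _ a1; lra.
have CM0 := mulr_ge0 C20 M0.
have K10 : 0 <= (C1 + C1) / a by apply: divr_ge0; [exact: addr_ge0|exact: ltW].
have K20 : 0 <= C2 * M / b by apply: divr_ge0; [exact: CM0|exact: ltW].
have K30 : 0 <= C1 / a by apply: divr_ge0; [exact: C10|exact: ltW].
exists ((C1 + C1) / a + C2 * M / b + C1 / a); first by rewrite !addr_ge0.
move=> t t' x /andP[t'0 t't] tT Sx.
move: t't; rewrite le_eqVlt => /predU1P[->|t't].
  by rewrite !subrr normr0 mulr_ge0 ?powR_ge0 // !addr_ge0.
have h0 : 0 < t - t' by rewrite subr_gt0.
set h := t - t' in h0 *.
have t0 : 0 <= t := le_trans t'0 (ltW t't).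
have tT' : 0 <= t <= T by rewrite t0 tT.
have t'T : 0 <= t' <= T by rewrite t'0 (le_trans (ltW t't) tT).
have [i1 b1] := P1 t x tT' Sx; have [i2 b2] := P1 t' x t'T Sx.
have i3 : leb.-integrable `[0, t'] (EFin \o J t x).
  apply: (integrableS _ _ _ i1) => //.
  by apply: subset_itvl; rewrite bnd_simp ltW.
rewrite !Wstar_slice_op.
have := @Rintegral_itvB R (J t x) (BLeft 0) (BRight t) t' i1.
rewrite !bnd_simp => /(_ t'0 (ltW t't)) split.
(* The kernels are compared on the common interval up to [t']; the remaining interval has length h,
   and there the singularity is integrated alone. *)
have -> : Rintegral leb `[0, t] (J t x) - Rintegral leb `[0, t'] (J t' x) =
   Rintegral leb `[0, t'] (fun tau => J t x tau - J t' x tau) + Rintegral leb `]t', t] (J t x).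
  by rewrite (RintegralB _ i3 i2) // -split [RHS]addrC subrKA.
apply: (le_trans (ler_normD _ _)).
have -> : ((C1 + C1) / a + C2 * M / b + C1 / a) * h `^ (alpha / 2) =
  ((C1 + C1) / a + C2 * M / b) * h `^ (alpha / 2) + (C1 / a) * h `^ (alpha / 2) by ring.
apply: lerD.
  have mj : measurable_fun `[0, t'[ (fun tau => J t x tau - J t' x tau).
    apply: measurable_funB.
      apply: (@measurable_funS _ _ _ _ `[0, t[%classic) => //.
        by apply: subset_itvl; rewrite bnd_simp ltW.
      exact: (measurable_slice_op m0 alpha01 domO nuO sigmaH muC tT' Sx).
    exact: (measurable_slice_op m0 alpha01 domO nuO sigmaH muC t'T Sx).
  have CC : 0 <= C1 + C1 := addr_ge0 C10 C10.
  have Ch : 0 <= C2 * M * h := mulr_ge0 CM0 (ltW h0).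
  have := @Rintegral_time_le R t' T h a b 1 (C1 + C1) (C2 * M * h) 0 _ t'T h0 a0 b0 ltr01 CC Ch (lexx 0) mj.
  case.
  - move=> tau /andP[tau0 taut']; have taut := lt_trans taut' t't.
    have le1 := b1 tau; rewrite tau0 taut in le1; have := le1 erefl => {}le1.
    have le2 := b2 tau; rewrite tau0 taut' in le2; have := le2 erefl => {}le2.
    apply: (le_trans (ler_normB _ _)); rewrite mulrDl; apply: (lerD _ le2).
    apply: (le_trans le1); apply: (ler_wpM2l C10); apply: (antitone am1).
    by rewrite subr_gt0 taut' lerD2r ltW.
  - move=> tau /andP[tau0 taut'] hs; rewrite mul0r addr0.
    have s0 : 0 < t' - tau by rewrite subr_gt0.
    have hh : 0 <= h <= t' - tau by rewrite hs ltW.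
    have tau_t : 0 <= tau < t' by rewrite tau0.
    have t'T' : t' <= T by case/andP: t'T.
    have := P2 (t' - tau) h x (mu tau) M s0 hh Sx M0 (bs tau_t t'T').
    have -> : t' - tau + h = t - tau by rewrite /h; ring.
    have -> : - b - 1 = alpha / 2 - 2 by rewrite /b; ring.
    by rewrite mulrA.
  move=> _; have -> : C2 * M * h / b * h `^ (- b) = C2 * M / b * h `^ (alpha / 2).
    have -> : h `^ (alpha / 2) = h * h `^ (- b).
      have := powR_mul 1 (- b) h0; rewrite (powRr1 (ltW h0)) => ->.
      by congr (_ `^ _); rewrite /b; ring.
    by rewrite mulrA (mulrAC _ h).
  by rewrite !mul0r addr0 => le1; rewrite [leRHS]mulrDl.
pose g tau := C1 * (t - tau) `^ (alpha / 2 - 1).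
have [i4 le4] : leb.-integrable `]t', t[ (EFin \o J t x) /\
    `|Rintegral leb `]t', t[ (J t x)| <= C1 / a * h `^ (alpha / 2).
  have sub : `]t', t[ `<=` (`[0, t[ : set R).
    by apply: subset_itvr; rewrite bnd_simp.
  apply: (@Rintegral_dominated _ (measurableTypeR R) R lebesgue_measure _ (J t x) g) => //.
  - apply: (measurable_funS _ sub) => //.
    exact: (measurable_slice_op m0 alpha01 domO nuO sigmaH muC tT' Sx).
  - by apply: measurable_funM => //; exact: measurable_powR_sub.
  - by move=> tau /sub /=; rewrite in_itv /= => h1; exact: b1.
  - under eq_integral => tau _ do rewrite EFinM.
    rewrite ge0_integralZl //; last 2 first.
    + by apply/measurable_EFinP; exact: measurable_powR_sub.
    + by move=> tau _; rewrite lee_fin powR_ge0.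
    rewrite -mulrA [a^-1 * _]mulrC EFinM; apply: lee_wpmul2l; first by rewrite lee_fin.
    apply: le_trans (integral_powR_sub_singular a0 t't).
    apply: ge0_subset_integral => //.
    + by apply/measurable_EFinP; exact: measurable_powR_sub.
    + by move=> tau _; rewrite lee_fin powR_ge0.
    + by apply: subset_itvr; rewrite bnd_simp.
by rewrite -(Rintegral_itv_bndo_bndc i4).
Qed.

(** The tangential bound is left as a hypothesis with a free [c] because it is supplied twice: of
    order h^(alpha/2) for a bounded density, of order h^alpha for a Hoelder one, where h is the
    distance of the two points. *)
Lemma Wstar_space_le : exists2 C, 0 <= C & forall t x x' c, 0 <= t <= T -> S x -> S x' ->
  0 < enorm (x - x') -> 0 <= c ->
  (forall tau, 0 <= tau < t -> enorm (x - x') ^+ 2 <= t - tau ->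
    `|tangential_op Omega sigma (t - tau) (nu x - nu x') x (mu tau)| <=
      c * (t - tau) `^ (alpha / 4 - 1)) ->
  `|W t x - W t x'| <= C * enorm (x - x') `^ alpha + c / (alpha / 4) * T `^ (alpha / 4).
Proof.
have [C1 C10 P1] := slice_integrable.
have [C2 C20 P2] := slice_op_space m0 alpha01 domO nuO sigmaH.
(* [- b - 1] is the exponent [alpha / 2 - 3 / 2] of the space difference. With the cut at h^2, both
   the near part and the far part, which carries a factor h, are of order h^alpha. *)
pose a := alpha / 2; pose b := 1 / 2 - alpha / 2.
have b0 : 0 < b by rewrite /b; case/andP: alpha01 => _ a1; lra.
have g0 : 0 < alpha / 4 by rewrite divr_gt0.
have CM0 := mulr_ge0 C20 M0.
have K10 : 0 <= (C1 + C1) / a by apply: divr_ge0; [exact: addr_ge0|exact: ltW].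
have K20 : 0 <= C2 * M / b by apply: divr_ge0; [exact: CM0|exact: ltW].
exists ((C1 + C1) / a + C2 * M / b); first by rewrite !addr_ge0.
move=> t x x' c tT Sx Sx'; set h := enorm (x - x') => h0 c0 tan.
have [i1 b1] := P1 t x tT Sx; have [i2 b2] := P1 t x' tT Sx'.
rewrite !Wstar_slice_op -(RintegralB _ i1 i2) //.
have mj : measurable_fun `[0, t[ (fun tau => J t x tau - J t x' tau).
  apply: measurable_funB.
    exact: (measurable_slice_op m0 alpha01 domO nuO sigmaH muC tT Sx).
  exact: (measurable_slice_op m0 alpha01 domO nuO sigmaH muC tT Sx').
have CC : 0 <= C1 + C1 := addr_ge0 C10 C10.
have Ch : 0 <= C2 * M * h := mulr_ge0 CM0 (ltW h0).
have hh : 0 < h ^+ 2 := exprn_gt0 2 h0.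
have := @Rintegral_time_le R t T (h ^+ 2) a b (alpha / 4) (C1 + C1) (C2 * M * h) c _ tT hh a0 b0 g0 CC Ch c0 mj.
case.
- move=> tau taut; apply: (le_trans (ler_normB _ _)); rewrite mulrDl.
  by apply: lerD; [exact: b1|exact: b2].
- move=> tau taut hs.
  have s0 : 0 < t - tau by case/andP: taut => _; rewrite subr_gt0.
  have tT' : t <= T by case/andP: tT.
  have := P2 (t - tau) x x' (mu tau) M s0 Sx Sx' hs M0 (bs taut tT').
  have -> : - b - 1 = alpha / 2 - 3 / 2 by rewrite /b; field.
  rewrite -/h mulrA => le1; have le2 := tan tau taut hs.
  rewrite -[X in `|X|](addrK (tangential_op Omega sigma (t - tau) (nu x - nu x') x (mu tau))).
  by apply: (le_trans (ler_normB _ _)); apply: lerD.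
move=> _; have sq p : (h ^+ 2) `^ p = h `^ (2 * p) by rewrite powRrM powR_mulrn // ltW.
rewrite !sq.
have -> : 2 * a = alpha by rewrite /a; field.
have -> : C2 * M * h / b * h `^ (2 * - b) = C2 * M / b * h `^ alpha.
  have -> : h `^ alpha = h * h `^ (2 * - b).
    have := powR_mul 1 (2 * - b) h0; rewrite (powRr1 (ltW h0)) => ->.
    by congr (_ `^ _); rewrite /b; field.
  by rewrite mulrA (mulrAC _ h).
by move=> le1; rewrite [X in _ <= X + _]mulrDl.
Qed.

End Potential.

(** * Gain of regularity in space in two passes *)

Section Regularity.
Variables (R : realType) (m : nat) (alpha T : R) (Omega : set 'rV[R]_m.+1).
Variables (nu : 'rV[R]_m.+1 -> 'rV[R]_m.+1) (sigma : {measure set (Borel R m.+1) -> \bar R}).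
Variables (mu : R -> 'rV[R]_m.+1 -> R).
Hypotheses (m0 : (0 < m)%N) (alpha01 : 0 < alpha < 1) (domO : C1alpha_domain alpha Omega).
Hypotheses (nuO : outward_normal_field Omega nu) (sigmaH : surface_measure Omega sigma).
Hypotheses (T0 : 0 < T) (muC : C00 T Omega mu).
Implicit Types (x y v w : 'rV[R]_m.+1) (s t : R).

Local Notation S := (bdry Omega : set (Borel R m.+1)).
Local Notation W := (Wstar sigma Omega nu mu).
Let alpha0 : 0 < alpha. Proof. by case/andP: alpha01. Qed.

Let bs M tau t : (forall t y, 0 <= t <= T -> bdry Omega y -> `|mu t y| <= M) ->
  0 <= tau < t -> 0 <= t <= T -> bounded_slice Omega M (mu tau).
Proof.
move=> bM /andP[tau0 taut] /andP[_ tT].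
have tauT : 0 <= tau <= T by rewrite tau0 (le_trans (ltW taut)).
by split=> [|y Sy]; [exact: measurable_density_slice muC _ tauT|exact: bM].
Qed.

(* The factor [enorm (x - x') `^ alpha] coming from the normals is halved in order to
   absorb the singularity [s^-1] of the tangential operator. *)
Lemma Wstar_space_half_holder : exists2 C, 0 <= C & forall t x x', 0 <= t <= T ->
  S x -> S x' -> `|W t x - W t x'| <= C * enorm (x - x') `^ (alpha / 2).
Proof.
have [M M0 bM] := density_bounded domO muC.
have [C1 C10 P1] := Wstar_space_le m0 alpha01 domO nuO sigmaH T0 muC M0 bM.
have [C2 C20 P2] := tangential_op_le m0 alpha01 domO nuO sigmaH.
have [K K0 tan] := normal_holder alpha01 domO nuO sigmaH.
have [D D0 bD] := bdry_bounded domO.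
have a2 : 0 <= alpha / 2 by rewrite divr_ge0 // ltW.
have CMK : 0 <= C2 * M * K := mulr_ge0 (mulr_ge0 C20 M0) K0.
pose C3 := C2 * M * K / (alpha / 4) * T `^ (alpha / 4).
have C30 : 0 <= C3.
  by apply: mulr_ge0; [apply: divr_ge0 => //; rewrite divr_ge0 // ltW|exact: powR_ge0].
have C1D : 0 <= C1 * (D + D) `^ (alpha / 2) := mulr_ge0 C10 (powR_ge0 _ _).
exists (C1 * (D + D) `^ (alpha / 2) + C3); first exact: addr_ge0.
move=> t x x' tT Sx Sx'.
have := enorm_ge0 (x - x'); rewrite le_eqVlt => /predU1P[/esym/enorm_eq0/eqP|h0].
  rewrite subr_eq0 => /eqP ->; rewrite subrr normr0.
  by apply: mulr_ge0; [exact: addr_ge0|exact: powR_ge0].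
set h := enorm (x - x') in h0 *.
have hh : h `^ alpha = h `^ (alpha / 2) * h `^ (alpha / 2).
  by rewrite (powR_mul _ _ h0); congr (_ `^ _); field.
have hD : h `^ (alpha / 2) <= (D + D) `^ (alpha / 2).
  apply: ge0_ler_powR; rewrite ?nnegrE //; [exact: ltW|exact: addr_ge0|].
  by apply: (le_trans (enormB _ _)); apply: lerD; exact: bD.
have c0 : 0 <= C2 * M * K * h `^ (alpha / 2) := mulr_ge0 CMK (powR_ge0 _ _).
have key tau : 0 <= tau < t -> h ^+ 2 <= t - tau ->
   `|tangential_op Omega sigma (t - tau) (nu x - nu x') x (mu tau)| <=
      C2 * M * K * h `^ (alpha / 2) * (t - tau) `^ (alpha / 4 - 1).
  move=> taut hs.
  have s0 : 0 < t - tau by case/andP: taut => _; rewrite subr_gt0.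
  apply: (le_trans (P2 _ (nu x - nu x') x _ M s0 Sx M0 (bs bM taut tT))).
  have -> : C2 * M * K * h `^ (alpha / 2) * (t - tau) `^ (alpha / 4 - 1) =
     C2 * M * (K * h `^ (alpha / 2) * (t - tau) `^ (alpha / 4 - 1)) by rewrite !mulrA.
  apply: (ler_wpM2l (mulr_ge0 C20 M0)).
  have hs2 : h `^ (alpha / 2) <= (t - tau) `^ (alpha / 4).
    have -> : h `^ (alpha / 2) = (h ^+ 2) `^ (alpha / 4).
      by rewrite -(powR_mulrn _ (ltW h0)) -powRrM; congr (_ `^ _); field.
    apply: ge0_ler_powR; rewrite ?nnegrE ?exprn_ge0 //; try exact: ltW.
    by rewrite divr_ge0 // ltW.
  rewrite -(powR_mul (alpha / 4) _ s0) mulrA.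
  apply: (ler_wpM2r (powR_ge0 _ _)).
  apply: (le_trans (tan x x' Sx Sx').1); rewrite -/h hh mulrA.
  exact: (ler_wpM2l (mulr_ge0 K0 (powR_ge0 _ _))).
apply: (le_trans (P1 t x x' _ tT Sx Sx' h0 c0 key)).
rewrite [leRHS]mulrDl; apply: lerD.
  rewrite -/h hh mulrA; apply: (ler_wpM2r (powR_ge0 _ _)).
  exact: (ler_wpM2l C10).
by rewrite /C3 (mulrAC _ (h `^ _)) (mulrAC _ (h `^ _)).
Qed.

(** The exponent [alpha / 2] of the density yields [alpha / 2 / 2 - 1] in time, the same
    [alpha / 4 - 1] as the cancellation. The tangential term is then integrable while the normals
    keep their full factor h^alpha. *)
Lemma Wstar_space_holder L : 0 <= L ->
  (forall t x x', 0 <= t <= T -> S x -> S x' -> `|mu t x - mu t x'| <= L * enorm (x - x') `^ (alpha / 2)) ->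
  exists2 C, 0 <= C & forall t x x', 0 <= t <= T ->
  S x -> S x' -> `|W t x - W t x'| <= C * enorm (x - x') `^ alpha.
Proof.
move=> L0 muL.
have [M M0 bM] := density_bounded domO muC.
have [C1 C10 P1] := Wstar_space_le m0 alpha01 domO nuO sigmaH T0 muC M0 bM.
have a2 : 0 <= alpha / 2 by rewrite divr_ge0 // ltW.
have [C2 C20 P2] := tangential_op_holder m0 alpha01 domO nuO sigmaH T0 a2.
have [K K0 tan] := normal_holder alpha01 domO nuO sigmaH.
have LM := addr_ge0 L0 M0.
have CMK : 0 <= C2 * (L + M) * K := mulr_ge0 (mulr_ge0 C20 LM) K0.
pose C3 := C2 * (L + M) * K / (alpha / 4) * T `^ (alpha / 4).
have C30 : 0 <= C3.
  by apply: mulr_ge0; [apply: divr_ge0 => //; rewrite divr_ge0 // ltW|exact: powR_ge0].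
exists (C1 + C3); first exact: addr_ge0.
move=> t x x' tT Sx Sx'.
have := enorm_ge0 (x - x'); rewrite le_eqVlt => /predU1P[/esym/enorm_eq0/eqP|h0].
  rewrite subr_eq0 => /eqP ->; rewrite subrr normr0.
  by apply: mulr_ge0; [exact: addr_ge0|exact: powR_ge0].
set h := enorm (x - x') in h0 *.
have c0 : 0 <= C2 * (L + M) * K * h `^ alpha := mulr_ge0 CMK (powR_ge0 _ _).
have key tau : 0 <= tau < t -> h ^+ 2 <= t - tau ->
   `|tangential_op Omega sigma (t - tau) (nu x - nu x') x (mu tau)| <=
      C2 * (L + M) * K * h `^ alpha * (t - tau) `^ (alpha / 4 - 1).
  move=> taut _; case/andP: (taut) (tT) => tau0 tau_t /andP[_ tT'].
  have sT : 0 < t - tau <= T.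
    by rewrite subr_gt0 tau_t lerBlDr (le_trans tT') // lerDl.
  have tauT : 0 <= tau <= T by rewrite tau0 (le_trans (ltW tau_t)).
  have muLx y : S y -> `|mu tau y - mu tau x| <= L * enorm (x - y) `^ (alpha / 2).
    by move=> Sy; rewrite distrC; exact: muL.
  apply: (le_trans (P2 _ (nu x - nu x') x _ M L sT Sx M0 L0 (bs bM taut tT) muLx)).
  have -> : alpha / 2 / 2 = alpha / 4 by field.
  rewrite -mulrDl mulrA; apply: (ler_wpM2r (powR_ge0 _ _)).
  rewrite (mulrAC C2 (enorm _)) -[leRHS]mulrA; apply: (ler_wpM2l (mulr_ge0 C20 LM)).
  exact: (tan x x' Sx Sx').1.
apply: (le_trans (P1 t x x' _ tT Sx Sx' h0 c0 key)).
rewrite [leRHS]mulrDl; apply: lerD => //.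
by rewrite /C3 (mulrAC _ (h `^ _)) (mulrAC _ (h `^ _)).
Qed.

End Regularity.

(** Multiplying by [2 * sgn] isolates the density, since sgn^2 = 1. *)
Lemma jump_relation_dist (R : realType) (sgn u v w z : R) : (sgn = 1 \/ sgn = -1) ->
  `|u - v| <= 2 * `|(sgn / 2 * u + w) - (sgn / 2 * v + z)| + 2 * `|w - z|.
Proof.
move=> hs; have n2 : `|2 * sgn| = 2 by case: hs => ->; rewrite ?mulr1 ?mulrN1 ?normrN normr_nat.
have -> : u - v = 2 * sgn * ((sgn / 2 * u + w) - (sgn / 2 * v + z)) - 2 * sgn * (w - z).
  by case: hs => ->; field.
by apply: (le_trans (ler_normB _ _)); rewrite !(normrM (2 * sgn)) n2.
Qed.

Theorem theorem2p9 (R : realType) (n : nat) (alpha T : R)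
  (Omega : set 'rV[R]_n) (nu : 'rV[R]_n -> 'rV[R]_n)
  (sigma : {measure set (Borel R n) -> \bar R})
  (mu : R -> 'rV[R]_n -> R) (sgn : R) :
  (2 <= n)%N -> 0 < alpha < 1 -> 0 < T ->
  C1alpha_domain alpha Omega ->
  outward_normal_field Omega nu ->
  surface_measure Omega sigma ->
  C00 T Omega mu ->
  (sgn = 1 \/ sgn = -1) ->
  C0holder alpha T Omega (fun t x => sgn / 2 * mu t x + Wstar sigma Omega nu mu t x) ->
  C0holder alpha T Omega mu.
Proof.
case: n => [//|m] in Omega nu sigma mu *; rewrite ltnS => m0 alpha01 T0 domO nuO sigmaH muC hs.
move=> [_ [Ct Pt] [Cx Px]].
have [M M0 bM] := density_bounded domO muC.
have [Wt Wt0 PWt] := Wstar_time_holder m0 alpha01 domO nuO sigmaH T0 muC M0 bM.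
have [Wx Wx0 PWx] := Wstar_space_half_holder m0 alpha01 domO nuO sigmaH T0 muC.
have [D D0 bD] := bdry_bounded domO.
have alpha0 : 0 < alpha by case/andP: alpha01.
(* The diameter bound [D + D] lowers the exponent of the data from [alpha] to [alpha / 2], to match
   what the potential is known to have at this stage. *)
have half_holder t x x' : 0 <= t <= T -> bdry Omega x -> bdry Omega x' ->
    `|mu t x - mu t x'| <=
      (2 * (`|Cx| * (D + D) `^ (alpha / 2)) + 2 * Wx) * enorm (x - x') `^ (alpha / 2).
  move=> tT Sx Sx'; apply: (le_trans (jump_relation_dist _ _
    (Wstar sigma Omega nu mu t x) (Wstar sigma Omega nu mu t x') hs)).
  have tT' : `[0, T]%classic t by rewrite /= in_itv.
  rewrite [leRHS]mulrDl; apply: lerD; rewrite -[leRHS]mulrA; apply: ler_wpM2l => //; last exact: PWx.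
  apply: (le_trans (Px t x x' tT' Sx Sx')).
  apply: (@le_trans _ _ (`|Cx| * enorm (x - x') `^ alpha)).
    by apply: ler_wpM2r; [exact: powR_ge0|exact: ler_norm].
  rewrite -mulrA; apply: ler_wpM2l => //.
  have a2 : 0 <= alpha / 2 by rewrite divr_ge0 // ltW.
  have -> : enorm (x - x') `^ alpha = enorm (x - x') `^ (alpha / 2) * enorm (x - x') `^ (alpha / 2).
    rewrite -powRD; first by congr (_ `^ _); field.
    by rewrite -splitr (gt_eqF alpha0).
  apply: ler_wpM2r; first exact: powR_ge0.
  apply: ge0_ler_powR; rewrite ?nnegrE //; [exact: enorm_ge0|exact: addr_ge0|].
  by apply: (le_trans (enormB _ _)); apply: lerD; exact: bD.
have L0 : 0 <= 2 * (`|Cx| * (D + D) `^ (alpha / 2)) + 2 * Wx.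
  by apply: addr_ge0; apply: mulr_ge0 => //; apply: mulr_ge0 => //; exact: powR_ge0.
have [Wa Wa0 PWa] := Wstar_space_holder m0 alpha01 domO nuO sigmaH T0 muC L0 half_holder.
split => //.
- exists (2 * Ct + 2 * Wt) => t s x tT sT Sx.
  apply: (le_trans (jump_relation_dist _ _
    (Wstar sigma Omega nu mu t x) (Wstar sigma Omega nu mu s x) hs)).
  rewrite [leRHS]mulrDl; apply: lerD; rewrite -[leRHS]mulrA; apply: ler_wpM2l => //; first exact: Pt.
  move: tT sT; rewrite /= !in_itv /= => /andP[t0 tT] /andP[s0 sT].
  have [st|ts] := leP s t.
    by rewrite (ger0_norm (_ : 0 <= t - s)) ?subr_ge0 //; apply: PWt => //; rewrite s0.
  rewrite distrC (distrC t) (ger0_norm (_ : 0 <= s - t)); last by rewrite subr_ge0 ltW.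
  by apply: PWt => //; rewrite t0 ltW.
- exists (2 * Cx + 2 * Wa) => t x y tT Sx Sy.
  apply: (le_trans (jump_relation_dist _ _
    (Wstar sigma Omega nu mu t x) (Wstar sigma Omega nu mu t y) hs)).
  rewrite [leRHS]mulrDl; apply: lerD; rewrite -[leRHS]mulrA; apply: ler_wpM2l => //; first exact: Px.
  by apply: PWa => //; move: tT; rewrite /= in_itv.
Qed.
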